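(* Let $G$ be a well-covered graph and let $I(G)$ be its edge ideal. If $G$ is simplicial, or $G$ is connected and contains neither $4$-cycles nor $5$-cycles, then $${\rm v}(I(G))\leq{\rm im}(G)\leq{\rm reg}(S/I(G))\leq\beta_0(G).$$
   Context: Graphs are finite and simple. Let $G$ be a graph with vertex set $V(G)=\{t_1,\ldots,t_s\}$ and edge set $E(G)$, let $K$ be a field and $S=K[t_1,\ldots,t_s]$ with the standard grading $S=\bigoplus_{d\ge0}S_d$. The edge ideal of $G$ is $I(G)=(t_it_j\mid\{t_i,t_j\}\in E(G))\subset S$. For a graded ideal $I\subset S$, ${\rm Ass}(I)$ is the set of associated primes of $S/I$, and the v-number is ${\rm v}(I)=\min\{d\geq 0\mid\exists\, f\in S_d,\ \mathfrak{p}\in{\rm Ass}(I)\text{ with }(I\colon f)=\mathfrak{p}\}$, where $(I\colon f)=\{g\in S\mid gf\in I\}$. ${\rm reg}(S/I)$ is the Castelnuovo–Mumford regularity: $\max\{j-i\mid b_{i,j}\neq0\}$, where $b_{i,j}$ are the graded Betti numbers of the minimal graded free resolution of $S/I$ over $S$. A set of vertices is stable if no two of its elements are joined by an edge; $\beta_0(G)$ is the maximum cardinality of a stable set of $G$. $G$ is well-covered if all maximal (with respect to inclusion) stable sets of $G$ have the same size. For a vertex $v$, $N_G[v]$ is the set consisting of $v$ and all its neighbors; $v$ is simplicial if the induced subgraph of $G$ on $N_G[v]$ is complete. $G$ is simplicial if every vertex of $G$ is either simplicial or adjacent to a simplicial vertex. Containing a cycle means containing it as a (not necessarily induced) subgraph.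 A matching is a set of pairwise disjoint edges; it is an induced matching of $G$ if the only edges of $G$ contained in the union of its edges are the edges of the matching. ${\rm im}(G)$ is the number of edges in a largest induced matching of $G$. *)

(* Defs.v *)
From HB Require Import structures.
From mathcomp Require Import all_boot all_order all_algebra.
From mathcomp Require Export mpoly.
From Stdlib Require Import ClassicalEpsilon.

Set Implicit Arguments.
Unset Strict Implicit.
Unset Printing Implicit Defensive.

Import GRing.Theory.
Local Open Scope ring_scope.

(* Ideals are Prop-valued predicates, as membership need not be decidable.    *)
Section Ideals.
Variable R : comNzRingType.
Implicit Types (I P : R -> Prop) (f g : R).

Definition is_ideal I : Prop :=
  [/\ I 0, forall f g, I f -> I g -> I (f + g) & forall f g, I f -> I (g * f)].

Definition is_prime_ideal P : Prop :=
  [/\ is_ideal P, ~ P 1 & forall f g, P (f * g) -> P f \/ P g].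

Definition ideal_generated_by (gens : R -> Prop) f : Prop :=
  exists (n : nat) (c g : 'I_n -> R),
    (forall k, gens (g k)) /\ f = \sum_k c k * g k.

Definition colon I f : R -> Prop := fun g => I (g * f).

(* The annihilator of the class of h in R/I is (I : h).                       *)
Definition associated_prime I P : Prop :=
  is_prime_ideal P /\ exists h, forall g, P g <-> colon I h g.

End Ideals.

Section VNumber.
Variables (K : fieldType) (s : nat).
Implicit Types I : {mpoly K[s]} -> Prop.

Definition v_degree I (d : nat) : Prop :=
  exists (f : {mpoly K[s]}) (P : {mpoly K[s]} -> Prop),
    [/\ f \is d.-homog, associated_prime I P & forall g, colon I f g <-> P g].

Definition is_vnumber I (d : nat) : Prop :=
  v_degree I d /\ forall d', v_degree I d' -> (d <= d')%N.

(* [epsilon] is unspecified when no value satisfies the predicate, so nothing *)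
(* can be proved about the minimum without proving that it exists.            *)
Definition vnumber I : nat := epsilon (inhabits 0%N) (is_vnumber I).

End VNumber.

Section Regularity.
Variables (K : fieldType) (s : nat).
Implicit Types I : {mpoly K[s]} -> Prop.

(* Data of an augmented complex of free modules over S = K[t_1, ..., t_s]     *)
(*   ... -> F_2 -> F_1 -> F_0 -> S/I,   F_i = \bigoplus_a S(- res_shift i a). *)
(* Elements of F_i are row vectors and maps act by right multiplication;      *)
(* res_aug lists representatives in S of the images in S/I of the basis of    *)
(* F_0. Ranks may be 0, so finite resolutions are included. A negative shift  *)
(* cannot occur in a minimal graded free resolution of S/I.                   *)
Record free_complex := FreeComplex {
  res_rank : nat -> nat;
  res_shift : forall i, 'I_(res_rank i) -> nat;
  res_aug : 'cV[{mpoly K[s]}]_(res_rank 0);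
  res_diff : forall i, 'M[{mpoly K[s]}]_(res_rank i.+1, res_rank i)
}.

Definition aug_map (F : free_complex) (v : 'rV_(res_rank F 0)) : {mpoly K[s]} :=
  (v *m res_aug F) 0 0.

(* The maps of the complex are homogeneous of degree 0.                       *)
Definition graded_complex (F : free_complex) : Prop :=
  (forall a, res_aug F a 0 \is (res_shift a).-homog) /\
  (forall i a b m, m \in msupp (res_diff F i a b) ->
     (mdeg m + res_shift b)%N = res_shift a).

Definition resolves_quotient I (F : free_complex) : Prop :=
  [/\ forall f, exists v : 'rV_(res_rank F 0), I (f - aug_map v),
      forall v : 'rV_(res_rank F 0),
        I (aug_map v) <-> exists w, v = w *m res_diff F 0
    & forall i (v : 'rV_(res_rank F i.+1)),
        v *m res_diff F i = 0 <-> exists w, v = w *m res_diff F i.+1].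

(* The image of F_(i+1) lies in (t_1, ..., t_s) F_i.                          *)
Definition minimal_complex (F : free_complex) : Prop :=
  forall i a b, (res_diff F i a b)@_0%MM = 0.

Definition minimal_graded_free_resolution I (F : free_complex) : Prop :=
  [/\ graded_complex F, resolves_quotient I F & minimal_complex F].

Definition betti (F : free_complex) (i j : nat) : nat :=
  #|[set a : 'I_(res_rank F i) | res_shift a == j]|.

(* r is the maximum of the j - i such that the (i, j) graded Betti number of  *)
(* S/I is nonzero, stated without truncated subtraction; the Betti numbers do *)
(* not depend on the choice of the minimal resolution F.                      *)
Definition is_regularity I (r : nat) : Prop :=
  exists F : free_complex,
    [/\ minimal_graded_free_resolution I F,
        exists i, betti F i (i + r) != 0%N
      & forall i j, betti F i j != 0%N -> (j <= i + r)%N].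

Definition regularity_quotient I : nat :=
  epsilon (inhabits 0%N) (is_regularity I).

End Regularity.

Record sgraph (s : nat) := SGraph {
  adj :> rel 'I_s;
  adj_sym : ssrbool.symmetric adj;
  adj_irr : irreflexive adj
}.

Section Graphs.
Variables (s : nat) (G : sgraph s).
Implicit Types (A B : {set 'I_s}) (M : {set {set 'I_s}}).

Definition edges : {set {set 'I_s}} :=
  [set [set p.1; p.2] | p in [pred p : 'I_s * 'I_s | G p.1 p.2]].

Definition stable A : bool := [forall x in A, forall y in A, ~~ G x y].

Definition beta0 : nat := \max_(A : {set 'I_s} | stable A) #|A|.

Definition well_covered : Prop :=
  forall A B, maxset stable A -> maxset stable B -> #|A| = #|B|.

Definition closed_nbhd (v : 'I_s) : {set 'I_s} := [set u | (u == v) || G v u].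

Definition simplicial_vertex (v : 'I_s) : Prop :=
  {in closed_nbhd v &, forall x y, x != y -> G x y}.

Definition simplicial_graph : Prop :=
  forall v, simplicial_vertex v \/ exists2 u, G v u & simplicial_vertex u.

Definition connected_graph : Prop := forall x y, connect G x y.

(* For k >= 3, a simple closed walk on k distinct vertices.                   *)
Definition contains_cycle (k : nat) : Prop :=
  exists2 c : seq 'I_s, size c = k & ucycle G c.

Definition matching M : bool := (M \subset edges) && trivIset M.

Definition induced_matching M : bool :=
  matching M && [forall e in edges, (e \subset cover M) ==> (e \in M)].

Definition induced_matching_number : nat :=
  \max_(M : {set {set 'I_s}} | induced_matching M) #|M|.

Definition edge_ideal (K : fieldType) : {mpoly K[s]} -> Prop :=
  ideal_generated_by (fun g => exists i j : 'I_s, G i j /\ g = 'X_i * 'X_j).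

End Graphs.

(* Main.v *)
From HB Require Import structures.
Require Import Defs.
From mathcomp Require Import all_boot all_order all_algebra.
From mathcomp Require Import zify.
From Stdlib Require Import ClassicalEpsilon.
Local Open Scope nat_scope.

Set Implicit Arguments.
Unset Strict Implicit.
Unset Printing Implicit Defensive.
Import GRing.Theory.

(** The bound on the v-number. If A is a stable set whose neighbourhood N(A) meets
    every edge, then the colon ideal (I(G) : f) for the product f of the variables of
    A is generated by the variables of N(A); it is prime, so v(I(G)) <= |A|
    ([nbhd_covers_v_degree]). Hence it suffices to find such an A with at most im(G)
    elements ([exists_nbhd_covers]).

    For a simplicial graph, let X be a maximal stable set of simplicial vertices and
    let A be maximal among the stable sets outside X. Each a in A has a neighbour in
    X, and as the vertices of X are simplicial these pairs form an induced matching
    ([simplicial_nbhd_covers]).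

    Now let G be connected and well-covered without 4- and 5-cycles. These properties
    except connectedness pass to what remains when a stable set is deleted together
    with its neighbours. There, being simplicial or next to a simplicial vertex
    spreads along edges, since otherwise some stable set could be completed to maximal ones
    of two different sizes ([simp_spread], [good_adj]). So if G is not
    simplicial, no vertex is simplicial or next to a simplicial one. Deleting as much
    as possible while some vertex is neither leaves a component in which all vertices
    have degree two, and it is a 7-cycle ([isolated_heptagon_exists]).
    Putting the deleted vertices back as long as a 7-cycle remains a component leaves
    at most one deleted vertex ([small_isolated_heptagon]): when putting back a vertex
    c attaches something to the cycle, then the component of the cycle has ten
    vertices, namely the cycle, c, and two neighbours u and d of c that see one cycle
    vertex and the two opposite ones, respectively ([hub_pair], [hub_nbr], [hub_nbrL],
    [hub_nbrR]); two such additions to the same cycle contradict well-coveredness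
    ([two_hubs]). By connectedness G is the 7-cycle or the ten-vertex graph, and two
    cycle vertices at distance three form the required set A
    ([connected_nbhd_covers]).

    The bounds on the regularity hold for every graph. A minimal resolution is a
    retract of every other resolution, even up to a ring endomorphism phi that fixes
    it ([minimal_shift]), so the degrees of its generators occur in every other one.
    Splitting off one vertex after another, the horseshoe lemma gives a resolution of
    S/I(G), in general not minimal, whose degrees show that reg(S/I(G)) <= beta_0(G)
    ([vars_edges_resolved]). Conversely, the Koszul complex on the edges of an induced
    matching is fixed by the endomorphism that kills all other variables, which also
    maps I(G) into the ideal of the matching, so its last generator, of degree twice
    its homological degree, occurs in every resolution of S/I(G)
    ([matching_leq_regularity]). That a minimal resolution exists at all follows from
    the same comparison: it shows that the syzygies at each stage are finitely
    generated ([compared_fin_gen]), and shortest homogeneous generating families are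
    minimal ([minimal_generators], [minimal_resolution_exists]). *)

(** * Deleting closed neighbourhoods of stable sets *)

Section GraphBasics.
Variables (s : nat) (G : sgraph s).
Implicit Types (A B S T : {set 'I_s}) (x y z : 'I_s).

Lemma adjC x y : G x y = G y x.
Proof. exact: adj_sym. Qed.

Lemma adj_neq x y : G x y -> x != y.
Proof. by move=> xy; apply: contraTneq xy => ->; rewrite adj_irr. Qed.

Lemma stableP A : reflect {in A &, forall x y, ~~ G x y} (stable G A).
Proof.
apply: (iffP forall_inP) => [h x y xA yA|h x xA].
  by move/forall_inP: (h x xA) => /(_ y yA).
by apply/forall_inP => y yA; apply: h.
Qed.

Lemma stableS A B : A \subset B -> stable G B -> stable G A.
Proof.
by move=> /subsetP AB /stableP stB; apply/stableP => x y /AB xB /AB; apply: stB.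
Qed.

Lemma no_4cycle : ~ contains_cycle G 4 -> forall a b c d,
  G a b -> G b c -> G c d -> G d a -> a != c -> b == d.
Proof.
move=> no4 a b c d ab bc cd da ac; apply: contra_notT no4 => bd.
exists [:: a; b; c; d] => //.
rewrite /ucycle /= ab bc cd da /= !inE !negb_or ac bd /=.
by rewrite (adj_neq ab) (adj_neq bc) (adj_neq cd) eq_sym (adj_neq da).
Qed.

Lemma no_5cycle : ~ contains_cycle G 5 -> forall a b c d e,
  G a b -> G b c -> G c d -> G d e -> G e a ->
  a != c -> a != d -> b != d -> b != e -> c != e -> False.
Proof.
move=> no5 a b c d e ab bc cd de ea ac ad bd be ce; apply: no5.
exists [:: a; b; c; d; e] => //.
rewrite /ucycle /= ab bc cd de ea /= !inE !negb_or ac ad bd be ce /=.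
by rewrite (adj_neq ab) (adj_neq bc) (adj_neq cd) (adj_neq de) eq_sym (adj_neq ea).
Qed.

(** [alive S] is the vertex set of the graph that remains when a stable set S
    and its neighbours are deleted; working with S instead of the remaining
    graph keeps all vertices in one type. *)
Definition alive S x := (x \notin S) && [forall y in S, ~~ G y x].

Definition simp S x :=
  alive S x && [forall y, forall z,
    [&& alive S y, alive S z, G x y, G x z & y != z] ==> G y z].

Definition good S x := simp S x || [exists y, G x y && simp S y].

Lemma alive0 x : alive set0 x.
Proof. by rewrite /alive inE; apply/forall_inP => y; rewrite inE. Qed.

Lemma alive_notin S x : alive S x -> x \notin S.
Proof. by case/andP. Qed.

Lemma alive_nadj S x y : alive S x -> y \in S -> ~~ G y x.
Proof. by case/andP => _ /forall_inP h /h. Qed.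

Lemma aliveP S x :
  reflect (forall y, y \in S -> y != x /\ ~~ G y x) (alive S x).
Proof.
apply: (iffP idP) => [al y yS|h].
  by rewrite (alive_nadj al yS); split=> //; apply: contraNneq (alive_notin al) => <-.
apply/andP; split; first by apply/negP => /h []; rewrite eqxx.
by apply/forall_inP => y /h [].
Qed.

Lemma aliveU1 S t x : alive (t |: S) x = [&& x != t, ~~ G t x & alive S x].
Proof.
apply/aliveP/and3P => [h|[xt tx al] y].
  have [tx ntx] := h t (setU11 _ _); split=> //; first by rewrite eq_sym.
  by apply/aliveP => y yS; apply: h; rewrite setU1r.
by case/setU1P => [->|]; [rewrite eq_sym | move/aliveP: al; apply].
Qed.

Lemma aliveU S T x : alive (S :|: T) x = alive S x && alive T x.
Proof.
apply/aliveP/andP => [h|[/aliveP h1 /aliveP h2] y].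
  by split; apply/aliveP => y yS; apply: h; rewrite inE yS ?orbT.
by case/setUP => [/h1|/h2].
Qed.

Lemma aliveS S T x : S \subset T -> alive T x -> alive S x.
Proof. by move/setUidPr => <-; rewrite aliveU => /andP []. Qed.

Lemma stableU1 S t : stable G S -> alive S t -> stable G (t |: S).
Proof.
move=> /stableP st al; apply/stableP => x y /setU1P [->|xS] /setU1P [->|yS].
- by rewrite adj_irr.
- by rewrite adjC (alive_nadj al).
- by rewrite (alive_nadj al).
- exact: st.
Qed.

Lemma simp_alive S x : simp S x -> alive S x.
Proof. by case/andP. Qed.

Lemma simp_adj S x y z : simp S x -> alive S y -> alive S z ->
  G x y -> G x z -> y != z -> G y z.
Proof.
case/andP => _ /forallP /(_ y) /forallP /(_ z) /implyP h ay az xy xz yz.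
by apply: h; rewrite ay az xy xz yz.
Qed.

Lemma simpI S x : alive S x ->
  (forall y z, alive S y -> alive S z -> G x y -> G x z -> y != z -> G y z) ->
  simp S x.
Proof.
move=> ax h; rewrite /simp ax /=; apply/forallP => y; apply/forallP => z.
by apply/implyP => /and5P [*]; apply: h.
Qed.

Lemma nonsimp S x y z :
  alive S y -> alive S z -> G x y -> G x z -> y != z -> ~~ G y z -> ~~ simp S x.
Proof. by move=> ay az xy xz yz; apply: contraNN => sx; apply: (simp_adj sx). Qed.

Lemma nonsimpP S x : alive S x -> ~~ simp S x ->
  exists y z, [/\ alive S y, alive S z & [/\ G x y, G x z, y != z & ~~ G y z]].
Proof.
move=> ax; rewrite /simp ax /= => /forallPn [y /forallPn [z]].
by rewrite negb_imply => /andP [/and5P [*]]; exists y, z.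
Qed.

Lemma simp_good S x : simp S x -> good S x.
Proof. by rewrite /good => ->. Qed.

Lemma adj_simp_good S x y : G x y -> simp S y -> good S x.
Proof. by move=> xy sy; apply/orP; right; apply/existsP; exists y; rewrite xy. Qed.

Lemma goodP S x :
  reflect (simp S x \/ exists2 y, G x y & simp S y) (good S x).
Proof.
apply: (iffP orP) => [[|/existsP [y /andP [xy sy]]]|[|[y xy sy]]]; try by left.
  by right; exists y.
by right; apply/existsP; exists y; rewrite xy.
Qed.

Hypothesis hwc : well_covered G.
Hypothesis no4 : ~ contains_cycle G 4.
Hypothesis no5 : ~ contains_cycle G 5.

Lemma well_covered_leq A B : maxset (stable G) A -> stable G B -> #|B| <= #|A|.
Proof.
move=> mA stB; have [C mC BC] := maxset_exists stB.
by rewrite (hwc mA mC) subset_leq_card.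
Qed.

(** Two neighbours of z with a second common neighbour close a 4-cycle. So a
    non-simplicial neighbour of z has a neighbour at distance two from z. *)
Lemma nonsimp_far_nbr S z c : alive S c -> G z c -> ~~ simp S c ->
  exists d, [/\ alive S d, G c d, d != z & ~~ G z d].
Proof.
move=> ac zc /(nonsimpP ac) [a [b [aa ab [ca cb ab' nab]]]].
have [za|nza] := boolP ((a == z) || G z a); last first.
  by exists a; move: nza; rewrite negb_or => /andP [].
have [zb|nzb] := boolP ((b == z) || G z b); last first.
  by exists b; move: nzb; rewrite negb_or => /andP [].
have nz : a != z.
  apply: contraNneq nab => az; move: zb; rewrite -az eq_sym (negbTE ab') /=.
  by [].
have nzb : b != z.
  by apply: contraNneq nab => bz; move: za; rewrite -bz (negbTE ab') /= adjC.
move: za zb; rewrite (negbTE nz) (negbTE nzb) /= => za zb.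
suff /eqP E : a == b by rewrite E eqxx in ab'.
apply: (no_4cycle no4 za) (adj_neq zc); rewrite ?(adjC a) ?(adjC b) //.
Qed.

(** Deleting such far neighbours, one for each neighbour c of z outside N[p],
    leaves a stable set S' after which x, p, z form an induced path; then p on
    the one side, and x with z on the other, extend S' to stable sets of
    different sizes. *)
Lemma simp_spread S x p z : stable G S -> simp S x -> alive S p -> alive S z ->
  G x p -> G p z -> z != x -> ~~ G x z -> exists2 c, G z c & simp S c.
Proof.
move=> stS sx ap az xp pz zx nxz.
apply/exists_inP; apply: contraT => /exists_inPn nos.
pose far c d := [&& alive S d, G c d, d != z & ~~ G z d].
pose f c := odflt p [pick d | far c d].
pose C := [set c | [&& G z c, alive S c, c != p & ~~ G p c]].
have fP c : c \in C -> far c (f c).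
  rewrite inE => /and4P [zc ac _ _]; rewrite /f; case: pickP => //= h.
  have [d [ad cd dz nzd]] := nonsimp_far_nbr ac zc (nos c zc).
  by move: (h d); rewrite /far ad cd dz nzd.
have fp c : c \in C -> f c != p /\ ~~ G (f c) p.
  move=> cC; have /and4P [ad cd dz nzd] := fP c cC.
  move: cC; rewrite inE => /and4P [zc ac cp npc].
  split; first by apply: contraNneq npc => <-; rewrite adjC.
  apply/negP => dp; have := no_4cycle no4 zc cd dp pz.
  by rewrite eq_sym dz (negbTE cp) => /(_ isT).
pose B0 := S :|: f @: C.
have stB0 : stable G B0.
  apply/stableP => a b /setUP [aS|/imsetP [c cC ->]] /setUP [bS|/imsetP [c' cC' ->]].
  - by move/stableP: stS; apply.
  - by have /and4P [ad _ _ _] := fP c' cC'; apply: alive_nadj ad aS.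
  - by have /and4P [ad _ _ _] := fP c cC; rewrite adjC; apply: alive_nadj ad bS.
  have /and4P [ad cd dz nzd] := fP c cC; have /and4P [ad' cd' dz' nzd'] := fP c' cC'.
  apply/negP => dd; have [E|ncc] := eqVneq c c'.
    by rewrite E adj_irr in dd.
  move: cC cC'; rewrite !inE => /and4P [zc _ _ _] /and4P [zc' _ _ _].
  rewrite adjC in cd'; rewrite adjC in zc'.
  apply: (no_5cycle no5 zc cd dd cd' zc') => //; rewrite 1?eq_sym //.
    by apply: contraNneq nzd' => ->.
  by apply: contraNneq nzd => <-; rewrite adjC.
have aB0 y : alive S y -> (forall c, c \in C -> f c != y /\ ~~ G (f c) y) -> alive B0 y.
  by move=> ay h; rewrite aliveU ay /=; apply/aliveP => _ /imsetP [c cC ->]; apply: h.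
have aB0p := aB0 p ap fp.
have [B mB pB] := maxset_exists (stableU1 stB0 aB0p).
have [stB _] := maxsetP mB; have /stableP nB := stB.
have {}pB b : b \in p |: B0 -> b \in B by move/subsetP: pB; apply.
have pinB : p \in B by apply: pB; rewrite setU11.
have SB b : b \in S -> b \in B by move=> bS; apply: pB; rewrite !inE bS orbT.
have aliveB b : b \in B -> b \notin S -> alive S b.
  by move=> bB bS; rewrite /alive bS /=; apply/forall_inP => y /SB yB; apply: nB.
have xB b : b \in B :\ p -> ~~ G x b.
  case/setD1P => bp bB; apply/negP => xb; have [bS|bS] := boolP (b \in S).
    by have := alive_nadj (simp_alive sx) bS; rewrite adjC xb.
  have := nB b p bB pinB; rewrite (simp_adj sx _ ap xb xp bp) //.
  exact: aliveB.
have zB b : b \in B :\ p -> ~~ G z b.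
  case/setD1P => bp bB; apply/negP => zb; have [bS|bS] := boolP (b \in S).
    by have := alive_nadj az bS; rewrite adjC zb.
  have bC : b \in C by rewrite inE zb aliveB // bp nB.
  have /and4P [_ bf _ _] := fP b bC; apply/negP: bf; apply: nB bB _.
  by apply: pB; rewrite !inE imset_f ?orbT.
have stD : stable G (x |: (z |: (B :\ p))).
  apply/stableP => a b /setU1P [->|/setU1P [->|aB]] /setU1P [->|/setU1P [->|bB]];
    rewrite ?adj_irr ?(negbTE nxz) //.
  - exact: xB.
  - by rewrite adjC (negbTE nxz).
  - exact: zB.
  - by rewrite adjC xB.
  - by rewrite adjC zB.
  by case/setD1P: aB => _ aB; case/setD1P: bB => _ bB; apply: nB.
have zNB : z \notin B :\ p.
  by apply/negP => /setD1P [_ zB']; have := nB p z pinB zB'; rewrite pz.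
have xNB : x \notin z |: (B :\ p).
  rewrite !inE negb_or eq_sym zx /=; apply/negP => /andP [_ xB'].
  by have := nB x p xB' pinB; rewrite xp.
have := well_covered_leq mB stD.
have := cardsU1 x (z |: (B :\ p)); have := cardsU1 z (B :\ p); have := cardsD1 p B.
by rewrite xNB zNB pinB => -> -> ->; rewrite !add1n ltnn.
Qed.

(** So the vertices that are simplicial or next to a simplicial one fill whole
    components of what remains. *)
Lemma good_adj S v w : stable G S -> good S v -> alive S v -> alive S w ->
  G v w -> good S w.
Proof.
move=> stS gv av aw vw; case/goodP: gv => [sv|[x vx sx]].
  by apply: adj_simp_good sv; rewrite adjC.
have [->|wx] := eqVneq w x; first exact: simp_good.
have [xw|nxw] := boolP (G x w); first by apply: adj_simp_good sx; rewrite adjC.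
have xv : G x v by rewrite adjC.
by have [c wc sc] := simp_spread stS sx av aw xv vw wx nxw; apply: adj_simp_good sc.
Qed.

Local Open Scope ring_scope.

(** * The heptagon and what is attached to it *)

(** The explicit list makes statements about all elements of Z/7 computable. *)
Definition Z7 : seq 'Z_7 := [seq inZp i | i <- iota 0 7].

Lemma Z7_all (P : pred 'Z_7) : all P Z7 -> forall i, P i.
Proof.
move=> /allP h i; apply: h; rewrite -(valZpK i); apply: map_f.
by rewrite mem_iota /=; apply: ltn_ord.
Qed.

Definition cyc7 (i j : 'Z_7) : bool := (j == i + 1) || (i == j + 1).

Lemma cyc7_rot (p i j : 'Z_7) : cyc7 (p + i) (p + j) = cyc7 i j.
Proof. by rewrite /cyc7 -!addrA !(inj_eq (addrI p)). Qed.

Lemma cyc7_opp (i j : 'Z_7) : cyc7 (- i) (- j) = cyc7 i j.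
Proof.
apply/eqP; move: j; apply: Z7_all; move: i; apply: Z7_all; by vm_compute.
Qed.

Definition heptagon T (v : 'Z_7 -> 'I_s) : Prop :=
  [/\ stable G T, forall i, alive T (v i) & forall i j, G (v i) (v j) = cyc7 i j].

Lemma heptagon_rot T v p : heptagon T v -> heptagon T (fun i => v (p + i)).
Proof. by case=> st al ad; split=> // i j; rewrite ad cyc7_rot. Qed.

Lemma heptagon_opp T v : heptagon T v -> heptagon T (fun i => v (- i)).
Proof. by case=> st al ad; split=> // i j; rewrite ad cyc7_opp. Qed.

Definition attached T (v : 'Z_7 -> 'I_s) y i : bool :=
  [&& alive T y, [forall j, v j != y] & G (v i) y].

Section Heptagon.
Variables (T : {set 'I_s}) (v : 'Z_7 -> 'I_s).
Hypothesis hv : heptagon T v.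

Lemma hept_st : stable G T. Proof. by case: hv. Qed.
Lemma hept_al i : alive T (v i). Proof. by case: hv. Qed.
Lemma hept_adj i j : G (v i) (v j) = cyc7 i j. Proof. by case: hv. Qed.

Lemma hept_inj i j : (v i == v j) = (i == j).
Proof.
apply/eqP/eqP => [E|-> //].
have h k : cyc7 i k = cyc7 j k by rewrite -!hept_adj E.
have: all (fun k => cyc7 i k == cyc7 j k) Z7 by apply/allP => k _; rewrite h.
move=> H; apply/eqP; move: H; apply/implyP; clear; move: j; apply: Z7_all; move: i.
by apply: Z7_all; vm_compute.
Qed.

Lemma hept_nbr i j k y : j == i + 1 -> k == i - 1 -> alive T y -> G (v i) y ->
  [\/ y = v j, y = v k | attached T v y i].
Proof.
move=> /eqP -> /eqP -> ay iy.
have [/existsP [l /eqP E]|nE] := boolP [exists l, v l == y]; last first.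
  by rewrite /attached ay iy andbT -negb_exists; constructor 3.
move: iy; rewrite -E hept_adj => /orP [/eqP -> |/eqP ->]; first by constructor 1.
by rewrite addrK; constructor 2.
Qed.

Lemma attached_adj y i : attached T v y i -> G (v i) y.
Proof. by case/and3P. Qed.

Lemma attached_al y i : attached T v y i -> alive T y.
Proof. by case/and3P. Qed.

Lemma attached_neq y i j : attached T v y i -> v j != y.
Proof. by case/and3P => _ /forallP. Qed.

Lemma attachedI y i j : attached T v y i -> attached T v y j = G (v j) y.
Proof. by case/and3P => ay ny _; rewrite /attached ay ny. Qed.

(** Cycle vertices that are not neighbours are joined by a path of length two or
    three, which y would close to a 4- or 5-cycle. *)
Lemma attached_one y i j : attached T v y i -> attached T v y j -> i != j -> cyc7 i j.
Proof.
move=> yi yj ij; apply: contraT => nij.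
have: [|| i == j, cyc7 i j, has (fun k => cyc7 i k && cyc7 k j) Z7 |
    has (fun k => has (fun l =>
      [&& cyc7 i k, cyc7 k l, cyc7 l j, i != l & k != j]) Z7) Z7].
  by clear; move: j; apply: Z7_all; move: i; apply: Z7_all; vm_compute.
rewrite (negbTE ij) (negbTE nij) !orFb => /orP [/hasP [k _ /andP [ik kj]]|].
  have := @no_4cycle no4 y (v i) (v k) (v j).
  rewrite !hept_adj ik kj (attached_adj yj) adjC (attached_adj yi).
  rewrite eq_sym (attached_neq k yi) hept_inj (negbTE ij).
  by move=> /(_ isT isT isT isT isT).
case/hasP => k _ /hasP [l _ /and5P [ik kl lj il kj]].
have := @no_5cycle no5 y (v i) (v k) (v l) (v j).
rewrite !hept_adj !hept_inj ik kl lj il kj ij (attached_adj yj) adjC (attached_adj yi).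
rewrite eq_sym (attached_neq k yi) eq_sym (attached_neq l yi).
by case.
Qed.

(** Otherwise c, y, z and the cycle vertices form a 4- or 5-cycle. *)
Lemma common_nbr_far c y z i j : (forall i, v i != c) -> G c y -> G c z ->
  attached T v y i -> attached T v z j -> (i == j) || cyc7 i j -> y = z.
Proof.
move=> nc cy cz yi zj /orP [/eqP E|ij].
  apply/eqP; apply: (no_4cycle no4 cy (c := v i)).
  - by rewrite adjC (attached_adj yi).
  - by rewrite E (attached_adj zj).
  - by rewrite adjC.
  by rewrite eq_sym nc.
apply/eqP/contraT => yz; exfalso.
apply: (@no_5cycle no5 c y (v i) (v j) z) => //.
- by rewrite adjC (attached_adj yi).
- by rewrite hept_adj.
- exact: attached_adj zj.
- by rewrite adjC.
- by rewrite eq_sym nc.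
- by rewrite eq_sym nc.
- by rewrite eq_sym (attached_neq j yi).
exact: attached_neq zj.
Qed.

(** At cycle distance one or two, the edge would close a 4- or 5-cycle. *)
Lemma attached_edge y z i j : attached T v y i -> attached T v z j -> G y z ->
  ~~ [|| cyc7 i j, j == i + 2 | i == j + 2].
Proof.
have dist2 y' z' a b : attached T v y' a -> attached T v z' b -> G y' z' ->
    b == a + 2 -> False.
  move=> ya zb yz /eqP E.
  apply: (@no_5cycle no5 y' (v a) (v (a + 1)) (v b) z').
  - by rewrite adjC (attached_adj ya).
  - by rewrite hept_adj /cyc7 eqxx.
  - by rewrite hept_adj /cyc7 E -addrA (_ : 1 + 1 = 2) ?eqxx //; apply: val_inj.
  - exact: attached_adj zb.
  - by rewrite adjC.
  - by rewrite eq_sym (attached_neq _ ya).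
  - by rewrite eq_sym (attached_neq _ ya).
  - by rewrite hept_inj E -subr_eq0 opprD addrA subrr.
  - exact: attached_neq zb.
  exact: attached_neq zb.
move=> yi zj yz; apply/negP => /or3P [ij|d2|d2].
- have yv : G y (v i) by rewrite adjC (attached_adj yi).
  have vv : G (v i) (v j) by rewrite hept_adj.
  have zy : G z y by rewrite adjC.
  have := no_4cycle no4 yv vv (attached_adj zj) zy.
  by rewrite eq_sym (attached_neq j yi) (negbTE (attached_neq i zj)) => /(_ isT).
- exact: dist2 yi zj yz d2.
by apply: dist2 zj yi _ d2; rewrite adjC.
Qed.

Lemma hept_nonsimp i : ~~ simp T (v i).
Proof.
apply: (@nonsimp T (v i) (v (i + 1)) (v (i - 1))); rewrite ?hept_al ?hept_adj ?hept_inj //.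
- by rewrite /cyc7 eqxx.
- by rewrite /cyc7 subrK eqxx orbT.
- by move: i; apply: Z7_all; vm_compute.
by move: i; apply: Z7_all; vm_compute.
Qed.

(** A good vertex makes the whole cycle good, and as no cycle vertex is simplicial,
    each of them needs a simplicial neighbour off the cycle. *)
Lemma hept_good i : good T (v i) -> forall j, exists2 y, attached T v y j & simp T y.
Proof.
move=> gi; have gk (k : nat) : good T (v (i + k%:R)).
  elim: k => [|k IH]; first by rewrite addr0.
  apply: good_adj hept_st IH _ _ _; rewrite ?hept_al // hept_adj /cyc7.
  by rewrite -natr1 addrA eqxx.
move=> j; have := gk (val (j - i)); rewrite natr_Zp addrC subrK.
case/goodP => [sj|[y jy sy]]; first by case/negP: (hept_nonsimp j).
exists y => //; case: (hept_nbr (eqxx _) (eqxx _) (simp_alive sy) jy) => // E.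
  by rewrite E (negbTE (hept_nonsimp _)) in sy.
by rewrite E (negbTE (hept_nonsimp _)) in sy.
Qed.
End Heptagon.

Lemma heptagon_killed T v k i y : heptagon T v -> alive (v k |: T) y -> y = v i ->
  cyc7 k i || (i == k) -> False.
Proof.
move=> hv; rewrite aliveU1 => /and3P [yk gky _] E.
rewrite E (hept_inj hv) (hept_adj hv) in yk gky.
by rewrite (negbTE yk) (negbTE gky).
Qed.

(** Deleting N[v 1] turns the cycle into the path v 3, v 4, v 5, v 6. If its end
    v 6 becomes simplicial, then v 4 must become simplicial or get a simplicial
    neighbour. But v 4 and v 5 lie inside the path, and v 3 sees v 4 and u. *)
Lemma attached_next T v u : heptagon T v -> simp (v 1 |: T) (v 6) ->
  attached T v u 3 -> ~~ G (v 1) u -> exists y, attached T v y 4.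
Proof.
move=> hv s6 u3 n1; apply/existsP; apply: contraT => /existsPn no4'.
have al i : alive T (v i) := hept_al hv i.
have aT i : i != 1 -> ~~ cyc7 1 i -> alive (v 1 |: T) (v i).
  by move=> i1 n; rewrite aliveU1 al (hept_inj hv) i1 (hept_adj hv) n.
have st1 := stableU1 (hept_st hv) (al 1).
have au : alive (v 1 |: T) u.
  by rewrite aliveU1 n1 (attached_al u3) eq_sym (attached_neq 1 u3).
have g4 : good (v 1 |: T) (v 4).
  apply: (good_adj st1 (v := v 5)); rewrite ?aT ?(hept_adj hv) //.
  by apply: adj_simp_good s6; rewrite (hept_adj hv).
have n3 : ~~ simp (v 1 |: T) (v 3).
  apply: (@nonsimp _ _ (v 4) u) (aT 4 isT isT) au _ (attached_adj u3) _ _.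
  - by rewrite (hept_adj hv).
  - exact: attached_neq u3.
  by apply/negP => h; case/negP: (no4' u); rewrite (attachedI _ u3).
have n5 : ~~ simp (v 1 |: T) (v 5).
  by apply: (@nonsimp _ _ (v 4) (v 6)); rewrite ?aT ?(hept_adj hv) ?(hept_inj hv).
have n4 : ~~ simp (v 1 |: T) (v 4).
  by apply: (@nonsimp _ _ (v 3) (v 5)); rewrite ?aT ?(hept_adj hv) ?(hept_inj hv).
case/goodP: g4 => [s4|[y y4 sy]]; first by rewrite s4 in n4.
have ayT := aliveS (subsetUr _ _) (simp_alive sy).
case: (hept_nbr (i := 4) (j := 5) (k := 3) hv isT isT ayT y4) => [E|E|h].
- by rewrite -E sy in n5.
- by rewrite -E sy in n3.
by case/negP: (no4' y).
Qed.

(** If nothing is attached at v 6, then v 5 is all that v 6 sees after deleting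
    N[v 1], and the preceding lemma applies. *)
Lemma attached_partner T v u : heptagon T v -> attached T v u 3 -> ~~ G (v 1) u ->
  (exists y, attached T v y 4) \/ exists y, attached T v y 6.
Proof.
move=> hv u3 n1.
have [/existsP|/existsPn no6] := boolP [exists y, attached T v y 6]; first by right.
left; apply: attached_next (u3) n1 => //.
have a6 : alive (v 1 |: T) (v 6) by rewrite aliveU1 (hept_al hv) (hept_inj hv) (hept_adj hv).
apply: simpI a6 _ => y z ay az y6 z6.
suff E x : alive (v 1 |: T) x -> G (v 6) x -> x = v 5.
  by rewrite (E y ay y6) (E z az z6) eqxx.
move=> ax x6; have axT := aliveS (subsetUr _ _) ax.
case: (hept_nbr (i := 6) (j := 0) (k := 5) hv isT isT axT x6) => // [E|h].
  by case: (heptagon_killed hv ax E isT).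
by case/negP: (no6 x).
Qed.

(** * A heptagon isolated by deleting one more vertex *)

(** The situation after an inclusion-minimal choice: c is the only vertex that
    has to be deleted, besides R, to make the heptagon a component. *)
Section Hub.
Variables (R : {set 'I_s}) (v : 'Z_7 -> 'I_s) (c : 'I_s).
Definition hub : Prop :=
  [/\ heptagon R v, alive R c, forall i, ~~ G c (v i) &
      forall y i, attached R v y i -> G c y].
End Hub.

Lemma hub_rot R v c p : hub R v c -> hub R (fun i => v (p + i)) c.
Proof.
case=> hv ac cv ch; split=> //; first exact: heptagon_rot.
move=> y i /and3P [ay /forallP ny iy]; apply: (ch y (p + i)).
rewrite /attached ay iy andbT; apply/forallP => j.
by have := ny (j - p); rewrite addrC subrK.
Qed.

Lemma hub_opp R v c : hub R v c -> hub R (fun i => v (- i)) c.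
Proof.
case=> hv ac cv ch; split=> //; first exact: heptagon_opp.
move=> y i /and3P [ay /forallP ny iy]; apply: (ch y (- i)).
rewrite /attached ay iy andbT; apply/forallP => j.
by have := ny (- j); rewrite opprK.
Qed.

Section HubTheory.
Variables (R : {set 'I_s}) (v : 'Z_7 -> 'I_s) (c : 'I_s).
Hypothesis hh : hub R v c.
Let hv : heptagon R v. Proof. by case: hh. Qed.
Let ac : alive R c. Proof. by case: hh. Qed.
Let cv i : ~~ G c (v i). Proof. by case: hh. Qed.
Let ch y i : attached R v y i -> G c y. Proof. by case: hh => _ _ _; apply. Qed.

Lemma hub_out i : v i != c.
Proof.
apply: contraNneq (cv (i + 1)) => <-.
by rewrite (hept_adj hv) /cyc7 eqxx.
Qed.

Lemma attached_far y z i j : attached R v y i -> attached R v z j ->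
  (i == j) || cyc7 i j -> y = z.
Proof.
by move=> yi zj; exact: (common_nbr_far hv hub_out (ch yi) (ch zj) yi zj).
Qed.

Lemma attachedS T y i : R \subset T -> attached T v y i -> attached R v y i.
Proof. by move=> RT /and3P [ay ny iy]; rewrite /attached (aliveS RT ay) ny iy. Qed.

(** Every cycle vertex would need an attached simplicial neighbour. Those at v 0, v 1
    and v 2 coincide by attached_far, but no attached vertex sees v 0 and v 2. *)
Lemma hub_not_good T i : R \subset T -> stable G T -> (forall j, alive T (v j)) ->
  ~~ good T (v i).
Proof.
move=> RT stT aT; have hT : heptagon T v by split=> // j k; rewrite (hept_adj hv).
apply/negP => gi; have [y y0 _] := hept_good hT gi 0.
have [z z1 _] := hept_good hT gi 1; have [t t2 _] := hept_good hT gi 2.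
have Eyz := attached_far (attachedS RT y0) (attachedS RT z1) isT.
have Ezt := attached_far (attachedS RT z1) (attachedS RT t2) isT.
by have := attached_one hT y0; rewrite Eyz Ezt => /(_ _ t2 isT).
Qed.

Lemma hub_aliveU1 t y : alive R y -> y != t -> ~~ G t y -> alive (t |: R) y.
Proof. by rewrite aliveU1 => -> -> ->. Qed.

Lemma hub_alive_vU1 k i : i != k -> ~~ cyc7 k i -> alive (v k |: R) (v i).
Proof.
by move=> ik n; rewrite hub_aliveU1 ?(hept_al hv) ?(hept_inj hv) ?(hept_adj hv).
Qed.

(** Two non-adjacent neighbours that y had before the deletion of N[t] cannot both
    survive it. *)
Lemma new_simp t y : simp (t |: R) y -> ~~ simp R y ->
  exists x, [/\ alive R x, G y x & G t x].
Proof.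
move=> sy ny; have := simp_alive sy; rewrite aliveU1 => /and3P [yt gty ay].
have [a [b [aa ab [ya yb nab gab]]]] := nonsimpP ay ny.
have lost x : alive R x -> G y x -> ~~ alive (t |: R) x -> G t x.
  move=> ax yx; rewrite aliveU1 ax andbT negb_and !negbK => /orP [/eqP E|//].
  by move: gty; rewrite adjC -E yx.
have [la|la] := boolP (alive (t |: R) a); last by exists a; split=> //; apply: lost.
have [lb|lb] := boolP (alive (t |: R) b); last by exists b; split=> //; apply: lost.
by rewrite (simp_adj sy la lb ya yb nab) in gab.
Qed.

Lemma attachedI' y i : alive R y -> (forall j, v j != y) -> G (v i) y -> attached R v y i.
Proof. by move=> ay ny iy; rewrite /attached ay iy andbT; apply/forallP. Qed.

Lemma in_cycle y : (forall j, v j != y) \/ exists j, y = v j.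
Proof.
have [/existsP [j /eqP <-]|h] := boolP [exists j, v j == y]; first by right; exists j.
by left => j; move: h; rewrite negb_exists => /forallP /(_ j).
Qed.

Lemma hub_c_aliveU1 i : alive (v i |: R) c.
Proof. by rewrite hub_aliveU1 // 1?eq_sym ?hub_out // adjC. Qed.

(** With N[v 0] deleted, the end v 2 of the remaining path is simplicial, so d
    needs a new simplicial neighbour. This neighbour has lost a vertex next to v 0,
    and the absence of 4- and 5-cycles identifies it with c. *)
Lemma hub_double d : attached R v d 3 -> attached R v d 4 ->
  (exists a, attached R v a 0) /\ simp (v 0 |: R) c.
Proof.
move=> d3 d4.
have dat j : attached R v d j -> (j == 3) || (j == 4).
  move=> dj; apply: contraT; rewrite negb_or => /andP [n3 n4].
  have := attached_one hv d3 dj; have := attached_one hv d4 dj.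
  rewrite eq_sym n4 eq_sym n3 => /(_ isT) j4 /(_ isT) j3.
  have : ~~ (cyc7 4 j && cyc7 3 j) by move: (j); apply: Z7_all; vm_compute.
  by rewrite j4 j3.
have gd j : j != 3 -> j != 4 -> ~~ G (v j) d.
  move=> n3 n4; apply/negP => h; have := dat j.
  by rewrite (attachedI _ d3) h (negbTE n3) (negbTE n4) => /(_ isT).
have RT : R \subset v 0 |: R := subsetUr _ _.
have stT := stableU1 (hept_st hv) (hept_al hv 0).
have ad : alive (v 0 |: R) d.
  by rewrite hub_aliveU1 ?(attached_al d3) ?gd // eq_sym (attached_neq 0 d3).
have aT := @hub_alive_vU1 0.
have s2 : simp (v 0 |: R) (v 2).
  apply: simpI (aT 2 isT isT) _ => y z ay az y2 z2.
  suff E x : alive (v 0 |: R) x -> G (v 2) x -> x = v 3.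
    by rewrite (E y ay y2) (E z az z2) eqxx.
  move=> ax x2.
  case: (hept_nbr (i := 2) (j := 3) (k := 1) hv isT isT (aliveS RT ax) x2) => // [E|h].
    by move: ax; rewrite E aliveU1 (hept_adj hv) => /and3P [_ /negP/(_ isT)].
  by have E := attached_far h d3 isT; move: h; rewrite E (attachedI _ d3) (negbTE (gd 2 isT isT)).
have g3 : good (v 0 |: R) (v 3) by apply: adj_simp_good s2; rewrite (hept_adj hv).
have {g3} := good_adj stT g3 (aT 3 isT isT) ad (attached_adj d3).
have n3 : ~~ simp (v 0 |: R) (v 3).
  by apply: (@nonsimp _ _ (v 2) (v 4)); rewrite ?aT ?(hept_adj hv) ?(hept_inj hv).
have n4 : ~~ simp (v 0 |: R) (v 4).
  by apply: (@nonsimp _ _ (v 3) (v 5)); rewrite ?aT ?(hept_adj hv) ?(hept_inj hv).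
have nd : ~~ simp (v 0 |: R) d.
  apply: (@nonsimp _ _ (v 3) c); rewrite ?aT ?hub_c_aliveU1 ?hub_out //.
  - by rewrite adjC (attached_adj d3).
  - by rewrite adjC (ch d3).
  by rewrite adjC.
case/goodP => [sd|[y dy sy]]; first by rewrite sd in nd.
have ay := simp_alive sy.
have [ny|[j E]] := in_cycle y; last first.
  have /dat : attached R v d j by rewrite (attachedI _ d3) adjC -E.
  by case/orP => /eqP Ej; rewrite E Ej ?(negbTE n3) ?(negbTE n4) in sy.
have nsy : ~~ simp R y.
  have := hub_not_good 3 (subxx R) (hept_st hv) (hept_al hv); apply: contraNN => sRy.
  apply: (good_adj (hept_st hv) (v := d)); rewrite ?(hept_al hv) ?(attached_al d3) //.
    exact: adj_simp_good sRy.
  by rewrite adjC (attached_adj d3).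
have [x [ax yx x0]] := new_simp sy nsy.
have ayR := aliveS RT ay.
have yat j : G y (v j) -> attached R v y j by move=> h; apply: attachedI'; rewrite // adjC.
case: (hept_nbr (i := 0) (j := 1) (k := 6) hv isT isT ax x0) => [E|E|xa].
- have y1 : attached R v y 1 by apply: yat; rewrite -E.
  exfalso; apply: (@no_5cycle no5 y (v 1) (v 2) (v 3) d);
    rewrite ?(hept_adj hv) ?(hept_inj hv) ?(attached_neq _ d3) ?(attached_adj d3) //.
  + by rewrite -E.
  + by rewrite eq_sym.
  by rewrite eq_sym.
- have y1 : attached R v y 6 by apply: yat; rewrite -E.
  exfalso; apply: (@no_5cycle no5 y (v 6) (v 5) (v 4) d);
    rewrite ?(hept_adj hv) ?(hept_inj hv) ?(attached_neq _ d3) ?(attached_adj d4) //.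
  + by rewrite -E.
  + by rewrite eq_sym.
  by rewrite eq_sym.
split; first by exists x.
suff <- : y = c by [].
apply/eqP; apply: (no_4cycle no4 dy yx _ (ch d3)).
  by rewrite adjC (ch xa).
by apply: contraTneq x0 => <-; apply: gd.
Qed.

End HubTheory.

Lemma attached_rot R v y p i : attached R (fun j => v (p + j)) y i = attached R v y (p + i).
Proof.
rewrite /attached; congr [&& _, _ & _]; apply/forallP/forallP => h j; last exact: h.
by have := h (j - p); rewrite /= addrC subrK.
Qed.

Lemma attached_opp R v y i : attached R (fun j => v (- j)) y i = attached R v y (- i).
Proof.
rewrite /attached; congr [&& _, _ & _]; apply/forallP/forallP => h j; last exact: h.
by have := h (- j); rewrite /= opprK.
Qed.

(** The other alternative in attached_partner would attach a vertex next to v 0, and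
    this vertex would be u. *)
Lemma hub_single R v c u : hub R v c -> attached R v u 0 -> ~~ G (v 1) u -> ~~ G (v 6) u ->
  exists d, attached R v d 3.
Proof.
move=> hh u0 n1 n6; have [hv _ _ _] := hh.
pose w i := v (4 + i).
have u3 : attached R w u 3 by rewrite /w attached_rot (_ : 4 + 3 = 0) //; apply: val_inj.
have nw1 : ~~ G (w 1) u.
  apply/negP => h; have := attached_one hv u0 (j := 4 + 1).
  by rewrite (attachedI _ u0) -[G _ _]/(G (w 1) u) h => /(_ isT isT).
have [[y]|[y]] := attached_partner (heptagon_rot 4 hv) u3 nw1.
  rewrite attached_rot (_ : 4 + 4 = 1); last exact: val_inj.
  move=> y1; have E := attached_far hh u0 y1 isT.
  by move: n1; rewrite E (attached_adj y1).
by rewrite attached_rot (_ : 4 + 6 = 3); [exists y | apply: val_inj].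
Qed.

(** If u sees two cycle vertices, hub_double gives the opposite one. If u sees only
    v i, then hub_single and its mirror image give vertices attached at the two
    vertices opposite to v i, and these coincide by attached_far. *)
Lemma hub_pair R v c u i : hub R v c -> attached R v u i -> exists p x d,
  let w j := v (p + j) in
  [/\ attached R w x 0, attached R w d 3 & attached R w d 4].
Proof.
move=> hh ui.
have dbl p : attached R (fun j => v (p + j)) u 3 -> attached R (fun j => v (p + j)) u 4 ->
    exists p x d, let w j := v (p + j) in
  [/\ attached R w x 0, attached R w d 3 & attached R w d 4].
  move=> u3 u4; have [[x x0] _] := hub_double (hub_rot p hh) u3 u4.
  by exists p, x, u.
have [gp|n1] := boolP (G (v (i + 1)) u).
  apply: (dbl (i - 3)); rewrite attached_rot ?subrK // -addrA.
  by rewrite (attachedI _ ui) (_ : - 3 + 4 = 1) //; apply: val_inj.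
have [gm|n6] := boolP (G (v (i - 1)) u).
  apply: (dbl (i - 4)); rewrite attached_rot ?subrK // -addrA.
  by rewrite (attachedI _ ui) (_ : - 4 + 3 = -1) //; apply: val_inj.
have hw := hub_rot i hh; have u0 : attached R (fun j => v (i + j)) u 0.
  by rewrite attached_rot addr0.
have e6 : -1 = 6 :> 'Z_7 by apply: val_inj.
have u0' : attached R (fun j => v (i + - j)) u 0.
  by rewrite (attached_opp R (fun j => v (i + j))) oppr0.
have n6' : ~~ G (v (i + 6)) u by rewrite -e6.
have n1' : ~~ G (v (i + - 6)) u by rewrite -e6 opprK.
have [d d3] := hub_single hw u0 n1 n6'.
have [d' d4] := hub_single (hub_opp hw) u0' n6 n1'.
exists i, u, d; split=> //.
rewrite (attached_opp R (fun j => v (i + j))) (_ : - 3 = 4) in d4; last exact: val_inj.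
by rewrite (attached_far hw d3 d4 isT).
Qed.

(** Otherwise v 1 and u are all that v 0 sees after deleting N[v 5]. Then
    attached_next gives a vertex at v 2; it can only be d, which sees v 4. *)
Lemma not_two_doubles R v c u d : hub R v c ->
  attached R v u 0 -> attached R v d 3 -> attached R v d 4 -> ~~ G (v 1) u.
Proof.
move=> hh u0 d3 d4; have [hv _ _ _] := hh; apply/negP => u1'.
have u1 : attached R v u 1 by rewrite (attachedI _ u0).
pose w j := v (- (1 + j)).
have w1 j : w j = v (6 - j).
  rewrite /w opprD; congr (v (_ + _)); exact: val_inj.
have hw : heptagon R w := heptagon_rot 1 (heptagon_opp hv).
have aw y j : attached R w y j = attached R v y (- (1 + j)).
  by rewrite (attached_rot R (fun j => v (- j))) attached_opp.
have nd : ~~ G (w 1) d.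
  rewrite w1; apply/negP => h; have := attached_one hv d3 (j := 6 - 1).
  by rewrite (attachedI _ d3) h => /(_ isT isT).
have s6 : simp (w 1 |: R) (w 6).
  have a6 : alive (w 1 |: R) (w 6) by rewrite aliveU1 (hept_al hw) (hept_inj hw) (hept_adj hw).
  apply: simpI a6 _.
  have E x : alive (w 1 |: R) x -> G (w 6) x -> x = v 1 \/ x = u.
    move=> ax x6; have axR := aliveS (subsetUr _ _) ax.
    case: (hept_nbr (i := 6) (j := 0) (k := 5) hw isT isT axR x6) => [E|->|h].
    - by case: (heptagon_killed hw ax E isT).
    - by left; rewrite w1; congr v; apply: val_inj.
    right; rewrite aw in h; apply: (attached_far hh h u0).
    by rewrite /cyc7; vm_compute.
  move=> y z ay az y6 z6.
  case: (E y ay y6) => ->; case: (E z az z6) => ->; rewrite ?eqxx // => _.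
  by rewrite adjC.
have d3w : attached R w d 3 by rewrite aw (_ : - (1 + 3) = 3) //; apply: val_inj.
have [y] := attached_next hw s6 d3w nd.
rewrite aw (_ : - (1 + 4) = 2); last exact: val_inj.
move=> y2; have E := attached_far hh y2 d3 isT.
by have := attached_one hv y2 (j := 4); rewrite E d4 => /(_ isT isT).
Qed.

(** The component that appears when c is put back, with the heptagon labelled so
    that u is attached at v 0 and d at v 3 and v 4: it has these ten vertices. *)
Section HubPair.
Variables (R : {set 'I_s}) (v : 'Z_7 -> 'I_s) (c u d : 'I_s).
Hypothesis hh : hub R v c.
Hypotheses (u0 : attached R v u 0) (d3 : attached R v d 3) (d4 : attached R v d 4).
Let hv : heptagon R v. Proof. by case: hh. Qed.
Let ac : alive R c. Proof. by case: hh. Qed.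
Let cv i : ~~ G c (v i). Proof. by case: hh. Qed.
Let ch y i : attached R v y i -> G c y. Proof. by case: hh => _ _ _; apply. Qed.
Let RT t : R \subset t |: R. Proof. exact: subsetUr. Qed.

Lemma pair_neq : u != d.
Proof.
apply/eqP => E; have := attached_one hv u0 (j := 3).
by rewrite E d3 => /(_ isT isT).
Qed.

Lemma attached_pair y i : attached R v y i ->
  (y == u) && (i == 0) || (y == d) && ((i == 3) || (i == 4)).
Proof.
move=> yi.
have E0 : (i == 0) || cyc7 i 0 -> y = u := attached_far hh yi u0.
have E3 : (i == 3) || cyc7 i 3 -> y = d := attached_far hh yi d3.
have E4 : (i == 4) || cyc7 i 4 -> y = d := attached_far hh yi d4.
have n1 := not_two_doubles hh u0 d3 d4.
have n6 : ~~ G (v 6) u.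
  have e : -1 = 6 :> 'Z_7 by apply: val_inj.
  rewrite -e; apply: (not_two_doubles (hub_opp hh)).
  - by rewrite attached_opp oppr0.
  - by rewrite attached_opp (_ : - 3 = 4); [exact: d4 | apply: val_inj].
  by rewrite attached_opp (_ : - 4 = 3); [exact: d3 | apply: val_inj].
have : [|| i == 0, i == 1, i == 6 | ((i == 3) || cyc7 i 3) || ((i == 4) || cyc7 i 4)].
  by move: (i); apply: Z7_all; vm_compute.
case/or4P => [i0|/eqP i1|/eqP i6|/orP h].
- by rewrite E0 ?i0 // eqxx.
- by have := attached_adj yi; rewrite E0 i1 // (negbTE n1).
- by have := attached_adj yi; rewrite E0 i6 // (negbTE n6).
have yd : y = d by case: h.
have di : attached R v d i by rewrite -yd.
rewrite yd eqxx orbC /=; apply/orP; left.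
apply: contraT; rewrite negb_or => /andP [n3 n4].
have := attached_one hv d3 di; have := attached_one hv d4 di.
rewrite eq_sym n4 eq_sym n3 => /(_ isT) j4 /(_ isT) j3.
have : ~~ (cyc7 4 i && cyc7 3 i) by move: (i); apply: Z7_all; vm_compute.
by rewrite j4 j3.
Qed.

Lemma pair_adjL i : G (v i) u = (i == 0).
Proof.
rewrite -(attachedI i u0); apply/idP/eqP => [/attached_pair|-> //].
by rewrite eqxx (negbTE pair_neq) /= orbF => /eqP.
Qed.

Lemma pair_adjR i : G (v i) d = (i == 3) || (i == 4).
Proof.
rewrite -(attachedI i d3); apply/idP/orP => [/attached_pair|].
  by rewrite eqxx eq_sym (negbTE pair_neq) /= => /orP.
by case=> /eqP ->.
Qed.

Lemma hub_adjL : G c u. Proof. exact: ch u0. Qed.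
Lemma hub_adjR : G c d. Proof. exact: ch d3. Qed.
Lemma pair_outL i : v i != u. Proof. exact: attached_neq u0. Qed.
Lemma pair_outR i : v i != d. Proof. exact: attached_neq d3. Qed.

(** Same idea as for hub_double, with the roles of u and d exchanged. *)
Lemma hub_simp3 : simp (v 3 |: R) c.
Proof.
have stT := stableU1 (hept_st hv) (hept_al hv 3).
have aT := @hub_alive_vU1 _ _ _ hh 3.
have au : alive (v 3 |: R) u.
  by rewrite aliveU1 (attached_al u0) eq_sym pair_outL pair_adjL.
have s5 : simp (v 3 |: R) (v 5).
  apply: simpI (aT 5 isT isT) _ => y z ay az y5 z5.
  suff E x : alive (v 3 |: R) x -> G (v 5) x -> x = v 6.
    by rewrite (E y ay y5) (E z az z5) eqxx.
  move=> ax x5.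
  case: (hept_nbr (i := 5) (j := 6) (k := 4) hv isT isT (aliveS (RT _) ax) x5) => // [E|h].
    by case: (heptagon_killed hv ax E isT).
  by have := attached_pair h; rewrite !andbF.
have g6 : good (v 3 |: R) (v 6) by apply: adj_simp_good s5; rewrite (hept_adj hv).
have g0 : good (v 3 |: R) (v 0).
  by apply: good_adj stT g6 (aT 6 isT isT) (aT 0 isT isT) _; rewrite (hept_adj hv).
have := good_adj stT g0 (aT 0 isT isT) au (attached_adj u0).
have n0 : ~~ simp (v 3 |: R) (v 0).
  by apply: (@nonsimp _ _ (v 6) (v 1)); rewrite ?aT ?(hept_adj hv) ?(hept_inj hv).
have nu : ~~ simp (v 3 |: R) u.
  apply: (@nonsimp _ _ (v 0) c); rewrite ?aT ?(hub_c_aliveU1 hh) ?(hub_out hh) //.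
  - by rewrite adjC (attached_adj u0).
  - by rewrite adjC hub_adjL.
  by rewrite adjC.
case/goodP => [su|[y uy sy]]; first by rewrite su in nu.
have ay := simp_alive sy; have ayR := aliveS (RT _) ay.
have [ny|[j E]] := in_cycle v y; last first.
  have : G (v j) u by rewrite -E adjC.
  by rewrite pair_adjL => /eqP Ej; rewrite E Ej (negbTE n0) in sy.
have nsy : ~~ simp R y.
  have := hub_not_good hh 0 (subxx R) (hept_st hv) (hept_al hv); apply: contraNN => sRy.
  apply: (good_adj (hept_st hv) (v := u)); rewrite ?(hept_al hv) ?(attached_al u0) //.
    exact: adj_simp_good sRy.
  by rewrite adjC (attached_adj u0).
have [x [ax yx x3]] := new_simp sy nsy.
have nd : y != d by apply: contraTneq ay => ->; rewrite aliveU1 (attached_adj d3) andbF.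
have yat j : G y (v j) -> attached R v y j by move=> h; apply: attachedI'; rewrite // adjC.
case: (hept_nbr (i := 3) (j := 4) (k := 2) hv isT isT ax x3) => [E|E|xa].
- by have := attached_pair (yat 4 ltac:(by rewrite -E)); rewrite (negbTE nd) /= andbF.
- by have := attached_pair (yat 2 ltac:(by rewrite -E)); rewrite !andbF.
have {}xa : x = d.
  by have := attached_pair xa; rewrite andbF /= => /andP [/eqP].
suff <- : y = c by [].
rewrite {}xa in yx; apply/eqP; apply: (no_4cycle no4 uy yx); rewrite ?hub_adjL ?pair_neq //.
by rewrite adjC hub_adjR.
Qed.

(** The vertex c is simplicial without N[v 0] and without N[v 3], so a further
    neighbour of c is adjacent to d and to u and closes a 4-cycle with them and c. *)
Lemma hub_nbr y : alive R y -> G c y -> (y == u) || (y == d).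
Proof.
move=> ay cy; apply: contraT; rewrite negb_or => /andP [yu yd].
have ny j : v j != y by apply: contraTneq cy => <-.
have nyv j : (j == 0) || (j == 3) -> ~~ G (v j) y.
  move=> hj; apply/negP => jy; have := attached_pair (attachedI' ay ny jy).
  by rewrite (negbTE yu) (negbTE yd).
have [_ s0] := hub_double hh d3 d4.
have yd' : G y d.
  apply: (simp_adj s0) => //; rewrite ?hub_adjR //.
    by rewrite aliveU1 ay eq_sym ny nyv.
  by rewrite aliveU1 (attached_al d3) eq_sym pair_outR pair_adjR.
have yu' : G y u.
  apply: (simp_adj hub_simp3) => //; rewrite ?hub_adjL //.
    by rewrite aliveU1 ay eq_sym ny nyv.
  by rewrite aliveU1 (attached_al u0) eq_sym pair_outL pair_adjL.
have /eqP E : c == y.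
  apply: (no_4cycle no4 (a := u) (c := d)); rewrite ?pair_neq ?hub_adjR //.
    by rewrite adjC hub_adjL.
  by rewrite adjC.
by rewrite E adj_irr in cy.
Qed.

Lemma hub_c_not_simp T x i : R \subset T -> stable G T -> (forall j, alive T (v j)) ->
  attached R v x i -> alive T x -> ~~ simp T c.
Proof.
move=> RT' stT aT xi ax; have := hub_not_good hh i RT' stT aT; apply: contraNN => sc.
apply: (good_adj stT (v := x)); rewrite ?aT //.
  by apply: adj_simp_good sc; rewrite adjC (ch xi).
by rewrite adjC (attached_adj xi).
Qed.

Lemma pair_nadj : ~~ G u d.
Proof.
have := hub_c_not_simp (subxx R) (hept_st hv) (hept_al hv) u0 (attached_al u0).
apply: contraNN => ud; apply: simpI ac _ => y z ay az cy cz.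
case/orP: (hub_nbr ay cy) => /eqP ->; case/orP: (hub_nbr az cz) => /eqP ->;
  by rewrite ?eqxx // => _; rewrite adjC.
Qed.

(** Deleting N[y] would remove x and leave c simplicial, next to x', which remains
    attached to the cycle. *)
Lemma pair_child x x' y : (forall z, alive R z -> G c z -> (z == x) || (z == x')) ->
  G c x -> G c x' -> x != x' -> (exists i, attached R v x' i) ->
  alive R y -> G x y -> (forall j, v j != y) -> (forall j, ~~ G (v j) y) ->
  y == c.
Proof.
move=> cN cx cx' xx' [i xi] ay xy ny nvy; apply: contraT => yc.
have stT : stable G (y |: R) := stableU1 (hept_st hv) ay.
have aT j : alive (y |: R) (v j) by rewrite aliveU1 ny adjC nvy (hept_al hv).
have ncy : ~~ G y c.
  apply/negP; rewrite adjC => /(cN y ay) /orP [] /eqP E.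
    by rewrite E adj_irr in xy.
  by have := nvy i; rewrite E (attached_adj xi).
have nx' : ~~ G y x'.
  apply: contraNN yc => yx'; apply: (no_4cycle no4 xy yx' _ cx xx').
  by rewrite adjC.
have ax' : alive (y |: R) x'.
  rewrite aliveU1 nx' (attached_al xi) !andbT.
  by apply: contraNneq (nvy i) => <-; apply: attached_adj xi.
have := hub_c_not_simp (RT y) stT aT xi ax'; rewrite simpI //.
  by rewrite aliveU1 eq_sym yc ncy.
suff E z : alive (y |: R) z -> G c z -> z = x'.
  by move=> a b aa ab ca cb; rewrite (E a aa ca) (E b ab cb) eqxx.
move=> az cz; case/orP: (cN z (aliveS (RT y) az) cz) => /eqP // E.
by move: az; rewrite E aliveU1 adjC xy andbF.
Qed.

Lemma hub_nbrL y : alive R y -> G u y -> (y == c) || (y == v 0).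
Proof.
move=> ay uy; have [ny|[j E]] := in_cycle v y; last first.
  by move: uy; rewrite E adjC pair_adjL => /eqP ->; rewrite eqxx orbT.
apply/orP; left; apply: (pair_child (x := u) (x' := d)) => //.
- exact: hub_nbr.
- exact: hub_adjL.
- exact: hub_adjR.
- exact: pair_neq.
- by exists 3.
move=> j; apply/negP => jy; have := attached_pair (attachedI' ay ny jy).
by case/orP => /andP [/eqP E _]; move: uy; rewrite E ?adj_irr ?(negbTE pair_nadj).
Qed.

Lemma hub_nbrR y : alive R y -> G d y -> [|| y == c, y == v 3 | y == v 4].
Proof.
move=> ay dy; have [ny|[j E]] := in_cycle v y; last first.
  by move: dy; rewrite E adjC pair_adjR => /orP [] /eqP ->; rewrite eqxx !orbT.
apply/orP; left; apply: (pair_child (x := d) (x' := u)) => //.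
- by move=> z az cz; rewrite orbC hub_nbr.
- exact: hub_adjR.
- exact: hub_adjL.
- by rewrite eq_sym pair_neq.
- by exists 0.
move=> j; apply/negP => jy; have := attached_pair (attachedI' ay ny jy).
by case/orP => /andP [/eqP E _]; move: dy; rewrite E ?adj_irr // adjC (negbTE pair_nadj).
Qed.
End HubPair.

(** * At most one deletion isolates a heptagon *)

Definition isolated_heptagon T v : Prop :=
  heptagon T v /\ forall y i, ~~ attached T v y i.

(** An isolated heptagon is left after deleting N[T]; c is the only reason why
    the vertices attached in the absence of c are gone. *)
Lemma isolated_hub T v c : isolated_heptagon T v -> c \in T -> hub (T :\ c) v c.
Proof.
case=> hv nat cT; have sub : T :\ c \subset T := subsetDl _ _.
have stT := hept_st hv; have aT i := hept_al hv i.
have cv i : ~~ G c (v i) := alive_nadj (aT i) cT.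
split=> //.
- split; first exact: stableS sub stT.
    by move=> i; apply: aliveS sub (aT i).
  exact: hept_adj hv.
- apply/aliveP => y /setD1P [yc yT]; split=> //.
  by move/stableP: stT; apply.
move=> y i /and3P [ay ny iy]; have nay : ~~ alive T y.
  by apply: contra (nat y i) => ayT; rewrite /attached ayT ny iy.
have E : T = c |: (T :\ c) by rewrite setD1K.
move: nay; rewrite E aliveU1 ay andbT negb_and !negbK => /orP [/eqP yc|//].
by move: (cv i); rewrite -yc adjC iy.
Qed.

Lemma isolated_rot T v p : isolated_heptagon T v -> isolated_heptagon T (fun i => v (p + i)).
Proof.
by case=> hv nat; split; [apply: heptagon_rot | move=> y i; rewrite attached_rot].
Qed.

Lemma isolated_opp T v : isolated_heptagon T v -> isolated_heptagon T (fun i => v (- i)).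
Proof.
by case=> hv nat; split; [apply: heptagon_opp | move=> y i; rewrite attached_opp].
Qed.

(** Two vertices c and c' of T cannot both be needed. In the graph without N[Q],
    where Q is T without them, their pairs u, d and u', d' are attached to the
    cycle at different places, which is impossible: deleting N[d] makes u, or
    v 2 if u is adjacent to u', a simplicial vertex in a component with vertices that
    are neither simplicial nor next to a simplicial vertex. *)
Section TwoHubs.
Variables (T : {set 'I_s}) (v : 'Z_7 -> 'I_s) (c c' u d u' d' : 'I_s) (p : 'Z_7).
Hypothesis hT : isolated_heptagon T v.
Hypotheses (cT : c \in T) (cT' : c' \in T) (cc : c != c').
Let v' i := v (p + i).
Let Q := T :\ c :\ c'.
Hypotheses (u0 : attached (T :\ c) v u 0) (d3 : attached (T :\ c) v d 3)
  (d4 : attached (T :\ c) v d 4).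
Hypotheses (u0' : attached (T :\ c') v' u' 0) (d3' : attached (T :\ c') v' d' 3)
  (d4' : attached (T :\ c') v' d' 4).
Let hc : hub (T :\ c) v c := isolated_hub hT cT.
Let hc' : hub (T :\ c') v' c' := isolated_hub (isolated_rot p hT) cT'.

Let ncc : ~~ G c c'.
Proof. by have /stableP := hept_st (proj1 hT); apply. Qed.

Let QT : Q \subset T.
Proof. by apply: subset_trans (subsetDl _ _) (subsetDl _ _). Qed.

Let hQ : heptagon Q v.
Proof.
case: hT => hv _; split; last exact: hept_adj hv.
  exact: stableS QT (hept_st hv).
by move=> i; apply: aliveS QT (hept_al hv i).
Qed.

Lemma alive_left y : alive (T :\ c) y = [&& y != c', ~~ G c' y & alive Q y].
Proof. by rewrite -aliveU1 setD1K // !inE cT' eq_sym cc. Qed.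

Lemma alive_right y : alive (T :\ c') y = [&& y != c, ~~ G c y & alive Q y].
Proof.
rewrite -aliveU1 (_ : Q = T :\ c' :\ c) ?setD1K // ?inE ?cT ?cc //.
by apply/setP => x; rewrite !inE andbCA.
Qed.

Let RQ y : alive (T :\ c) y -> alive Q y.
Proof. by rewrite alive_left => /and3P []. Qed.
Let RQ' y : alive (T :\ c') y -> alive Q y.
Proof. by rewrite alive_right => /and3P []. Qed.

Lemma left_adj i : (G (v i) u = (i == 0)) * (G (v i) d = (i == 3) || (i == 4)).
Proof. by rewrite (pair_adjL hc u0 d3 d4) (pair_adjR hc u0 d3 d4). Qed.

Lemma right_adj i :
  (G (v i) u' = (i == p)) * (G (v i) d' = (i == p + 3) || (i == p + 4)).
Proof.
have E : v i = v' (i - p) by rewrite /v' addrC subrK.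
rewrite E (pair_adjL hc' u0' d3' d4') (pair_adjR hc' u0' d3' d4').
by rewrite subr_eq0 !subr_eq ![_ + p]addrC.
Qed.

Let outu i : v i != u. Proof. exact: attached_neq u0. Qed.
Let outd i : v i != d. Proof. exact: attached_neq d3. Qed.
Let outc i : v i != c. Proof. exact: hub_out hc i. Qed.
Let out' y i : (forall j, v' j != y) -> v i != y.
Proof. by move=> h; have := h (i - p); rewrite /v' addrC subrK. Qed.
Let outu' i : v i != u'. Proof. by apply: out' => j; apply: attached_neq u0'. Qed.
Let outd' i : v i != d'. Proof. by apply: out' => j; apply: attached_neq d3'. Qed.
Let outc' i : v i != c'. Proof. by apply: out' => j; apply: hub_out hc' j. Qed.
Let nvc i : ~~ G (v i) c. Proof. by case: hc => _ _ h _; rewrite adjC. Qed.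
Let nvc' i : ~~ G (v i) c'.
Proof. by case: hc' => _ _ h _; have := h (i - p); rewrite /v' addrC subrK adjC. Qed.

Let al_u : alive Q u. Proof. exact: RQ (attached_al u0). Qed.
Let al_d : alive Q d. Proof. exact: RQ (attached_al d3). Qed.
Let al_u' : alive Q u'. Proof. exact: RQ' (attached_al u0'). Qed.
Let al_d' : alive Q d'. Proof. exact: RQ' (attached_al d3'). Qed.
Let al_v i : alive Q (v i). Proof. exact: hept_al hQ i. Qed.

Let c'u : ~~ G c' u. Proof. by have := attached_al u0; rewrite alive_left => /and3P []. Qed.
Let c'd : ~~ G c' d. Proof. by have := attached_al d3; rewrite alive_left => /and3P []. Qed.
Let cu' : ~~ G c u'. Proof. by have := attached_al u0'; rewrite alive_right => /and3P []. Qed.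
Let cd' : ~~ G c d'. Proof. by have := attached_al d3'; rewrite alive_right => /and3P []. Qed.
Let dc' : d != c'. Proof. by have := attached_al d3; rewrite alive_left => /and3P []. Qed.
Let cu : G c u := hub_adjL hc u0.
Let cd : G c d := hub_adjR hc d3.
Let c'u' : G c' u' := hub_adjL hc' u0'.
Let c'd' : G c' d' := hub_adjR hc' d3'.

(** If y survives one of the deletions of N[c] and N[c'], then attached_pair applies.
    Otherwise y shares the neighbour c with u and d, one of which is attached near v i,
    and common_nbr_far applies. *)
Lemma hubs_attached y i : alive Q y -> (forall j, v j != y) -> G (v i) y ->
  [|| y == u, y == d, y == u' | y == d'].
Proof.
move=> ay ny iy.
have [la|la] := boolP (alive (T :\ c) y).
  have := attached_pair hc u0 d3 d4 (attachedI' la ny iy).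
  by case/orP => /andP [-> _]; rewrite ?orbT.
have [ra|ra] := boolP (alive (T :\ c') y).
  have yi' : attached (T :\ c') v' y (i - p).
    by apply: attachedI' => // [j|]; rewrite /v' ?ny // addrC subrK.
  have := attached_pair hc' u0' d3' d4' yi'.
  by case/orP => /andP [-> _]; rewrite ?orbT.
move: ra; rewrite alive_right ay andbT negb_and !negbK => /orP [/eqP E|cy].
  by move: iy; rewrite E (negbTE (nvc i)).
have yi : attached Q v y i := attachedI' ay ny iy.
have near z j : attached (T :\ c) v z j -> (i == j) || cyc7 i j -> y = z.
  move=> zj; have zjQ : attached Q v z j.
    apply: attachedI' (attached_adj zj); first exact: RQ (attached_al zj).
    by move=> l; exact: attached_neq zj.
  have cz : G c z by case: hc => _ _ _ h; exact: h zj.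
  exact: (common_nbr_far hQ outc cy cz yi zjQ).
have : [|| (i == 0) || cyc7 i 0, (i == 3) || cyc7 i 3 | (i == 4) || cyc7 i 4].
  by move: (i); apply: Z7_all; vm_compute.
by case/or3P => [/(near u 0 u0)|/(near d 3 d3)|/(near d 4 d4)] ->; rewrite eqxx ?orbT.
Qed.

Hypothesis p123 : p \in [:: 1; 2; 3].

Let at_u : attached Q v u 0. Proof. by apply: attachedI'; rewrite // left_adj. Qed.
Let at_d3 : attached Q v d 3. Proof. by apply: attachedI'; rewrite // left_adj. Qed.
Let at_d4 : attached Q v d 4. Proof. by apply: attachedI'; rewrite // left_adj. Qed.
Let at_u' : attached Q v u' p. Proof. by apply: attachedI'; rewrite // right_adj eqxx. Qed.
Let at_d3' : attached Q v d' (p + 3).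
Proof. by apply: attachedI'; rewrite // right_adj eqxx. Qed.
Let at_d4' : attached Q v d' (p + 4).
Proof. by apply: attachedI'; rewrite // right_adj eqxx orbT. Qed.

Let far_apart y z i j k l : attached Q v y i -> attached Q v y j ->
  attached Q v z k -> attached Q v z l ->
  [|| cyc7 i k, k == i + 2 | i == k + 2] || [|| cyc7 j l, l == j + 2 | j == l + 2] ->
  ~~ G y z.
Proof.
move=> yi yj zk zl h; apply/negP => yz; move: h.
by rewrite (negbTE (attached_edge hQ yi zk yz)) (negbTE (attached_edge hQ yj zl yz)).
Qed.

Lemma hubs_nadj : [/\ ~~ G d u', ~~ G d d' & ~~ G u d'].
Proof.
split.
- apply: far_apart at_d3 at_d4 at_u' at_u' _.
  by move: p123; rewrite !inE => /or3P [] /eqP ->; vm_compute.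
- apply: far_apart at_d4 at_d3 at_d3' at_d4' _.
  by move: p123; rewrite !inE => /or3P [] /eqP ->; vm_compute.
apply: far_apart at_u at_u at_d3' at_d4' _.
by move: p123; rewrite !inE => /or3P [] /eqP ->; vm_compute.
Qed.

Lemma hubs_nadj_u : (p != 3) -> ~~ G u u'.
Proof.
move=> p3; apply: far_apart at_u at_u at_u' at_u' _.
by move: p3; move: p123; rewrite !inE => /or3P [] /eqP ->; vm_compute.
Qed.

Let not_good T' i : Q \subset T' -> stable G T' -> (forall j, alive T' (v j)) ->
  ~~ good T' (v i).
Proof.
move=> QT' stT' aT'; have hT' : heptagon T' v by split=> // k l; rewrite (hept_adj hQ).
apply/negP => gi.
have [j /norP [j0 /norP [j3 /norP [j4 /norP [jp /norP [jp3 jp4]]]]]] :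
    exists j, ~~ [|| j == 0, j == 3, j == 4, j == p, j == p + 3 | j == p + 4].
  exists (if p == 1 then 2 else 1).
  by move: p123; rewrite !inE => /or3P [] /eqP ->; vm_compute.
have [y yj _] := hept_good hT' gi j.
have := hubs_attached (aliveS QT' (attached_al yj)) (fun l => attached_neq l yj) (attached_adj yj).
have := attached_adj yj => jy; case/or4P => /eqP E; move: jy; rewrite E ?left_adj ?right_adj.
- by rewrite (negbTE j0).
- by rewrite (negbTE j3) (negbTE j4).
- by rewrite (negbTE jp).
by rewrite (negbTE jp3) (negbTE jp4).
Qed.

Lemma hubs_nbr_u z : alive Q z -> G u z -> ~~ (G c z && G c' z) ->
  [|| z == c, z == v 0 | z == u'].
Proof.
move=> az uz ns; have [//|zc] := eqVneq z c.
have zc' : z != c' by apply: contraTneq uz => ->; rewrite adjC.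
have [c'z|c'z] := boolP (G c' z).
  have cz : ~~ G c z by move: ns; rewrite c'z andbT.
  have rz : alive (T :\ c') z by rewrite alive_right zc cz.
  case/orP: (hub_nbr hc' u0' d3' d4' rz c'z) => /eqP E; first by rewrite E eqxx !orbT.
  by have [_ _] := hubs_nadj; rewrite -E uz.
have lz : alive (T :\ c) z by rewrite alive_left zc' c'z.
case/orP: (hub_nbrL hc u0 d3 d4 lz uz) => /eqP E; first by rewrite E eqxx in zc.
by rewrite E eqxx.
Qed.

Lemma hubs_nbr_d z : alive Q z -> G d z -> ~~ (G c z && G c' z) ->
  [|| z == c, z == v 3 | z == v 4].
Proof.
move=> az dz ns; have [//|zc] := eqVneq z c.
have zc' : z != c' by apply: contraTneq dz => ->; rewrite adjC.
have [c'z|c'z] := boolP (G c' z).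
  have cz : ~~ G c z by move: ns; rewrite c'z andbT.
  have rz : alive (T :\ c') z by rewrite alive_right zc cz.
  have [nu nd _] := hubs_nadj.
  by case/orP: (hub_nbr hc' u0' d3' d4' rz c'z) => /eqP E; move: dz;
    rewrite E ?(negbTE nu) ?(negbTE nd).
have lz : alive (T :\ c) z by rewrite alive_left zc' c'z.
by have := hub_nbrR hc u0 d3 d4 lz dz; rewrite (negbTE zc).
Qed.

Lemma hubs_nbr_d' z : alive Q z -> G d' z -> ~~ (G c z && G c' z) ->
  [|| z == c', z == v (p + 3) | z == v (p + 4)].
Proof.
move=> az dz ns; have [//|zc'] := eqVneq z c'.
have zc : z != c by apply: contraTneq dz => ->; rewrite adjC.
have [cz|cz] := boolP (G c z).
  have c'z : ~~ G c' z by move: ns; rewrite cz.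
  have lz : alive (T :\ c) z by rewrite alive_left zc' c'z.
  have [_ nd nu] := hubs_nadj.
  case/orP: (hub_nbr hc u0 d3 d4 lz cz) => /eqP E; move: dz;
    rewrite E adjC ?(negbTE nu) ?(negbTE nd) //.
have rz : alive (T :\ c') z by rewrite alive_right zc cz.
by have := hub_nbrR hc' u0' d3' d4' rz dz; rewrite (negbTE zc').
Qed.

(** Deleting a common neighbour w of c and c' removes both at once. Then d
    and d' are gone too, since they would be simplicial, whereas u and u' remain and
    must be adjacent for the same reason. So p = 3, and nothing is left that could be
    attached next to u' as attached_partner demands. *)
Lemma hubs_no_shared w : alive Q w -> ~~ (G c w && G c' w).
Proof.
move=> aw; apply/negP => /andP [cw c'w].
have one z : alive (w |: Q) z -> ~~ (G c z && G c' z).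
  rewrite aliveU1 => /and3P [zw _ _]; apply: contraNN zw => /andP [cz c'z].
  by apply: (no_4cycle no4 (a := c) (c := c')); rewrite // adjC.
have wv j : v j != w by apply: contraTneq cw => <-; rewrite adjC.
have nvw j : ~~ G w (v j).
  rewrite adjC; apply/negP => jw; have := hubs_attached aw wv jw.
  by case/or4P => /eqP E; move: cw c'w;
     rewrite E ?(negbTE c'u) ?(negbTE c'd) ?(negbTE cu') ?(negbTE cd').
have QT' : Q \subset w |: Q := subsetUr _ _.
have stT' : stable G (w |: Q) := stableU1 (hept_st hQ) aw.
have aT' j : alive (w |: Q) (v j) by rewrite aliveU1 wv nvw al_v.
have ng := not_good _ QT' stT' aT'.
have dead z : G w z -> alive (w |: Q) z = false by rewrite aliveU1 => ->; rewrite andbF.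
have wc : G w c by rewrite adjC.
have wc' : G w c' by rewrite adjC.
have wd : G w d.
  apply: contraT => nwd; have ad : alive (w |: Q) d.
    by rewrite aliveU1 nwd al_d !andbT; apply: contraNneq c'd => ->; rewrite c'w.
  have dN z : alive (w |: Q) z -> G d z -> (z == v 3) || (z == v 4).
    move=> az dz; have := hubs_nbr_d (aliveS QT' az) dz (one z az).
    by case/orP => // /eqP E; rewrite E dead in az.
  have sd : simp (w |: Q) d.
    apply: simpI ad _ => y z ay az dy dz.
    by case/orP: (dN y ay dy) => /eqP ->; case/orP: (dN z az dz) => /eqP ->;
      rewrite ?eqxx ?(hept_adj hQ).
  case/negP: (ng 3); apply: adj_simp_good sd.
  by rewrite left_adj.
have wd' : G w d'.
  apply: contraT => nwd; have ad : alive (w |: Q) d'.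
    by rewrite aliveU1 nwd al_d' !andbT; apply: contraNneq cd' => ->; rewrite cw.
  have dN z : alive (w |: Q) z -> G d' z -> (z == v (p + 3)) || (z == v (p + 4)).
    move=> az dz; have := hubs_nbr_d' (aliveS QT' az) dz (one z az).
    by case/orP => // /eqP E; rewrite E dead in az.
  have p34 : cyc7 (p + 3) (p + 4) by rewrite cyc7_rot.
  have sd : simp (w |: Q) d'.
    apply: simpI ad _ => y z ay az dy dz.
    by case/orP: (dN y ay dy) => /eqP ->; case/orP: (dN z az dz) => /eqP ->;
      rewrite ?eqxx // => _; rewrite ?[G _ (v (p + 3))]adjC (hept_adj hQ) p34.
  case/negP: (ng (p + 3)); apply: adj_simp_good sd.
  by rewrite right_adj eqxx.
have au : alive (w |: Q) u.
  rewrite aliveU1 al_u andbT; apply/andP; split.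
    by apply: contraNneq c'u => ->; rewrite c'w.
  apply/negP => wu; have uc : G u c by rewrite adjC.
  have dw : G d w by rewrite adjC.
  have wc1 : w != c by rewrite eq_sym (adj_neq cw).
  have := no_4cycle no4 wu uc cd dw wc1.
  by rewrite (negbTE (pair_neq hc u0 d3)).
have au' : alive (w |: Q) u'.
  rewrite aliveU1 al_u' andbT; apply/andP; split.
    by apply: contraNneq cu' => ->; rewrite cw.
  apply/negP => wu; have uc : G u' c' by rewrite adjC.
  have dw : G d' w by rewrite adjC.
  have wc1 : w != c' by rewrite eq_sym (adj_neq c'w).
  have := no_4cycle no4 wu uc c'd' dw wc1.
  by rewrite (negbTE (pair_neq hc' u0' d3')).
have uu' : G u u'.
  apply: contraT => nuu; have uN z : alive (w |: Q) z -> G u z -> z = v 0.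
    move=> az uz; have := hubs_nbr_u (aliveS QT' az) uz (one z az).
    case/or3P => /eqP E //; first by rewrite E dead in az.
    by rewrite -E uz in nuu.
  have su : simp (w |: Q) u.
    by apply: simpI au _ => y z ay az uy uz; rewrite (uN y ay uy) (uN z az uz) eqxx.
  case/negP: (ng 0); apply: adj_simp_good su.
  by rewrite left_adj.
have p3 : p = 3.
  by apply/eqP; apply: contraT => /hubs_nadj_u; rewrite uu'.
have hT' : heptagon (w |: Q) v by split=> // k l; rewrite (hept_adj hQ).
have u3' : attached (w |: Q) v u' 3.
  apply/and3P; split=> //; first by apply/forallP.
  by rewrite right_adj p3.
have n1 : ~~ G (v 1) u' by rewrite right_adj p3.
have none y i : attached (w |: Q) v y i -> (i == 4) || (i == 6) -> False.
  move=> yi i46; have ay := attached_al yi; have yi' := attached_adj yi.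
  have := hubs_attached (aliveS QT' ay) (fun l => attached_neq l yi) yi'.
  case/or4P => /eqP E; move: yi' ay; rewrite E.
  - by rewrite left_adj => /eqP i0; rewrite i0 in i46.
  - by rewrite (dead d wd).
  - by rewrite right_adj p3 => /eqP i0; rewrite i0 in i46.
  by rewrite (dead d' wd').
by case: (attached_partner hT' u3' n1) => [] [y yi]; apply: (none y _ yi).
Qed.

Lemma two_hubs : False.
Proof.
have ns z : alive Q z -> ~~ (G c z && G c' z) := @hubs_no_shared z.
have stT' : stable G (d |: Q) := stableU1 (hept_st hQ) al_d.
have QT' : Q \subset d |: Q := subsetUr _ _.
have aV i : ~~ ((i == 3) || (i == 4)) -> alive (d |: Q) (v i).
  by move=> i34; rewrite aliveU1 al_v outd adjC left_adj i34.
have dead z : G d z -> alive (d |: Q) z = false by rewrite aliveU1 => ->; rewrite andbF.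
have [du' dd' ud'] := hubs_nadj.
have ud : u != d := pair_neq hc u0 d3.
have ud0 : ~~ G u d := pair_nadj hc u0 d3 d4.
have u'd' : u' != d' := pair_neq hc' u0' d3'.
have u'd'0 : ~~ G u' d' := pair_nadj hc' u0' d3' d4'.
have au : alive (d |: Q) u by rewrite aliveU1 al_u ud adjC ud0.
have au' : alive (d |: Q) u'.
  by rewrite aliveU1 al_u' du' !andbT; apply: contraNneq cu' => ->.
have ad' : alive (d |: Q) d'.
  by rewrite aliveU1 al_d' dd' !andbT; apply: contraNneq cd' => ->.
have ac' : alive (d |: Q) c'.
  have ac'Q : alive Q c' by case: hc' => _ /RQ'.
  by rewrite aliveU1 ac'Q eq_sym dc' adjC c'd.
have adj_v i z : alive (d |: Q) z -> G (v i) z -> [\/ z = v (i + 1), z = v (i - 1)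
    | (z = u /\ i == 0) \/ (z = u' /\ i == p) \/
      (z = d' /\ ((i == p + 3) || (i == p + 4)))].
  move=> az iz; case: (hept_nbr hQ (eqxx _) (eqxx _) (aliveS QT' az) iz) => [|| zi].
  - by constructor 1.
  - by constructor 2.
  constructor 3.
  have := hubs_attached (aliveS QT' az) (fun l => attached_neq l zi) iz.
  case/or4P => /eqP E; move: iz; rewrite E ?left_adj ?right_adj => iz.
  - by left.
  - by move: az; rewrite E aliveU1 eqxx.
  - by right; left.
  by right; right.
have uN z : alive (d |: Q) z -> G u z -> (z == v 0) || (z == u').
  move=> az uz; have azQ := aliveS QT' az.
  have := hubs_nbr_u azQ uz (ns z azQ).
  case/or3P => [/eqP E|->|->]; rewrite ?orbT //.
  by rewrite E dead // adjC in az.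
have su : ~~ G u u' -> simp (d |: Q) u.
  move=> nuu; apply: simpI au _ => y z ay az uy uz.
  suff E x : alive (d |: Q) x -> G u x -> x = v 0.
    by rewrite (E y ay uy) (E z az uz) eqxx.
  by move=> ax ux; case/orP: (uN x ax ux) => /eqP // E; rewrite E (negbTE nuu) in ux.
have g0 : ~~ G u u' -> good (d |: Q) (v 0).
  by move=> /su; apply: adj_simp_good; rewrite left_adj.
have nv i j k : ~~ ((j == 3) || (j == 4)) -> ~~ ((k == 3) || (k == 4)) ->
    cyc7 i j -> cyc7 i k -> j != k -> ~~ cyc7 j k -> ~~ simp (d |: Q) (v i).
  by move=> j34 k34 ij ik jk njk; apply: (@nonsimp _ _ (v j) (v k));
    rewrite ?aV ?(hept_adj hQ) ?(hept_inj hQ).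
have nva i j x : ~~ ((j == 3) || (j == 4)) -> cyc7 i j -> alive (d |: Q) x ->
    G (v i) x -> ~~ G (v j) x -> v j != x -> ~~ simp (d |: Q) (v i).
  by move=> j34 ij ax ix jx ne; apply: (@nonsimp _ _ (v j) x);
    rewrite ?aV ?(hept_adj hQ).
have n0 : ~~ simp (d |: Q) (v 0) by apply: (nv 0 6 1).
have n6 : ~~ simp (d |: Q) (v 6) by apply: (nv 6 5 0).
have n1 : ~~ simp (d |: Q) (v 1) by apply: (nv 1 0 2).
have e65 : 6 - 1 = 5 :> 'Z_7 by apply: val_inj.
have e60 : 6 + 1 = 0 :> 'Z_7 by apply: val_inj.
have e06 : 0 - 1 = 6 :> 'Z_7 by apply: val_inj.
move: (p123); rewrite !inE => /or3P [] /eqP Ep.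
- have n5 : ~~ simp (d |: Q) (v 5).
    apply: (nva 5 6 d') => //; first by rewrite right_adj Ep.
    by rewrite right_adj Ep.
  have g6 : good (d |: Q) (v 6).
    apply: good_adj stT' (g0 _) (aV 0 isT) (aV 6 isT) _; last by rewrite (hept_adj hQ).
      by apply: hubs_nadj_u; rewrite Ep.
  case/goodP: g6 => [s6|[y y6 sy]]; first by rewrite s6 in n6.
  case: (adj_v 6 y (simp_alive sy) y6) => [|| [[_ //]|[[_]|[_]]]].
  + by rewrite e60 => E; rewrite E (negbTE n0) in sy.
  + by rewrite e65 => E; rewrite E (negbTE n5) in sy.
  + by rewrite Ep.
  by rewrite Ep.
- have n2 : ~~ simp (d |: Q) (v 2).
    apply: (nva 2 1 u') => //; first by rewrite right_adj Ep.
    by rewrite right_adj Ep.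
  have g1 : good (d |: Q) (v 1).
    apply: good_adj stT' (g0 _) (aV 0 isT) (aV 1 isT) _; last by rewrite (hept_adj hQ).
    by apply: hubs_nadj_u; rewrite Ep.
  case/goodP: g1 => [s1|[y y1 sy]]; first by rewrite s1 in n1.
  case: (adj_v 1 y (simp_alive sy) y1) => [|| [[_ //]|[[_]|[_]]]].
  + by rewrite (_ : 1 + 1 = 2) => [E|]; [rewrite E (negbTE n2) in sy | apply: val_inj].
  + by rewrite subrr => E; rewrite E (negbTE n0) in sy.
  + by rewrite Ep.
  by rewrite Ep.
have e30 : p + 4 = 0 by rewrite Ep; apply: val_inj.
have e36 : p + 3 = 6 by rewrite Ep; apply: val_inj.
have nd' : ~~ simp (d |: Q) d'.
  apply: (@nonsimp _ _ (v 0) c'); rewrite ?aV //.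
  - by rewrite adjC right_adj e30 e36.
  - by rewrite adjC.
have [uu|nuu] := boolP (G u u'); last first.
  have vd' : G (v 0) d' by rewrite right_adj e30 e36.
  have := good_adj stT' (g0 nuu) (aV 0 isT) ad' vd'.
  case/goodP => [sd|[y y6 sy]]; first by rewrite sd in nd'.
  have ayQ := aliveS QT' (simp_alive sy).
  have := hubs_nbr_d' ayQ y6 (ns y ayQ); rewrite e30 e36.
  case/or3P => /eqP E; move: sy; rewrite E ?(negbTE n6) ?(negbTE n0) //.
  apply/negP; exact: (@nonsimp _ _ u' d').
have nu : ~~ simp (d |: Q) u.
  apply: (@nonsimp _ _ (v 0) u'); rewrite ?aV //.
  - by rewrite adjC left_adj.
  - by rewrite right_adj Ep.
have s2 : simp (d |: Q) (v 2).
  apply: simpI (aV 2 isT) _ => y z ay az y2 z2.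
  suff E x : alive (d |: Q) x -> G (v 2) x -> x = v 1.
    by rewrite (E y ay y2) (E z az z2) eqxx.
  move=> ax x2; case: (adj_v 2 x ax x2) => [|| [[_ //]|[[_]|[_]]]].
  + rewrite (_ : 2 + 1 = 3) => [E|]; last exact: val_inj.
    by rewrite E dead // adjC left_adj in ax.
  + by rewrite (_ : 2 - 1 = 1) //; apply: val_inj.
  + by rewrite Ep.
  by rewrite e30 e36.
have g1 : good (d |: Q) (v 1) by apply: adj_simp_good s2; rewrite (hept_adj hQ).
have := good_adj stT' g1 (aV 1 isT) (aV 0 isT); rewrite (hept_adj hQ) => /(_ isT).
case/goodP => [s0|[y y0 sy]]; first by rewrite s0 in n0.
case: (adj_v 0 y (simp_alive sy) y0) => [|| [[E _]|[[_]|[E _]]]].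
- by rewrite add0r => E; rewrite E (negbTE n1) in sy.
- by rewrite e06 => E; rewrite E (negbTE n6) in sy.
- by rewrite E (negbTE nu) in sy.
- by rewrite Ep.
by rewrite E (negbTE nd') in sy.
Qed.

End TwoHubs.

(** A rotation puts the pair of c at v 0; a reflection allows for negative p. If p = 0,
    then d and d' close a 4-cycle with v 3 and v 4. *)
Lemma two_hubs_attached T v c c' y i y' i' : isolated_heptagon T v ->
  c \in T -> c' \in T -> attached (T :\ c) v y i -> attached (T :\ c') v y' i' ->
  c = c'.
Proof.
move=> hT cT cT' yi yi'; apply/eqP; apply: contraT => cc; exfalso.
have [q [u [d [u0 d3 d4]]]] := hub_pair (isolated_hub hT cT) yi.
have {hT} := isolated_rot q hT; move: u0 d3 d4.
have {yi'} : attached (T :\ c') (fun j => v (q + j)) y' (i' - q).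
  by rewrite attached_rot addrC subrK.
move: (fun j => v (q + j)) (i' - q) => {yi i}v {}i' yi' u0 d3 d4 hT.
have [p [u' [d' [u0' d3' d4']]]] := hub_pair (isolated_hub hT cT') yi'.
have hv := proj1 hT.
have : [|| p == 0, p \in [:: 1; 2; 3] | - p \in [:: 1; 2; 3]].
  by move: (p); apply: Z7_all; vm_compute.
case/or3P => [/eqP p0|p123|p123].
- have dd' : d != d'.
    apply: contraTneq (attached_al d3) => ->.
    rewrite -(setD1K (a := c') (A := T :\ c)) ?inE 1?eq_sym ?cc // aliveU1.
    by rewrite (hub_adjR (isolated_hub (isolated_rot p hT) cT') d3') andbF.
  have g3 : G d (v 3) by rewrite adjC (attached_adj d3).
  have g3' : G (v 3) d' by have := attached_adj d3'; rewrite p0 add0r.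
  have g4' : G d' (v 4) by have := attached_adj d4'; rewrite p0 add0r adjC.
  have := no_4cycle no4 g3 g3' g4' (attached_adj d4) dd'.
  by rewrite (hept_inj hv).
- exact: (two_hubs hT cT cT' cc u0 d3 d4 u0' d3' d4' p123).
have e3 : - 3 = 4 :> 'Z_7 by apply: val_inj.
have e4 : - 4 = 3 :> 'Z_7 by apply: val_inj.
have flip z j : attached (T :\ c') (fun i => v (- (- p + i))) z j =
                attached (T :\ c') (fun i => v (p + i)) z (- j).
  by rewrite (attached_rot _ (fun i => v (- i))) attached_opp attached_rot opprD opprK.
apply: (two_hubs (isolated_opp hT) cT cT' cc (u := u) (d := d) (u' := u') (d' := d')
  (p := - p)) => //.
- by rewrite attached_opp oppr0.
- by rewrite attached_opp e3.
- by rewrite attached_opp e4.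
- by rewrite flip oppr0.
- by rewrite flip e3.
by rewrite flip e4.
Qed.

(** * Finding the heptagon *)

(** In a stable set T as large as possible such that some vertex that remains is
    neither simplicial nor next to a simplicial vertex, those vertices have only
    two remaining neighbours: any third neighbour could be deleted by one of its
    far neighbours. *)
Lemma two_nbrs T x p : stable G T ->
  (forall T', stable G T' -> (exists2 y, alive T' y & ~~ good T' y) -> #|T'| <= #|T|)%N ->
  alive T x -> ~~ good T x -> alive T p -> G x p ->
  exists q, [/\ alive T q, G x q, q != p, ~~ G p q &
    forall y, alive T y -> G x y -> (y == p) || (y == q)].
Proof.
move=> stT maxT ax ngx ap xp.
have nsx : ~~ simp T x by apply: contra ngx; apply: simp_good.
have nsn y : G x y -> ~~ simp T y by move=> xy; apply: contra ngx; apply: adj_simp_good.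
have third a b : alive T a -> alive T b -> G x a -> G x b -> a != b -> ~~ G a b ->
    forall y, alive T y -> G x y -> (y == a) || (y == b).
  move=> aa ab xa xb neab nab y ay xy; apply: contraT; rewrite negb_or => /andP [ya yb].
  have [d [ad yd dx nxd]] := nonsimp_far_nbr ay xy (nsn y xy).
  have al z : alive T z -> G x z -> z != y -> alive (d |: T) z.
    move=> az xz zy; rewrite aliveU1 az andbT; apply/andP; split.
      by apply: contraNneq nxd => <-.
    apply: contraNN zy => dz; have zx : G z x by rewrite adjC.
    by rewrite eq_sym; apply: (no_4cycle no4 xy yd dz zx); rewrite eq_sym.
  have ax' : alive (d |: T) x by rewrite aliveU1 ax eq_sym dx adjC nxd.
  suff : (#|d |: T| <= #|T|)%N by rewrite cardsU1 (alive_notin ad) add1n ltnn.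
  apply: maxT (stableU1 stT ad) _; exists x => //; apply/negP.
  case/goodP => [|[z xz sz]].
    by apply/negP; apply: (nonsimp (al a _ _ _) (al b _ _ _)); rewrite // eq_sym.
  have := simp_alive sz; rewrite aliveU1 => /and3P [zd dz az].
  have [e [ae ze ex nxe]] := nonsimp_far_nbr az xz (nsn z xz).
  have ed : e != d by apply: contraNneq dz => <-; rewrite adjC.
  have nde : ~~ G d e.
    apply/negP => de; have dy : G d y by rewrite adjC.
    have yx : G y x by rewrite adjC.
    have ed' : G e d by rewrite adjC.
    have xe : x != e by rewrite eq_sym.
    have xd' : x != d by rewrite eq_sym.
    have zy : z != y by apply: contraNneq dz => ->.
    have ey : e != y by apply: contraNneq nxe => ->.
    exact: (no_5cycle no5 xz ze ed' dy yx xe xd' zd zy ey).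
  have zx : G z x by rewrite adjC.
  have ae' : alive (d |: T) e by rewrite aliveU1 ed nde ae.
  have xe : x != e by rewrite eq_sym.
  by move: sz; apply/negP; apply: (nonsimp ax' ae' zx ze xe).
have [a [b [aa ab [xa xb neab nab]]]] := nonsimpP ax nsx.
have ab3 := third a b aa ab xa xb neab nab.
case/orP: (ab3 p ap xp) => /eqP ->; [exists b | exists a]; split=> //.
- by rewrite eq_sym.
- by rewrite adjC.
by move=> y ay xy; rewrite orbC ab3.
Qed.

(** By maximality all vertices of the component of x have degree two. Three steps from x
    in both directions lead to c1 and c2; unless these are adjacent, deleting them
    leaves a path around x in which p is simplicial but q is not good. *)
Lemma isolated_heptagon_exists : (exists x, ~~ good set0 x) ->
  exists T v, isolated_heptagon T v.
Proof.
case=> x0 ng0.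
pose P (T : {set 'I_s}) := stable G T && [exists y, alive T y && ~~ good T y].
have P0 : P set0.
  apply/andP; split; first by apply/stableP => a b; rewrite inE.
  by apply/existsP; exists x0; rewrite alive0.
case: (arg_maxnP (fun T => #|T|) P0) => T /andP [stT /existsP [x /andP [ax ngx]]] maxT.
have {}maxT T' : stable G T' -> (exists2 y, alive T' y & ~~ good T' y) -> (#|T'| <= #|T|)%N.
  move=> stT' [y ay ngy]; apply: maxT; rewrite /P stT' /=.
  by apply/existsP; exists y; rewrite ay.
have two := two_nbrs stT maxT.
have ngn a b : alive T a -> ~~ good T a -> alive T b -> G a b -> ~~ good T b.
  move=> aa nga ab gab; apply: contra nga => gb; apply: good_adj stT gb ab aa _.
  by rewrite adjC.
have nsx : ~~ simp T x by apply: contra ngx; apply: simp_good.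
have [p [_ [ap _ [xp _ _ _]]]] := nonsimpP ax nsx.
have [q [aq xq qp npq Nx]] := two x p ax ngx ap xp.
have px : G p x by rewrite adjC.
have qx : G q x by rewrite adjC.
have ngp := ngn x p ax ngx ap xp; have ngq := ngn x q ax ngx aq xq.
have [z1 [az1 pz1 z1x nxz1 Np]] := two p x ap ngp ax px.
have [z2 [az2 qz2 z2x nxz2 Nq]] := two q x aq ngq ax qx.
have z1p : G z1 p by rewrite adjC.
have z2q : G z2 q by rewrite adjC.
have ngz1 := ngn p z1 ap ngp az1 pz1; have ngz2 := ngn q z2 aq ngq az2 qz2.
have [c1 [ac1 zc1 c1p npc1 Nz1]] := two z1 p az1 ngz1 ap z1p.
have [c2 [ac2 zc2 c2q nqc2 Nz2]] := two z2 q az2 ngz2 aq z2q.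
have pq : p != q by rewrite eq_sym.
have z12 : z1 != z2.
  apply/eqP => E; have z2p : G z1 p by rewrite adjC.
  have qz1 : G q z1 by rewrite E.
  have := no_4cycle no4 xp pz1 _ qx; rewrite adjC qz1 eq_sym z1x (negbTE pq).
  by move=> /(_ isT isT).
have nz12 : ~~ G z1 z2.
  apply/negP => z1z2; apply: (no_5cycle no5 xp pz1 z1z2 z2q qx) => //.
  - by rewrite eq_sym.
  - by rewrite eq_sym.
  - by apply: contraNneq npq => ->; rewrite adjC.
  by apply: contraNneq npq => <-.
have c1x : c1 != x by apply: contraNneq nxz1 => <-; rewrite adjC.
have c2x : c2 != x by apply: contraNneq nxz2 => <-; rewrite adjC.
have c1q : c1 != q.
  apply/eqP => E; have qz1 : G q z1 by rewrite -E adjC.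
  by have := Nq z1 az1 qz1; rewrite (negbTE z1x) (negbTE z12).
have c2p : c2 != p.
  apply/eqP => E; have pz2 : G p z2 by rewrite -E adjC.
  by have := Np z2 az2 pz2; rewrite (negbTE z2x) eq_sym (negbTE z12).
have c1z2 : c1 != z2 by apply: contraNneq nz12 => <-.
have c2z1 : c2 != z1 by apply: contraNneq nz12 => <-; rewrite adjC.
have nxc1 : ~~ G x c1 by apply/negP => /(Nx c1 ac1); rewrite (negbTE c1p) (negbTE c1q).
have nxc2 : ~~ G x c2 by apply/negP => /(Nx c2 ac2); rewrite (negbTE c2p) (negbTE c2q).
have nqc1 : ~~ G q c1 by apply/negP => /(Nq c1 ac1); rewrite (negbTE c1x) (negbTE c1z2).
have z1c2 : z1 != c2 by rewrite eq_sym.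
have npc2 : ~~ G p c2.
  by apply/negP => /(Np c2 ac2); rewrite (negbTE c2x) (negbTE c2z1).
have [c12|nc12] := boolP (G c1 c2); last first.
  (* Deleting N[c1] and N[c2] leaves the path p, x, q as a component. *)
  pose T' := c1 |: (c2 |: T).
  have stT' : stable G T'.
    have [E|ne] := eqVneq c1 c2; first by rewrite /T' E setUA setUid; apply: stableU1.
    by apply: stableU1 (stableU1 stT ac2) _; rewrite aliveU1 ne adjC nc12.
  have aT' y : alive T y -> y != c1 -> y != c2 -> ~~ G y c1 -> ~~ G y c2 -> alive T' y.
    by move=> ay y1 y2 g1 g2; rewrite !aliveU1 ay y1 y2 !(adjC _ y) g1 g2.
  have ax' : alive T' x by apply: aT'; rewrite // eq_sym.
  have ap' : alive T' p by apply: aT'; rewrite // eq_sym.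
  have aq' : alive T' q by apply: aT'; rewrite // eq_sym.
  have T'T y : alive T' y -> alive T y.
    by apply: aliveS; apply: subset_trans (subsetUr _ _) (subsetUr _ _).
  have dz1 : ~~ alive T' z1 by rewrite aliveU1 (adjC c1) zc1 andbF.
  have dz2 : ~~ alive T' z2 by rewrite !aliveU1 (adjC c2) zc2 !andbF.
  have sp : simp T' p.
    apply: simpI ap' _ => y z ay az py pz.
    suff E w : alive T' w -> G p w -> w = x by rewrite (E y ay py) (E z az pz) eqxx.
    move=> aw pw; case/orP: (Np w (T'T w aw) pw) => /eqP // E.
    by rewrite E (negbTE dz1) in aw.
  have [c qc sc] := simp_spread stT' sp ax' aq' px xq qp npq.
  case/orP: (Nq c (T'T c (simp_alive sc)) qc) => /eqP E; rewrite E in sc.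
    by exfalso; move: sc; apply/negP; apply: (nonsimp ap' aq' xp xq pq npq).
  by rewrite (simp_alive sc) in dz2.
have c21 : G c2 c1 by rewrite adjC.
have ngc1 := ngn z1 c1 az1 ngz1 ac1 zc1; have ngc2 := ngn z2 c2 az2 ngz2 ac2 zc2.
have c1z1 : G c1 z1 by rewrite adjC.
have c2z2 : G c2 z2 by rewrite adjC.
have [e1 [_ _ _ _ Nc1]] := two c1 z1 ac1 ngc1 az1 c1z1.
have [e2 [_ _ _ _ Nc2]] := two c2 z2 ac2 ngc2 az2 c2z2.
have /eqP E1 : c2 == e1 by have := Nc1 c2 ac2 c12; rewrite (negbTE c2z1).
have /eqP E2 : c1 == e2 by have := Nc2 c1 ac1 c21; rewrite (negbTE c1z2).
subst e1 e2.
pose l := [:: x; p; z1; c1; c2; z2; q].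
have nq a b : G a b -> (a == b) = false by move=> /adj_neq /negbTE.
have uniql : uniq l.
  rewrite /= !inE !negb_or (adj_neq xp) (adj_neq xq) (adj_neq pz1) (adj_neq zc1).
  rewrite (adj_neq c12) (adj_neq c2z2) (adj_neq z2q) z12 z1c2 c1q c1z2 pq.
  rewrite (eq_sym x z1) z1x (eq_sym x z2) z2x (eq_sym x) c1x (eq_sym x) c2x.
  rewrite (eq_sym p c1) c1p (eq_sym p c2) c2p c2q /= !andbT; apply/andP; split.
    by apply: contraNneq npq => ->; rewrite adjC.
  by apply: contraNneq npq => <-.
pose v (i : 'Z_7) := nth x l i.
have al i : alive T (v i) by case: i => [[|[|[|[|[|[|[|i]]]]]]]].
have Nv a b c : G a b -> G a c -> (forall y, alive T y -> G a y -> (y == b) || (y == c)) ->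
    forall y, alive T y -> G a y = (y == b) || (y == c).
  move=> gab gac N y ay; apply/idP/orP; last by case=> /eqP ->.
  by move=> gay; apply/orP; apply: N.
have HN i y : alive T y -> G (v i) y = (y == v (i + 1)) || (y == v (i - 1)).
  move=> ay; case: i => [[|[|[|[|[|[|[|i]]]]]]]] Hi //; rewrite [X in _ = X]orbC.
  - by apply: (Nv x q p) => // z az xz; rewrite orbC Nx.
  - exact: (Nv p x z1).
  - exact: (Nv z1 p c1).
  - exact: (Nv c1 z1 c2).
  - by apply: (Nv c2 c1 z2) => // z az cz; rewrite orbC Nc2.
  - by apply: (Nv z2 c2 q) => // z az cz; rewrite orbC Nz2.
  by apply: (Nv q z2 x) => // z az cz; rewrite orbC Nq.
exists T, v; split.
  have vE j k : (v j == v k) = (j == k) by rewrite nth_uniq //; apply: ltn_ord.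
  split=> // i j; rewrite HN // !vE /cyc7; congr (_ || _).
  by rewrite -subr_eq eq_sym.
move=> y i; apply/negP => yi; have := attached_adj yi.
rewrite (HN _ _ (attached_al yi)) ![y == _]eq_sym.
by rewrite !(negbTE (attached_neq _ yi)).
Qed.

Lemma least_nat (P : nat -> Prop) : (exists n, P n) ->
  exists n, P n /\ forall m, P m -> (n <= m)%N.
Proof.
case=> n; elim/ltn_ind: n => n IH Pn.
have [[m [mn Pm]]|no] := excluded_middle_informative (exists m, (m < n)%N /\ P m).
  exact: IH mn Pm.
exists n; split=> // m Pm; rewrite leqNgt; apply/negP => mn.
by apply: no; exists m.
Qed.

(** In a smallest T every element, when put back, attaches something to the heptagon,
    and by two_hubs_attached there is at most one such element. *)
Lemma small_isolated_heptagon : (exists x, ~~ good set0 x) ->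
  exists v, isolated_heptagon set0 v \/ exists c u d,
    [/\ hub set0 v c, attached set0 v u 0, attached set0 v d 3 & attached set0 v d 4].
Proof.
move=> ng; have [T0 [v0 h0]] := isolated_heptagon_exists ng.
have [n [[T [v [hT cT]]] minT]] := @least_nat
  (fun n => exists T v, isolated_heptagon T v /\ #|T| = n)
  (ex_intro _ _ (ex_intro _ T0 (ex_intro _ v0 (conj h0 erefl)))).
have at_ c : c \in T -> exists y i, attached (T :\ c) v y i.
  move=> cT'; have [hv ac cv ch] := isolated_hub hT cT'.
  have [/existsP [y /existsP [i yi]]|no] :=
    boolP [exists y, exists i, attached (T :\ c) v y i]; first by exists y, i.
  have : isolated_heptagon (T :\ c) v.
    split=> // y i; apply: contra no => yi.
    by apply/existsP; exists y; apply/existsP; exists i.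
  move=> hT'; have := minT _ (ex_intro _ _ (ex_intro _ v (conj hT' erefl))).
  by rewrite -cT (cardsD1 c T) cT' add1n ltnn.
have [T0'|[c cT']] := set_0Vmem T; first by exists v; left; rewrite -T0'.
have [y [i yi]] := at_ c cT'.
have Tc : T :\ c = set0.
  apply/setP => c'; rewrite !inE; apply/negbTE/negP => /andP [c'c c'T].
  have [y' [i' yi']] := at_ c' c'T.
  by move: c'c; rewrite (two_hubs_attached hT cT' c'T yi yi') eqxx.
have hc := isolated_hub hT cT'; rewrite Tc in hc yi.
have [p [u [d [u0 d3 d4]]]] := hub_pair hc yi.
exists (fun j => v (p + j)); right; exists c, u, d; split=> //; exact: hub_rot.
Qed.


(** * A small stable set whose neighbourhood covers all edges *)

Definition nbhd_covers A : Prop := forall x y, G x y ->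
  (exists2 a, a \in A & G a x) \/ exists2 a, a \in A & G a y.

Lemma leq_induced_matching_number A (f : 'I_s -> 'I_s) :
  {in A, forall a, G a (f a)} ->
  {in A &, forall a b, a != b -> [/\ ~~ G a b, ~~ G a (f b) & ~~ G (f a) (f b)]} ->
  (#|A| <= induced_matching_number G)%N.
Proof.
move=> Gf indep; pose e a := [set a; f a].
have fne a b : a \in A -> b \in A -> a != b ->
    [/\ a != f b, f a != b & f a != f b].
  move=> aA bA ab; have [n1 n2 n3] := indep a b aA bA ab.
  have ba : b != a by rewrite eq_sym.
  have [_ n2' _] := indep b a bA aA ba; split.
  - by apply: contraNneq n1 => ->; rewrite adjC Gf.
  - by apply: contraNneq n1 => <-; rewrite Gf.
  by apply: contraNneq n2 => <-; rewrite Gf.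
have disj a b : a \in A -> b \in A -> a != b -> [disjoint e a & e b].
  move=> aA bA ab; have [n1 n2 n3] := fne a b aA bA ab.
  rewrite disjoints_subset; apply/subsetP => x; rewrite !inE negb_or.
  by case/orP => /eqP ->; rewrite ?ab ?n1 ?n2 ?n3.
have injE : {in A &, injective e}.
  move=> a b aA bA E; apply/eqP; apply: contraT => ab.
  by have := disj a b aA bA ab; rewrite E -setI_eq0 setIid => /eqP/setP/(_ b); rewrite !inE eqxx.
rewrite -(card_in_imset injE); apply: (leq_bigmax_cond (e @: A)).
apply/andP; split.
  apply/andP; split.
    apply/subsetP => _ /imsetP [a aA ->]; apply/imsetP; exists (a, f a) => //.
    by rewrite inE /= Gf.
  apply/trivIsetP => _ _ /imsetP [a aA ->] /imsetP [b bA ->] ab.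
  by apply: disj => //; apply: contraNneq ab => ->.
apply/forall_inP => _ /imsetP [[x y] /= xy ->]; rewrite inE /= in xy.
apply/implyP => /subsetP sub.
have /bigcupP [_ /imsetP [a aA ->] xa] := sub x (set21 x y).
have /bigcupP [_ /imsetP [b bA ->] yb] := sub y (set22 x y).
have [E|ab] := eqVneq a b; last first.
  have ba : b != a by rewrite eq_sym.
  have [n1 n2 n3] := indep a b aA bA ab; have [_ n4 _] := indep b a bA aA ba.
  by move: xy; case/set2P: xa => ->; case/set2P: yb => ->; apply/contraTT => _; rewrite // adjC.
suff -> : [set x; y] = e a by apply: imset_f.
move: xy; rewrite -E in yb; case/set2P: xa => ->; case/set2P: yb => ->; rewrite ?adj_irr //.
by move=> _; rewrite /e setUC.
Qed.

(** Take X maximal among the stable sets of simplicial vertices, and A maximal among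
    the stable sets outside X. Every a in A has a neighbour f a in X, and since the
    vertices of X are simplicial, the edges between a and f a form an induced
    matching. *)
Lemma simplicial_nbhd_covers : (forall x, good set0 x) ->
  exists A, [/\ stable G A, nbhd_covers A & (#|A| <= induced_matching_number G)%N].
Proof.
move=> allgood.
have st0 : stable G set0 by apply/stableP => a b; rewrite inE.
pose PX (X : {set 'I_s}) := stable G X && (X \subset [set x | simp set0 x]).
have [X mX _] := @maxset_exists _ PX set0 ltac:(by rewrite /PX st0 sub0set).
have [/andP [stX /subsetP simpX] maxX] := maxsetP mX.
have sX x : x \in X -> simp set0 x by move/simpX; rewrite inE.
have a0 := alive0.
have XN v : v \notin X -> exists2 x, x \in X & G v x.
  move=> vX; have [u su vu] : exists2 u, simp set0 u & (v == u) || G v u.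
    case/goodP: (allgood v) => [sv|[u vu su]]; first by exists v; rewrite ?eqxx.
    by exists u; rewrite ?vu ?orbT.
  have [uX|uX] := boolP (u \in X).
    by exists u => //; case/orP: vu => // /eqP E; rewrite E uX in vX.
  have [/exists_inP [x xX ux]|no] := boolP [exists x in X, G u x].
    exists x => //; case/orP: vu => [/eqP -> //|vu].
    have [E|vx] := eqVneq v x; first by rewrite E xX in vX.
    by apply: (simp_adj su) => //; rewrite adjC.
  have : PX (u |: X).
    rewrite /PX stableU1 //=.
      by apply/subsetP => z /setU1P [->|/simpX //]; rewrite inE.
    rewrite /alive uX /=; apply/forall_inP => x xX.
    by move: no; rewrite negb_exists_in => /forall_inP /(_ x xX); rewrite adjC.
  by move/maxX => E; move: uX; rewrite -E ?subsetUr // setU11.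
pose PA (A : {set 'I_s}) := stable G A && (A \subset ~: X).
have [A mA _] := @maxset_exists _ PA set0 ltac:(by rewrite /PA st0 sub0set).
have [/andP [stA AX] maxA] := maxsetP mA.
have AN v : v \notin X -> v \notin A -> exists2 a, a \in A & G a v.
  move=> vX vA; apply/exists_inP; apply: contraT => no.
  have : PA (v |: A).
    rewrite /PA stableU1 //=.
      by rewrite subUset sub1set inE vX.
    rewrite /alive vA /=; apply/forall_inP => x xX.
    by move: no; rewrite negb_exists_in => /forall_inP /(_ x xX).
  by move/maxA => E; move: vA; rewrite -E ?subsetUr // setU11.
exists A; split=> //.
  move=> x y xy; have [xA|xA] := boolP (x \in A); first by right; exists x.
  have [yA|yA] := boolP (y \in A); first by left; exists y; rewrite // adjC.
  have [xX|xX] := boolP (x \in X); last by left; apply: AN.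
  have [yX|yX] := boolP (y \in X); last by right; apply: AN.
  by move/stableP: stX => /(_ x y xX yX); rewrite xy.
pose f a := odflt a [pick x in X | G a x].
have fP a : a \in A -> f a \in X /\ G a (f a).
  move=> /(subsetP AX); rewrite inE => /XN [x xX ax]; rewrite /f.
  by case: pickP => [z /andP []//|/(_ x)]; rewrite xX ax.
apply: (@leq_induced_matching_number A f); first by move=> a /fP [].
move=> a b aA bA ab; have [faX af] := fP a aA; have [fbX bf] := fP b bA.
have nab : ~~ G a b by move/stableP: stA; apply.
split=> //; last by move/stableP: stX; apply.
apply: contra nab => afb; apply: (simp_adj (sX _ fbX)) => //; by rewrite adjC.
Qed.

Lemma connected_ind (P : pred 'I_s) x : connected_graph G -> P x ->
  (forall a b, P a -> G a b -> P b) -> forall y, P y.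
Proof.
move=> conn Px step y; have /connectP [l pl ->] := conn x y.
by elim: l x Px pl => //= a l IH x Px /andP [xa /IH]; apply; apply: step xa.
Qed.

Lemma hept_two_edges T v : heptagon T v -> (2 <= induced_matching_number G)%N.
Proof.
move=> hv; pose A := [set v 0; v 3]; pose f x := if x == v 0 then v 6 else v 4.
have cardA : #|A| = 2%N by rewrite cards2 (hept_inj hv).
rewrite -cardA; have f3 : f (v 3) = v 4 by rewrite /f (hept_inj hv).
have f0 : f (v 0) = v 6 by rewrite /f eqxx.
apply: (@leq_induced_matching_number A f).
  by move=> a /set2P [] ->; rewrite ?f0 ?f3 (hept_adj hv).
by move=> a b /set2P [] -> /set2P [] ->; rewrite ?eqxx // => _;
  rewrite ?f0 ?f3 !(hept_adj hv).
Qed.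

(** On the cycle v 0 and v 3 see all but the stable set v 0, v 3, v 5; off the cycle
    they miss only vertices in W. *)
Lemma hept_nbhd_covers T v (W : pred 'I_s) : heptagon T v ->
  (forall x y, W x -> G x y -> (exists i, y = v i) -> False) ->
  {in W &, forall x y, ~~ G x y} ->
  (forall x, [\/ exists i, x = v i, W x | G (v 0) x \/ G (v 3) x]) ->
  nbhd_covers [set v 0; v 3].
Proof.
move=> hv Wv WW all x y xy.
have cov z : G (v 0) z || G (v 3) z -> exists2 a, a \in [set v 0; v 3] & G a z.
  by case/orP => h; [exists (v 0) | exists (v 3)]; rewrite ?set21 ?set22.
have yx : G y x by rewrite adjC.
have [hx|hx] := boolP (G (v 0) x || G (v 3) x); first by left; apply: cov.
have [hy|hy] := boolP (G (v 0) y || G (v 3) y); first by right; apply: cov.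
exfalso; case: (all x) => [[i xi]|Wx|/orP]; last by apply/negP.
  case: (all y) => [[j yj]|Wy|/orP]; last by apply/negP.
    have : [|| cyc7 0 i, cyc7 3 i, cyc7 0 j, cyc7 3 j | ~~ cyc7 i j].
      by move: (j); apply: Z7_all; move: (i); apply: Z7_all; vm_compute.
    move: hx hy xy; rewrite xi yj !(hept_adj hv).
    by move=> /norP [/negbTE -> /negbTE ->] /norP [/negbTE -> /negbTE ->] ->.
  by apply: (Wv y x Wy yx); exists i.
case: (all y) => [yj|Wy|/orP]; last by apply/negP.
  exact: (Wv x y Wx xy yj).
by have := WW x y Wx Wy; rewrite xy.
Qed.

Lemma connected_nbhd_covers : connected_graph G -> (exists x, ~~ good set0 x) ->
  exists A, [/\ stable G A, nbhd_covers A & (#|A| <= induced_matching_number G)%N].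
Proof.
move=> conn /small_isolated_heptagon [v hc].
have hv : heptagon set0 v by case: hc => [[]|[c [u [d [[]]]]]].
exists [set v 0; v 3]; split; last first.
- by rewrite cards2 (hept_inj hv) (leq_trans _ (hept_two_edges hv)).
- case: hc => [[_ iso]|[c [u [d [hh u0 d3 d4]]]]].
    apply: (hept_nbhd_covers (W := pred0) hv) => // x; constructor 1.
    have := connected_ind (P := fun x => [exists i, x == v i]) (x := v 0) conn.
    case/(_ _ _ x)/existsP => [||i /eqP ->]; last by exists i.
      by apply/existsP; exists 0.
    move=> a b /existsP [i /eqP ->] ib.
    case: (hept_nbr hv (eqxx _) (eqxx _) (alive0 b) ib) => [E|E|h].
    + by apply/existsP; exists (i + 1); rewrite E.
    + by apply/existsP; exists (i - 1); rewrite E.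
    by case/negP: (iso b i).
  have [_ ac cv _] := hh.
  apply: (hept_nbhd_covers (W := pred1 c) hv).
  - by move=> x y /eqP -> cy [i E]; have := cv i; rewrite -E cy.
  - by move=> x y /eqP -> /eqP ->; rewrite adj_irr.
  move=> x; have : [|| [exists i, x == v i], x == c, x == u | x == d].
    apply: (connected_ind (P := fun x => [|| [exists i, x == v i], x == c, x == u | x == d])
      (x := v 0) conn).
      by apply/orP; left; apply/existsP; exists 0.
    have vE i : [exists j, v i == v j] by apply/existsP; exists i.
    move=> a b /or4P [/existsP [i /eqP ->]|/eqP ->|/eqP ->|/eqP ->] ab.
    + case: (hept_nbr hv (eqxx _) (eqxx _) (alive0 b) ab) => [->|->|h]; rewrite ?vE //.
      by case/orP: (attached_pair hh u0 d3 d4 h) => /andP [-> _]; rewrite !orbT.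
    + by case/orP: (hub_nbr hh u0 d3 d4 (alive0 b) ab) => ->; rewrite !orbT.
    + by case/orP: (hub_nbrL hh u0 d3 d4 (alive0 b) ab) => /eqP ->; rewrite ?vE ?eqxx ?orbT.
    by case/or3P: (hub_nbrR hh u0 d3 d4 (alive0 b) ab) => /eqP ->; rewrite ?vE ?eqxx ?orbT.
  case/or4P => [/existsP [i /eqP ->]|xc|/eqP ->|/eqP ->].
  - by constructor 1; exists i.
  - by constructor 2.
  - by constructor 3; left; apply: attached_adj u0.
  by constructor 3; right; apply: attached_adj d3.
by apply/stableP => a b /set2P [] -> /set2P [] ->; rewrite (hept_adj hv).
Qed.

End GraphBasics.

Lemma simplicial_good s (G : sgraph s) : simplicial_graph G -> forall x, good G set0 x.
Proof.
move=> sG x; have simpE v : simplicial_vertex G v -> simp G set0 v.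
  move=> sv; apply: simpI (alive0 G v) _ => y z _ _ vy vz yz.
  by apply: sv yz; rewrite inE ?vy ?vz orbT.
by case: (sG x) => [/simpE|[u xu /simpE]]; [apply: simp_good | apply: adj_simp_good].
Qed.

Lemma exists_nbhd_covers s (G : sgraph s) : well_covered G ->
  simplicial_graph G \/ [/\ connected_graph G, ~ contains_cycle G 4 & ~ contains_cycle G 5] ->
  exists A, [/\ stable G A, nbhd_covers G A & (#|A| <= induced_matching_number G)%N].
Proof.
move=> hwc [sG|[conn no4 no5]].
  exact: simplicial_nbhd_covers (simplicial_good sG).
have [/existsP ng|] := boolP [exists x, ~~ good G set0 x].
  exact: connected_nbhd_covers.
rewrite negb_exists => /forallP allg; apply: simplicial_nbhd_covers => x.
by have := allg x; rewrite negbK.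
Qed.

Local Open Scope ring_scope.

(** * Monomial ideals *)

Section MonomialIdeals.
Variables (K : fieldType) (s : nat).
Implicit Types (D : pred 'X_{1..s}) (f g : {mpoly K[s]}) (m k : 'X_{1..s}).

(** A monomial ideal is encoded by the set D of its monomials, which turns membership
    into a condition on supports. *)
Definition mideal D f : Prop := forall m, m \in msupp f -> D m.

Definition up_closed D : Prop := forall m k, D m -> D (m + k)%MM.

Definition hits (W : {set 'I_s}) m : bool := [exists i in W, 0 < m i]%N.

Lemma midealP D f : mideal D f <-> forall m, ~~ D m -> f@_m = 0.
Proof.
split=> h m; last by rewrite mcoeff_msupp; apply: contraNT => /h /eqP.
by move=> nD; apply/eqP; rewrite mcoeff_eq0; apply: contra nD => /h.
Qed.

Lemma mideal0 D : mideal D 0.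
Proof. by move=> m; rewrite msupp0. Qed.

Lemma midealD D f g : mideal D f -> mideal D g -> mideal D (f + g).
Proof. by rewrite !midealP => hf hg m nD; rewrite mcoeffD hf ?hg ?addr0. Qed.

Lemma midealM D f g : up_closed D -> mideal D f -> mideal D (g * f).
Proof.
move=> upD hf m /msuppM_le /allpairsP [[a b] /= [_ bf ->]].
by rewrite addmC; apply/upD/hf.
Qed.

Lemma mideal_ideal D : up_closed D -> is_ideal (mideal D).
Proof.
by move=> upD; split; [apply: mideal0 | apply: midealD | move=> f g; apply: midealM].
Qed.

Lemma mideal_sub D D' f : (forall m, D m -> D' m) -> mideal D f -> mideal D' f.
Proof. by move=> sub hf m /hf /sub. Qed.

Lemma midealX D m : mideal D 'X_[m] <-> D m.
Proof.
by rewrite /mideal msuppX; split=> [|h k]; [apply; rewrite inE | rewrite inE => /eqP ->].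
Qed.

Lemma mideal_colonX D u f : mideal D (f * 'X_[u]) <-> mideal (fun m => D (u + m)%MM) f.
Proof.
rewrite /mideal; split=> h m; last by rewrite (perm_mem (msuppMX _ _)) => /mapP [k kf ->]; apply: h.
by move=> mf; apply: h; rewrite (perm_mem (msuppMX _ _)); apply: map_f.
Qed.

Definition mrestr (D : pred 'X_{1..s}) f : {mpoly K[s]} :=
  \sum_(m <- msupp f | D m) f@_m *: 'X_[m].

Lemma mcoeff_mrestr D f m : (mrestr D f)@_m = if D m then f@_m else 0.
Proof.
rewrite /mrestr raddf_sum /=.
have [mf|mf] := boolP (m \in msupp f); last first.
  rewrite (eqP (_ : f@_m == 0)) ?mcoeff_eq0 // if_same big1_seq // => k /andP [_ kf].
  rewrite mcoeffZ mcoeffX; case: eqP => [E|_]; last by rewrite mulr0.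
  by rewrite -E kf in mf.
rewrite big_mkcond (bigD1_seq m) ?msupp_uniq //= big1_seq ?addr0.
  by case: (D m); rewrite // mcoeffZ mcoeffX eqxx mulr1.
by move=> k /andP [/negbTE km kf]; case: (D k) => //; rewrite mcoeffZ mcoeffX km mulr0.
Qed.

Lemma mideal_addX D u f : up_closed D ->
  mideal (fun m => D m || (u <= m)%MM) f <-> exists a, mideal D (f - a * 'X_[u]).
Proof.
move=> upD; split=> [h|[a h]].
  exists (\sum_(m <- msupp f | (u <= m)%MM) f@_m *: 'X_[m - u]).
  rewrite mulr_suml (eq_bigr (fun m => f@_m *: 'X_[m])); last first.
    by move=> m um; rewrite -scalerAl -mpolyXD submK.
  rewrite -/(mrestr (fun m => (u <= m)%MM) f); apply/midealP => m nD.
  rewrite mcoeffB mcoeff_mrestr; case: ifP => [_|um]; first by rewrite subrr.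
  by rewrite subr0; apply/eqP; rewrite mcoeff_eq0; apply/negP => /h; rewrite um (negbTE nD).
rewrite -(subrK (a * 'X_[u]) f); apply: midealD.
  by apply: mideal_sub h => m ->.
move=> m; rewrite (perm_mem (msuppMX _ _)) => /mapP [k _ ->].
by rewrite lem_addr orbT.
Qed.

(** The kernel is the ideal generated by the variables in W, which is therefore
    prime. *)
Definition kill (W : {set 'I_s}) : {mpoly K[s]} -> {mpoly K[s]} :=
  mmap (@mpolyC s K) (fun i => if i \in W then 0 else 'X_i).

HB.instance Definition _ W := GRing.RMorphism.on (kill W).

Lemma kill_monomial W m : kill W 'X_[m] = if hits W m then 0 else 'X_[m].
Proof.
rewrite /kill mmapX /mmap1; case: ifP => [/exists_inP [i iW mi]|/negbT nh].
  by rewrite (bigD1 i) //= iW expr0n eqn0Ngt mi mul0r.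
rewrite [RHS]mpolyXE_id; apply: eq_bigr => i _; case: ifP => // iW.
move: nh; rewrite negb_exists_in => /forall_inP /(_ i iW); rewrite -eqn0Ngt => /eqP ->.
by rewrite !expr0.
Qed.

Lemma mcoeff_kill W f m : (kill W f)@_m = if hits W m then 0 else f@_m.
Proof.
have -> : kill W f = mrestr (fun m => ~~ hits W m) f.
  rewrite {1}[f]mpolyE raddf_sum /mrestr [RHS]big_mkcond /=; apply: eq_bigr => k _.
  rewrite -mul_mpolyC rmorphM /= kill_monomial /kill mmapC.
  by case: (hits W k); rewrite ?mulr0 // mul_mpolyC.
by rewrite mcoeff_mrestr; case: (hits W m).
Qed.

Lemma kill_eq0 W f : kill W f = 0 <-> mideal (hits W) f.
Proof.
rewrite midealP; split=> [E m nh|h].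
  by have := mcoeff_kill W f m; rewrite E mcoeff0 (negbTE nh).
by apply/mpolyP => m; rewrite mcoeff_kill mcoeff0; case: ifP => // /negbT /h.
Qed.

Lemma hits_prime W : is_prime_ideal (mideal (hits W)).
Proof.
split.
- apply: mideal_ideal => m k /exists_inP [i iW mi]; apply/exists_inP; exists i => //.
  by rewrite mnmDE ltn_addr.
- move/kill_eq0/eqP; rewrite rmorph1; apply/negP; exact: oner_neq0.
move=> f g /kill_eq0/eqP; rewrite rmorphM mulf_eq0 => /orP [] /eqP /kill_eq0; by [left|right].
Qed.

End MonomialIdeals.

(** * The edge ideal as a monomial ideal, and the v-number *)

Section EdgeIdeal.
Variables (K : fieldType) (s : nat) (G : sgraph s).
Implicit Types (A W : {set 'I_s}) (m k : 'X_{1..s}) (f : {mpoly K[s]}).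

Definition has_edge m : bool := [exists i, exists j, [&& G i j, 0 < m i & 0 < m j]]%N.

Lemma has_edgeP m :
  reflect (exists i j, [/\ G i j, (0 < m i)%N & (0 < m j)%N]) (has_edge m).
Proof.
apply: (iffP existsP) => [[i /existsP [j /and3P [*]]]|[i [j [ij mi mj]]]]; first by exists i, j.
by exists i; apply/existsP; exists j; rewrite ij mi.
Qed.

Lemma hitsP W m : reflect (exists2 i, i \in W & 0 < m i)%N (hits W m).
Proof. exact: exists_inP. Qed.

Lemma has_edge_up : up_closed has_edge.
Proof.
move=> m k /has_edgeP [i [j [ij mi mj]]]; apply/has_edgeP; exists i, j.
by rewrite !mnmDE !ltn_addr.
Qed.

Lemma hits_up W : up_closed (@hits s W).
Proof.
move=> m k /hitsP [i iW mi]; apply/hitsP; exists i => //.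
by rewrite mnmDE ltn_addr.
Qed.

Lemma edge_monomial m (i j : 'I_s) : G i j -> (0 < m i)%N -> (0 < m j)%N ->
  'X_[m] = 'X_[m - U_(i) - U_(j)] * ('X_i * 'X_j) :> {mpoly K[s]}.
Proof.
move=> ij mi mj; rewrite -!mpolyXD; congr mpolyX; apply/mnmP => l.
rewrite !mnmE; have ne := adj_neq ij.
case: (eqVneq i l) => [il|_]; case: (eqVneq j l) => [jl|_] /=; subst; rewrite ?eqxx in ne * => //;
  lia.
Qed.

Lemma edge_idealP f : @edge_ideal s G K f <-> mideal has_edge f.
Proof.
split=> [[n [c [g [gE ->]]]]|h].
  elim/big_ind: _ => [|p q|k _]; [exact: mideal0 | exact: midealD |].
  apply: midealM; first exact: has_edge_up.
  have [i [j [ij ->]]] := gE k; rewrite -mpolyXD midealX; apply/has_edgeP.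
  by exists i, j; rewrite !mnmDE !mnm1E !eqxx addn1; split.
pose mk (l : 'I_(size (msupp f))) := nth 0%MM (msupp f) l.
have [c hc] : exists c : 'I_(size (msupp f)) -> {mpoly K[s]} * {mpoly K[s]}, forall l,
    (exists i j, G i j /\ (c l).2 = 'X_i * 'X_j) /\ f@_(mk l) *: 'X_[mk l] = (c l).1 * (c l).2.
  apply: (fin_all_exists (P := fun l (c : {mpoly K[s]} * {mpoly K[s]}) =>
    (exists i j, G i j /\ c.2 = 'X_i * 'X_j) /\ f@_(mk l) *: 'X_[mk l] = c.1 * c.2)) => l.
  have /has_edgeP [i [j [ij mi mj]]] : has_edge (mk l) by apply: h; rewrite mem_nth.
  exists (f@_(mk l) *: 'X_[mk l - U_(i) - U_(j)], 'X_i * 'X_j); split; first by exists i, j.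
  by rewrite /= -scalerAl -edge_monomial.
exists (size (msupp f)), (fun l => (c l).1), (fun l => (c l).2).
split; first by move=> l; case: (hc l).
rewrite {1}[f]mpolyE (big_nth 0%MM) big_mkord; apply: eq_bigr => l _.
by case: (hc l).
Qed.

Definition mnm_set A : 'X_{1..s} := [multinom (i \in A : nat) | i < s].

Lemma mdeg_mnm_set A : mdeg (mnm_set A) = #|A|.
Proof.
rewrite mdegE (eq_bigr (fun i => (i \in A : nat))) => [|i _]; last by rewrite mnmE.
by rewrite -sum1_card [RHS]big_mkcond /=.
Qed.

Lemma mnm_set_gt0 A i : (0 < mnm_set A i)%N = (i \in A).
Proof. by rewrite mnmE lt0b. Qed.

(** If N(A) covers all edges, then the colon ideal of the product of the variables
    of A is the prime ideal generated by the variables of N(A). *)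
Lemma nbhd_covers_v_degree A : stable G A -> nbhd_covers G A ->
  v_degree (@edge_ideal s G K) #|A|.
Proof.
move=> /stableP stA covA; pose W := [set x | [exists a in A, G a x]].
have colonE g : colon (@edge_ideal s G K) 'X_[mnm_set A] g <-> mideal (hits W) g.
  rewrite /colon edge_idealP mideal_colonX; split; apply: mideal_sub => m.
    case/has_edgeP => i [j [ij]]; rewrite !mnmDE !addn_gt0 !mnm_set_gt0 => hi hj.
    have inW x y : G x y -> x \in A -> y \in W.
      by move=> xy xA; rewrite inE; apply/exists_inP; exists x.
    have ji : G j i by rewrite adjC.
    have [iA|iA] := boolP (i \in A).
      case/orP: hj => [jA|mj]; first by have := stA i j iA jA; rewrite ij.
      by apply/hitsP; exists j => //; apply: inW ij iA.
    rewrite (negbTE iA) /= in hi; have [jA|jA] := boolP (j \in A).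
      by apply/hitsP; exists i => //; apply: inW ji jA.
    rewrite (negbTE jA) /= in hj; apply/hitsP.
    by case: (covA i j ij) => [] [a aA ax]; [exists i | exists j]; rewrite // (inW a).
  case/hitsP => i; rewrite inE => /exists_inP [a aA ai] mi; apply/has_edgeP.
  by exists a, i; rewrite !mnmDE !addn_gt0 mnm_set_gt0 aA mi orbT.
exists 'X_[mnm_set A], (mideal (hits W)); split=> //.
- by rewrite dhomogX /= mdeg_mnm_set.
split; first exact: hits_prime.
by exists 'X_[mnm_set A] => g; rewrite colonE.
Qed.

Lemma vnumber_leq d : v_degree (@edge_ideal s G K) d -> (vnumber (@edge_ideal s G K) <= d)%N.
Proof.
move=> hd; have [n [hn minn]] := least_nat (ex_intro _ d hd).
have [_] : is_vnumber (@edge_ideal s G K) (vnumber (@edge_ideal s G K)).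
  by apply: epsilon_spec; exists n.
exact.
Qed.

End EdgeIdeal.

(** * Graded submodules of free modules and their resolutions *)

Section GradedModules.
Variables (K : fieldType) (s : nat).
Local Notation S := {mpoly K[s]}.
Implicit Types (i d e : nat) (k : 'X_{1..s}).

(** A matrix of degree 0 from the free module with shifts sh' to the one with
    shifts sh. *)
Definition homog_mx m n (sh' : 'I_m -> nat) (sh : 'I_n -> nat) (D : 'M[S]_(m, n)) : Prop :=
  forall a b k, k \in msupp (D a b) -> (mdeg k + sh b)%N = sh' a.

Definition hcomp n (sh : 'I_n -> nat) d (v : 'rV[S]_n) : 'rV[S]_n :=
  \row_b mrestr (fun k => mdeg k + sh b == d)%N (v 0 b).

Lemma mrestr_mul d e e' (p q : S) :
  (forall k, k \in msupp q -> (mdeg k + e)%N = e') ->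
  mrestr (fun k => mdeg k + e == d)%N (p * q) = mrestr (fun k => mdeg k + e' == d)%N p * q.
Proof.
move=> hq; apply/mpolyP => k; rewrite mcoeff_mrestr !mcoeffM.
case: ifP => kd; last apply/esym/big1 => /= -[a b] /= /eqP kab;
  first apply: eq_bigr => /= -[a b] /= /eqP kab.
  rewrite mcoeff_mrestr; case: ifP => // ad.
  have [bq|] := boolP ((b : 'X_{1..s}) \in msupp q); last first.
    by rewrite -mcoeff_eq0 => /eqP ->; rewrite !mulr0.
  by move: ad; rewrite -(hq _ bq) addnA -mdegD -kab kd.
rewrite mcoeff_mrestr; case: ifP => ad; last by rewrite mul0r.
have [bq|] := boolP ((b : 'X_{1..s}) \in msupp q); last first.
  by rewrite -mcoeff_eq0 => /eqP ->; rewrite mulr0.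
by move: ad; rewrite -(hq _ bq) addnA -mdegD -kab kd.
Qed.

Lemma mrestr_sum (I : Type) (r : seq I) (P : pred 'X_{1..s}) (F : I -> S) :
  mrestr P (\sum_(j <- r) F j) = \sum_(j <- r) mrestr P (F j).
Proof.
apply/mpolyP => k; rewrite mcoeff_mrestr !raddf_sum /=.
case: ifP => Pk; first by apply: eq_bigr => j _; rewrite mcoeff_mrestr Pk.
by rewrite big1 // => j _; rewrite mcoeff_mrestr Pk.
Qed.

Lemma hcomp_mul m n (sh' : 'I_m -> nat) (sh : 'I_n -> nat) (D : 'M[S]_(m, n)) d w :
  homog_mx sh' sh D -> hcomp sh d (w *m D) = hcomp sh' d w *m D.
Proof.
move=> hD; apply/rowP => b; rewrite !mxE mrestr_sum; apply: eq_bigr => a _.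
by rewrite mxE; apply: mrestr_mul => k; apply: hD.
Qed.

Lemma hcomp_supp n (sh : 'I_n -> nat) d (v : 'rV[S]_n) b k :
  k \in msupp (hcomp sh d v 0 b) -> (mdeg k + sh b)%N = d.
Proof. by rewrite mxE mcoeff_msupp mcoeff_mrestr; case: ifP => [/eqP //|]; rewrite eqxx. Qed.

Lemma hcomp_id n (sh : 'I_n -> nat) d (v : 'rV[S]_n) :
  (forall b k, k \in msupp (v 0 b) -> (mdeg k + sh b)%N = d) -> hcomp sh d v = v.
Proof.
move=> h; apply/rowP => b; apply/mpolyP => k; rewrite mxE mcoeff_mrestr.
case: ifP => // /negbT kd; apply/esym/eqP; rewrite mcoeff_eq0.
by apply: contra kd => /h ->.
Qed.

Lemma hcomp_row m n (sh' : 'I_m -> nat) (sh : 'I_n -> nat) (D : 'M[S]_(m, n)) a :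
  homog_mx sh' sh D -> hcomp sh (sh' a) (row a D) = row a D.
Proof. by move=> hD; apply: hcomp_id => b k; rewrite mxE; apply: hD. Qed.

Definition submod n (Z : 'rV[S]_n -> Prop) : Prop :=
  [/\ Z 0, forall u v, Z u -> Z v -> Z (u + v) & forall c v, Z v -> Z (c *: v)].

Definition graded n (sh : 'I_n -> nat) (Z : 'rV[S]_n -> Prop) : Prop :=
  forall d v, Z v -> Z (hcomp sh d v).

Lemma submodB n (Z : 'rV[S]_n -> Prop) u v : submod Z -> Z u -> Z v -> Z (u - v).
Proof. by case=> _ ZD ZZ Zu Zv; apply: ZD => //; rewrite -scaleN1r; apply: ZZ. Qed.

Lemma submod_mul m n (Z : 'rV[S]_n -> Prop) (D : 'M_(m, n)) w : submod Z ->
  (forall a, Z (row a D)) -> Z (w *m D).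
Proof.
case=> Z0 ZD ZZ ZR; rewrite mulmx_sum_row.
by elim/big_ind: _ => // a _; apply: ZZ.
Qed.

Lemma submod_ker m n (D : 'M[S]_(m, n)) : submod (fun w => w *m D = 0).
Proof.
split=> [|u v hu hv|c v hv]; first by rewrite mul0mx.
  by rewrite mulmxDl hu hv addr0.
by rewrite -scalemxAl hv scaler0.
Qed.

Lemma graded_ker m n (sh' : 'I_m -> nat) (sh : 'I_n -> nat) D :
  homog_mx sh' sh D -> graded sh' (fun w => w *m D = 0).
Proof.
move=> hD d w wD; rewrite -(hcomp_mul _ _ hD) wD.
apply/rowP => b; rewrite !mxE; apply/mpolyP => k; rewrite mcoeff_mrestr mcoeff0.
by rewrite if_same.
Qed.

Lemma submod_im m n (Z : 'rV[S]_n -> Prop) (D : 'M_(m, n)) :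
  (forall v, Z v <-> exists w, v = w *m D) -> forall w, Z (w *m D).
Proof. by move=> E w; apply/E; exists w. Qed.

Lemma rows_exist m n (P : 'I_m -> 'rV[S]_n -> Prop) :
  (forall a, exists v, P a v) -> exists A : 'M_(m, n), forall a, P a (row a A).
Proof.
case/fin_all_exists => f hf; exists (\matrix_a f a) => a.
by rewrite rowK.
Qed.

(** Existence of a graded free resolution of Z, a submodule of the free module with
    shifts sh in homological degree i; all further shifts satisfy B. Being
    coinductive, it is unfolded one syzygy module at a time, without transport along
    equalities of ranks. *)
CoInductive resolved (B : nat -> nat -> Prop) i n (sh : 'I_n -> nat)
    (Z : 'rV[S]_n -> Prop) : Prop :=
  Resolved m (sh' : 'I_m -> nat) (D : 'M[S]_(m, n)) of
    homog_mx sh' sh D & (forall a, B i.+1 (sh' a)) &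
    (forall v, Z v <-> exists w, v = w *m D) &
    resolved B i.+1 sh' (fun w => w *m D = 0).

Lemma resolved_coind (B : nat -> nat -> Prop)
    (P : forall i n, ('I_n -> nat) -> ('rV[S]_n -> Prop) -> Prop) :
  (forall i n (sh : 'I_n -> nat) Z, P i n sh Z ->
    exists m (sh' : 'I_m -> nat) (D : 'M[S]_(m, n)), [/\ homog_mx sh' sh D,
      forall a, B i.+1 (sh' a), forall v, Z v <-> exists w, v = w *m D
      & P i.+1 m sh' (fun w => w *m D = 0)]) ->
  forall i n (sh : 'I_n -> nat) Z, P i n sh Z -> resolved B i sh Z.
Proof.
move=> step; cofix CIH => i n sh Z /step [m [sh' [D [h1 h2 h3 h4]]]].
exact: (Resolved h1 h2 h3 (CIH _ _ _ _ h4)).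
Qed.

Lemma resolved_shift (B B' : nat -> nat -> Prop) d :
  (forall i j, B i j -> B' i (d + j)%N) ->
  forall i n (sh : 'I_n -> nat) Z, resolved B i sh Z ->
  resolved B' i (fun a => d + sh a)%N Z.
Proof.
move=> BB; cofix CIH => i n sh Z [m sh' D hD Bsh' ZE /CIH R].
apply: (Resolved _ _ ZE R) => [a b k /hD <-|a]; last exact: BB.
by rewrite addnCA.
Qed.

Definition split_shift n1 n2 (sh1 : 'I_n1 -> nat) (sh2 : 'I_n2 -> nat) (a : 'I_(n1 + n2)) :=
  match split a with inl x => sh1 x | inr y => sh2 y end.

Lemma split_shiftL n1 n2 (sh1 : 'I_n1 -> nat) (sh2 : 'I_n2 -> nat) a :
  split_shift sh1 sh2 (lshift n2 a) = sh1 a.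
Proof. by rewrite /split_shift (unsplitK (inl a)). Qed.

Lemma split_shiftR n1 n2 (sh1 : 'I_n1 -> nat) (sh2 : 'I_n2 -> nat) a :
  split_shift sh1 sh2 (rshift n1 a) = sh2 a.
Proof. by rewrite /split_shift (unsplitK (inr a)). Qed.

Lemma homog_block m1 m2 n1 n2 (s1' : 'I_m1 -> nat) (s2' : 'I_m2 -> nat)
    (s1 : 'I_n1 -> nat) (s2 : 'I_n2 -> nat) D11 D12 D21 D22 :
  homog_mx s1' s1 D11 -> homog_mx s1' s2 D12 -> homog_mx s2' s1 D21 -> homog_mx s2' s2 D22 ->
  homog_mx (split_shift s1' s2') (split_shift s1 s2) (block_mx D11 D12 D21 D22).
Proof.
move=> h11 h12 h21 h22 a b k; rewrite -(splitK a) -(splitK b).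
case: (split a) => x; case: (split b) => y /=;
  rewrite ?split_shiftL ?split_shiftR ?block_mxEul ?block_mxEur ?block_mxEdl ?block_mxEdr.
- exact: h11.
- exact: h12.
- exact: h21.
exact: h22.
Qed.

Lemma homog_mx0 m n (sh' : 'I_m -> nat) (sh : 'I_n -> nat) : homog_mx sh' sh 0.
Proof. by move=> a b k; rewrite mxE msupp0. Qed.

Lemma split_shift_all n1 n2 (sh1 : 'I_n1 -> nat) (sh2 : 'I_n2 -> nat) (P : nat -> Prop) :
  (forall a, P (sh1 a)) -> (forall a, P (sh2 a)) -> forall a, P (split_shift sh1 sh2 a).
Proof. by move=> h1 h2 a; rewrite /split_shift; case: (split a). Qed.

(** An exact sequence 0 -> Z1 -> Z -> Z2 -> 0 inside the split sequence of the ambient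
    free modules; as an indexed family it is a predicate on Z for resolved_coind. *)
Variant extension (B : nat -> nat -> Prop) i : forall n, ('I_n -> nat) ->
    ('rV[S]_n -> Prop) -> Prop :=
  Extension n1 n2 (sh1 : 'I_n1 -> nat) (sh2 : 'I_n2 -> nat) Z1 Z2
      (Z : 'rV[S]_(n1 + n2) -> Prop) of
    resolved B i sh1 Z1 & resolved B i sh2 Z2 &
    submod Z & graded (split_shift sh1 sh2) Z &
    (forall v, Z1 v <-> Z (row_mx v 0)) & (forall v, Z2 v <-> exists u, Z (row_mx u v)) :
  extension B i (split_shift sh1 sh2) Z.

(** The horseshoe lemma. Lifting generators of Z2 to Z gives, with those of Z1,
    generators of Z, and the relations between them are again an extension. *)
Lemma horseshoe (B : nat -> nat -> Prop) i n (sh : 'I_n -> nat) Z :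
  extension B i sh Z -> resolved B i sh Z.
Proof.
move: i n sh Z; apply: resolved_coind => i _ _ _ [n1 n2 sh1 sh2 Z1 Z2 Z R1 R2 ZM Zgr Z1E Z2E].
case: R1 => m1 sh1' D1 hD1 B1 E1 R1; case: R2 => m2 sh2' D2 hD2 B2 E2 R2.
have rowD2 b : Z2 (row b D2) by rewrite rowE; apply/E2; exists (delta_mx 0 b).
have [tau htau] : exists tau : 'M[S]_(m2, n1), forall b, Z (row_mx (row b tau) (row b D2)) /\
    forall a k, k \in msupp (row b tau 0 a) -> (mdeg k + sh1 a)%N = sh2' b.
  apply: (@rows_exist m2 n1 (fun b u => Z (row_mx u (row b D2)) /\
    forall a k, k \in msupp (u 0 a) -> (mdeg k + sh1 a)%N = sh2' b)) => b.
  have [u Zu] := (Z2E (row b D2)).1 (rowD2 b).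
  exists (hcomp sh1 (sh2' b) u); split; last by move=> a k; apply: hcomp_supp.
  have := Zgr (sh2' b) _ Zu; congr Z; apply/rowP => a; rewrite mxE -(splitK a).
  case: (split a) => x /=; rewrite ?row_mxEl ?row_mxEr ?split_shiftL ?split_shiftR ?mxE //.
  by have /rowP/(_ x) := hcomp_row b hD2; rewrite !mxE.
have htauZ b : Z (row b (row_mx tau D2)).
  have [+ _] := htau b; congr Z; apply/rowP => a.
  by rewrite !mxE; case: (split a) => x; rewrite mxE.
pose D := block_mx D1 0 tau D2.
have DE w1 w2 : row_mx w1 w2 *m D = row_mx (w1 *m D1 + w2 *m tau) (w2 *m D2).
  by rewrite /D mul_row_block mulmx0 add0r.
have hD : homog_mx (split_shift sh1' sh2') (split_shift sh1 sh2) D.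
  apply: homog_block => //; first exact: homog_mx0.
  by move=> b a k kt; have [_ h] := htau b; apply: h; rewrite mxE.
have ZE v : Z v <-> exists w, v = w *m D.
  split=> [Zv|[w ->]].
    rewrite -(hsubmxK v) in Zv *; move: (lsubmx v) (rsubmx v) Zv => v1 v2 Zv.
    have [w2 v2E] : exists w, v2 = w *m D2 by apply/E2/Z2E; exists v1.
    have Zw2 : Z (row_mx (w2 *m tau) v2).
      by rewrite v2E -mul_mx_row; apply: submod_mul ZM _.
    have [w1 v1E] : exists w, v1 - w2 *m tau = w *m D1.
      apply/E1/Z1E; have := submodB ZM Zv Zw2.
      by rewrite opp_row_mx add_row_mx subrr.
    by exists (row_mx w1 w2); rewrite DE -v1E subrK -v2E.
  rewrite -(hsubmxK w) DE.
  have -> : row_mx (lsubmx w *m D1 + rsubmx w *m tau) (rsubmx w *m D2) =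
      row_mx (lsubmx w *m D1) 0 + rsubmx w *m row_mx tau D2.
    by rewrite mul_mx_row add_row_mx add0r.
  have [_ ZD _] := ZM; apply: ZD; last exact: submod_mul.
  by apply/Z1E/E1; exists (lsubmx w).
exists (m1 + m2)%N, (split_shift sh1' sh2'), D; split=> //.
  exact: (split_shift_all B1 B2).
apply: (Extension R1 R2).
- exact: submod_ker.
- exact: graded_ker hD.
- move=> v; rewrite DE !mul0mx addr0; split=> [->|E]; first by rewrite row_mx0.
  by rewrite -(row_mxKl (v *m D1) (0 : 'rV_n2)) E; apply/rowP => a; rewrite !mxE.
move=> v; split=> [vD2|[u]]; last first.
  rewrite DE => E; rewrite -(row_mxKr (u *m D1 + v *m tau) (v *m D2)) E.
  by apply/rowP => a; rewrite !mxE.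
have [w wE] : exists w, v *m tau = w *m D1.
  apply/E1/Z1E; rewrite -vD2 -mul_mx_row; exact: submod_mul.
by exists (- w); rewrite DE vD2 mulNmx -wE addNr row_mx0.
Qed.

Definition graded_ideal (I : S -> Prop) : Prop :=
  is_ideal I /\ forall d f, I f -> I (mrestr (fun k => mdeg k + 0 == d)%N f).

Lemma ideal_sub (I : S -> Prop) f g : is_ideal I -> I f -> I g -> I (f - g).
Proof. by case=> _ ID IM If Ig; apply: ID => //; rewrite -mulN1r; apply: IM. Qed.

Lemma aug_submod (I : S -> Prop) n (aug : 'cV[S]_n) : is_ideal I ->
  submod (fun v : 'rV_n => I ((v *m aug) 0 0)).
Proof.
case=> I0 ID IM; split=> [|u v hu hv|c v hv]; first by rewrite mul0mx mxE.
  by rewrite mulmxDl mxE; apply: ID.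
by rewrite -scalemxAl mxE; apply: IM.
Qed.

Lemma aug_graded (I : S -> Prop) n (sh : 'I_n -> nat) (aug : 'cV[S]_n) :
  graded_ideal I -> homog_mx sh (fun=> 0%N) aug ->
  graded sh (fun v : 'rV_n => I ((v *m aug) 0 0)).
Proof. by move=> [_ gI] haug d v hv; rewrite -(hcomp_mul _ _ haug) mxE; apply: gI. Qed.

Definition quotient_resolved B (I : S -> Prop) : Prop :=
  exists n (sh : 'I_n -> nat) (aug : 'cV[S]_n),
  [/\ homog_mx sh (fun=> 0%N) aug, forall a, B 0%N (sh a),
      forall f, exists v : 'rV_n, I (f - (v *m aug) 0 0)
    & resolved B 0 sh (fun v => I ((v *m aug) 0 0))].

Lemma resolved_ext B i n (sh : 'I_n -> nat) (Z Z' : 'rV[S]_n -> Prop) :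
  (forall v, Z v <-> Z' v) -> resolved B i sh Z -> resolved B i sh Z'.
Proof.
move=> E [m sh' D hD Bs ZE R]; apply: Resolved hD Bs _ R => v.
by rewrite -E ZE.
Qed.

Lemma quotient_resolved_ext B (I I' : S -> Prop) :
  (forall f, I f <-> I' f) -> quotient_resolved B I -> quotient_resolved B I'.
Proof.
move=> E [n [sh [aug [h1 h2 h3 h4]]]]; exists n, sh, aug; split=> //.
  by move=> f; have [v hv] := h3 f; exists v; apply/E.
by apply: resolved_ext h4 => v; rewrite E.
Qed.

Variant complex_stage (F : free_complex K s) : forall i n, ('I_n -> nat) ->
    ('rV[S]_n -> Prop) -> Prop :=
  ComplexStage i : complex_stage F i.+1 (@res_shift K s F i.+1) (fun w => w *m res_diff F i = 0).

Lemma complex_resolved (I : S -> Prop) (F : free_complex K s) (B : nat -> nat -> Prop) :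
  graded_complex F -> resolves_quotient I F -> (forall i a, B i (@res_shift K s F i a)) ->
  quotient_resolved B I.
Proof.
case=> g0 gF [sur ex0 exF] BF; exists (res_rank F 0), (@res_shift K s F 0), (res_aug F).
split=> //.
  by move=> a b k kf; rewrite ord1 in kf; rewrite addn0; move/dhomogP: (g0 a); apply.
apply: (Resolved (D := res_diff F 0)) => //; first exact: gF.
apply: (@resolved_coind B (complex_stage F)) (ComplexStage F 0) => _ _ _ _ [i].
exists (res_rank F i.+2), (@res_shift K s F i.+2), (res_diff F i.+1).
by split=> //; exact: gF.
Qed.

(** ** Comparing a stage of a minimal resolution with a given resolution *)

Section Comparison.
Variables (phi : {rmorphism S -> S}) (B : nat -> nat -> Prop).
Hypothesis phi0 : forall p, p@_0%MM = 0 -> (phi p)@_0%MM = 0.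
Local Notation phim := (map_mx phi).

(** Z is compared with a resolved module Zy by A, going to Zy, and C, going back and
    semilinear along phi. The composition differs from the identity by a map into Z,
    which a homotopy can lift, and by T, the part that the homotopy of the preceding
    stage contributes. *)
Definition compared i n (sh : 'I_n -> nat) (Z : 'rV[S]_n -> Prop) : Prop :=
  exists ny (shy : 'I_ny -> nat) (Zy : 'rV[S]_ny -> Prop)
    (A : 'M[S]_(n, ny)) (C : 'M[S]_(ny, n)) (T : 'M[S]_n),
  [/\ resolved B i shy Zy, forall b, B i (shy b), homog_mx sh shy A,
      forall v, Z v -> Zy (v *m A) & forall y, Zy y -> Z (phim y *m C)] /\
  [/\ forall a, Z (row a (phim A *m C - 1%:M - T)), forall v, Z v -> v *m T = 0
    & forall a b, (T a b)@_0%MM = 0].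

Definition in_max n (Z : 'rV[S]_n -> Prop) : Prop := forall v, Z v -> forall b, (v 0 b)@_0%MM = 0.

Lemma mcoeff0M (p q : S) : (p * q)@_0%MM = p@_0%MM * q@_0%MM.
Proof. exact: (rmorphM (mcoeff 0%MM)). Qed.

Lemma rows_mul m n p (Z : 'rV[S]_n -> Prop) (D : 'M[S]_(m, n)) (E : 'M[S]_(p, n)) :
  (forall v, Z v <-> exists w, v = w *m D) -> (forall a, Z (row a E)) ->
  exists H : 'M_(p, m), E = H *m D.
Proof.
move=> ZE ZR; have [H hH] := rows_exist (fun a => (ZE _).1 (ZR a)).
by exists H; apply/row_matrixP => a; rewrite row_mul hH.
Qed.

(** The maps A and C lift to the generators of Z and Zy. A lift H of the map into Z
    through D is the homotopy, and D H takes the place of T. *)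
Lemma compared_step i n (sh : 'I_n -> nat) Z m (sh' : 'I_m -> nat) (D : 'M[S]_(m, n)) :
  submod Z -> in_max Z -> compared i sh Z ->
  homog_mx sh' sh D -> (forall v, Z v <-> exists w, v = w *m D) -> phim D = D ->
  compared i.+1 sh' (fun w => w *m D = 0).
Proof.
move=> ZM Zmax [ny [shy [Zy [A [C [T [[R By hA AZ CZ] [TZ ZT T0]]]]]]]] hD ZE phiD.
case: R => my shy' Dy hDy By' ZyE R'.
have rowD a : Z (row a D) by rewrite rowE; apply: submod_im ZE _.
have [A' hA'] : exists A' : 'M[S]_(m, my), forall a, row a A' *m Dy = row a D *m A /\
    forall b k, k \in msupp (row a A' 0 b) -> (mdeg k + shy' b)%N = sh' a.
  apply: (@rows_exist m my (fun a w => w *m Dy = row a D *m A /\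
    forall b k, k \in msupp (w 0 b) -> (mdeg k + shy' b)%N = sh' a)) => a.
  have [w wE] := (ZyE _).1 (AZ _ (rowD a)).
  exists (hcomp shy' (sh' a) w); split; last by move=> b k; apply: hcomp_supp.
  by rewrite -(hcomp_mul _ _ hDy) -wE (hcomp_mul _ _ hA) (hcomp_row _ hD).
have A'Dy : A' *m Dy = D *m A.
  by apply/row_matrixP => a; rewrite !row_mul; case: (hA' a).
have [C' hC'] : exists C' : 'M[S]_(my, m), phim Dy *m C = C' *m D.
  apply: rows_mul ZE _ => b; rewrite row_mul -map_row; apply: CZ.
  by rewrite rowE; apply: submod_im ZyE _.
have [H hH] := rows_mul ZE TZ.
have DT : D *m T = 0 by apply/row_matrixP => a; rewrite row_mul ZT // row0.
exists my, shy', (fun w => w *m Dy = 0), A', C', (D *m H); split; split=> //.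
- by move=> a b k; have [_ h] := hA' a; move=> kA; apply: h; rewrite mxE.
- by move=> v vD; rewrite -mulmxA A'Dy mulmxA vD mul0mx.
- by move=> y yD; rewrite -mulmxA -hC' mulmxA -map_mxM yD map_mx0 mul0mx.
- move=> a; rewrite -row_mul; set X := _ *m D; suff -> : X = 0 by rewrite row0.
  rewrite {}/X !mulmxBl mul1mx -!mulmxA -hC' (mulmxA (phim A')) -map_mxM A'Dy map_mxM phiD.
  rewrite -mulmxA -hH !mulmxBr mulmx1 DT subr0.
  by rewrite subrr.
- by move=> v vD; rewrite mulmxA vD mul0mx.
move=> a b; rewrite mxE raddf_sum big1 //= => c _.
have := Zmax _ (rowD a) c; rewrite mxE mcoeff0M => ->.
by rewrite mul0r.
Qed.

(** Modulo the variables Z and T vanish, so phi(A) C has ones on the diagonal. Hence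
    each row of A has an entry with a constant term, which by homogeneity puts sh a
    among the shifts of Zy. *)
Lemma compared_bound i n (sh : 'I_n -> nat) Z : in_max Z -> compared i sh Z ->
  forall a, B i (sh a).
Proof.
move=> Zmax [ny [shy [Zy [A [C [T [[_ By hA _ _] [TZ _ T0]]]]]]]] a.
have := Zmax _ (TZ a) a; rewrite !mxE !eqxx !mcoeffB T0 subr0 mcoeff1 eqxx.
move/eqP; rewrite subr_eq0 raddf_sum /= => /eqP sum1.
have [/existsP [b]|no] := boolP [exists b, (A a b)@_0%MM != 0].
  by rewrite -mcoeff_msupp => /hA <-; rewrite mdeg0 add0n.
have : (1 : K) != 0 by exact: oner_neq0.
rewrite -[1]/(true%:R) -sum1 big1 ?eqxx // => b _.
rewrite mcoeff0M !mxE phi0 ?mul0r //.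
by move: no; rewrite negb_exists => /forallP /(_ b); rewrite negbK => /eqP.
Qed.

(** The augmentations lift through each other. *)
Lemma compared0 (IX IY : S -> Prop) n (sh : 'I_n -> nat) (aug : 'cV[S]_n) :
  quotient_resolved B IY -> graded_ideal IY -> is_ideal IX ->
  (forall f, IX f -> IY f) -> (forall f, IY f -> IX (phi f)) ->
  homog_mx sh (fun=> 0%N) aug -> phim aug = aug ->
  (forall f, exists v : 'rV_n, IX (f - (v *m aug) 0 0)) ->
  compared 0 sh (fun v => IX ((v *m aug) 0 0)).
Proof.
move=> [ny [shy [augy [haugy By sury R]]]] gIY iX XY YX haug phiaug surx.
have [iY gY] := gIY.
have [A hA] : exists A : 'M[S]_(n, ny), forall a, IY (aug a 0 - (row a A *m augy) 0 0) /\
    forall b k, k \in msupp (row a A 0 b) -> (mdeg k + shy b)%N = sh a.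
  apply: (@rows_exist n ny (fun a w => IY (aug a 0 - (w *m augy) 0 0) /\
    forall b k, k \in msupp (w 0 b) -> (mdeg k + shy b)%N = sh a)) => a.
  have [w hw] := sury (aug a 0); exists (hcomp shy (sh a) w); split; last first.
    by move=> b k; apply: hcomp_supp.
  rewrite -(hcomp_mul _ _ haugy) mxE.
  have -> : aug a 0 = mrestr (fun k => mdeg k + 0 == sh a)%N (aug a 0).
    by have /rowP/(_ 0) := hcomp_row a haug; rewrite !mxE.
  have := gY (sh a) _ hw; congr IY.
  by apply/mpolyP => k; rewrite mcoeffB !mcoeff_mrestr mcoeffB; case: ifP; rewrite ?subr0.
have [C hC] : exists C : 'M[S]_(ny, n), forall b, IX (phi (augy b 0) - (row b C *m aug) 0 0).
  by apply: (@rows_exist ny n (fun b w => IX (phi (augy b 0) - (w *m aug) 0 0))).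
have IXsum p (w : 'rV[S]_p) (E : 'cV[S]_p) : (forall b, IX (E b 0)) -> IX ((w *m E) 0 0).
  move=> hE; rewrite mxE; case: iX => I0 ID IM; elim/big_ind: _ => // b _.
  exact: IM.
have IYsum p (w : 'rV[S]_p) (E : 'cV[S]_p) : (forall b, IY (E b 0)) -> IY ((w *m E) 0 0).
  move=> hE; rewrite mxE; case: iY => I0 ID IM; elim/big_ind: _ => // b _.
  exact: IM.
have hA' a : IY ((aug - A *m augy) a 0).
  by have [+ _] := hA a; rewrite -row_mul !mxE.
have hC' b : IX ((phim augy - C *m aug) b 0).
  by have := hC b; rewrite -row_mul !mxE.
exists ny, shy, (fun v => IY ((v *m augy) 0 0)), A, C, 0; split; split=> //.
- by move=> a b k; have [_ h] := hA a; move=> kA; apply: h; rewrite mxE.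
- move=> v /XY hv; have := ideal_sub iY hv (IYsum _ v _ hA').
  by rewrite mulmxBr mulmxA !mxE opprB addrC subrK.
- move=> y /YX hy; have := ideal_sub iX hy (IXsum _ (phim y) _ hC').
  congr IX; rewrite mulmxBr mulmxA -map_mxM.
  by rewrite !mxE opprB addrC subrK.
- move=> a; rewrite subr0 -row_mul mulmxBl mul1mx [row _ _ _ _]mxE.
  have h1 : IX ((phim (aug - A *m augy)) a 0) by rewrite mxE; apply: YX.
  have h2 : IX ((phim A *m (phim augy - C *m aug)) a 0).
    have := IXsum _ (row a (phim A)) _ hC'; congr IX.
    by rewrite -row_mul mxE.
  have [_ ID IM] := iX; have := ID _ _ h1 h2.
  rewrite map_mxB map_mxM phiaug mulmxBr mulmxA => h3.
  have := IM _ (-1) h3; congr IX.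
  by rewrite !mxE mulN1r addrA subrK opprB.
- by move=> v _; rewrite mulmx0.
by move=> a b; rewrite mxE mcoeff0.
Qed.

End Comparison.

(** * Minimal resolutions *)

Definition fin_gen n (Z : 'rV[S]_n -> Prop) : Prop :=
  exists m (D : 'M[S]_(m, n)), forall v, Z v <-> exists w, v = w *m D.

(** The generators are the images under C of those of Zy, and the rows of A C - 1 - T,
    which account for the composition of the comparison maps not being the identity.
    This replaces an appeal to noetherianity. *)
Lemma compared_fin_gen (B : nat -> nat -> Prop) i n (sh : 'I_n -> nat) Z :
  submod Z -> compared idfun B i sh Z -> fin_gen Z.
Proof.
move=> ZM [ny [shy [Zy [A [C [T [[R _ _ AZ CZ] [TZ ZT _]]]]]]]].
case: R => my shy' Dy _ _ ZyE _; rewrite map_mx_id // in TZ.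
exists (my + n)%N, (col_mx (Dy *m C) (A *m C - 1%:M - T)) => v; split=> [Zv|[w ->]].
  have [w wE] := (ZyE _).1 (AZ v Zv); exists (row_mx w (- v)).
  rewrite mul_row_col mulNmx !mulmxBr mulmx1 (ZT v Zv) subr0 !mulmxA -wE opprB.
  by rewrite addrC subrK.
rewrite -(hsubmxK w) mul_row_col; have [_ ZD _] := ZM; apply: ZD; last exact: submod_mul.
rewrite mulmxA; have := CZ (lsubmx w *m Dy); rewrite map_mx_id //; apply.
by apply/ZyE; exists (lsubmx w).
Qed.

Lemma hcomp_sum n (sh : 'I_n -> nat) (v : 'rV[S]_n) (N : nat) :
  (forall b k, k \in msupp (v 0 b) -> (mdeg k + sh b < N)%N) ->
  v = \sum_(d < N) hcomp sh d v.
Proof.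
move=> hN; apply/rowP => b; rewrite summxE; apply/mpolyP => k; rewrite raddf_sum /=.
under eq_bigr do rewrite mxE mcoeff_mrestr.
have [kv|] := boolP (k \in msupp (v 0 b)); last first.
  by rewrite -mcoeff_eq0 => /eqP ->; rewrite big1 // => d _; rewrite if_same.
rewrite (bigD1 (Ordinal (hN b k kv))) //= eqxx big1 ?addr0 // => d /negbTE dN.
by rewrite eq_sym; case: eqP => // E; rewrite -val_eqE /= E eqxx in dN.
Qed.

Lemma homog_generators n (sh : 'I_n -> nat) (Z : 'rV[S]_n -> Prop) :
  submod Z -> graded sh Z -> fin_gen Z ->
  exists m (sh' : 'I_m -> nat) (D : 'M[S]_(m, n)),
    homog_mx sh' sh D /\ forall v, Z v <-> exists w, v = w *m D.
Proof.
move=> ZM Zgr [m [D ZE]].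
pose N := (\max_(p : 'I_m * 'I_n) (msize (D p.1 p.2) + sh p.2)).+1.
have hN a b k : k \in msupp (row a D 0 b) -> (mdeg k + sh b < N)%N.
  rewrite mxE => /msize_mdeg_lt kD; rewrite ltnS.
  apply: leq_trans (leq_bigmax (a, b)) => /=.
  by rewrite leq_add2r ltnW.
pose T : finType := ('I_m * 'I_N)%type.
pose e (r : 'I_#|T|) : 'I_m * 'I_N := enum_val r.
pose D' : 'M[S]_(#|T|, n) := \matrix_r hcomp sh (e r).2 (row (e r).1 D).
exists #|T|, (fun r => (e r).2 : nat), D'; split.
  by move=> r b k; rewrite [D' r b]mxE => /hcomp_supp.
move=> v; split=> [/ZE [w ->]|[w ->]].
  exists (\row_r w 0 (e r).1).
  rewrite !mulmx_sum_row.
  transitivity (\sum_(p : T) w 0 p.1 *: hcomp sh p.2 (row p.1 D)).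
    rewrite -(pair_bigA _ (fun a (d : 'I_N) => w 0 a *: hcomp sh d (row a D))) /=.
    by apply: eq_bigr => a _; rewrite -scaler_sumr -hcomp_sum //; exact: hN.
  rewrite (big_enum_val (A := T)) /=.
  by apply: eq_bigr => r _; rewrite rowK mxE.
apply: submod_mul => // r; rewrite rowK; apply: Zgr; rewrite rowE.
exact: submod_im ZE _.
Qed.

(** Among homogeneous generating families, a shortest one has no relation with a
    constant coefficient: the generator carrying it would be superfluous. *)
Lemma minimal_generators n (sh : 'I_n -> nat) (Z : 'rV[S]_n -> Prop) :
  submod Z -> graded sh Z -> fin_gen Z ->
  exists m (sh' : 'I_m -> nat) (D : 'M[S]_(m, n)),
    [/\ homog_mx sh' sh D, forall v, Z v <-> exists w, v = w *m D
      & in_max (fun w => w *m D = 0)].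
Proof.
move=> ZM Zgr /(homog_generators ZM Zgr) ex.
have [m [[sh' [D [hD ZE]]] minm]] := least_nat ex.
exists m, sh', D; split=> // w wD a; apply/eqP/contraT => nz.
case: m sh' D hD ZE minm w wD a nz => [|m] sh' D hD ZE minm w wD a nz; first by case: a nz.
have w1D := graded_ker hD (sh' a) wD; move: w1D; set w1 := hcomp _ _ _ => w1D.
pose c := (w 0 a)@_0%MM.
have w1a : w1 0 a = c%:MP.
  apply/mpolyP => k; rewrite mcoeffC; have [->|k0] := eqVneq k 0%MM.
    by rewrite mxE mcoeff_mrestr mdeg0 add0n eqxx mulr1.
  rewrite mulr0; apply/eqP; rewrite mcoeff_eq0; apply: contra k0 => /hcomp_supp /eqP.
  by rewrite -{2}[sh' a]add0n eqn_add2r mdeg_eq0.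
clearbody w1; suff : (m.+1 <= m)%N by rewrite ltnn.
apply: minm; exists (sh' \o lift a), (row' a D); split.
  by move=> b e k; rewrite mxE; apply: hD.
move=> v; split=> [/ZE [u ->]|[u ->]]; last first.
  apply: submod_mul => // b; have -> : row b (row' a D) = row (lift a b) D.
    by apply/rowP => e; rewrite !mxE.
  by rewrite rowE; apply: submod_im ZE _.
pose u' := u - (u 0 a * (c^-1)%:MP) *: w1.
have u'D : u' *m D = u *m D by rewrite mulmxBl -scalemxAl w1D scaler0 subr0.
have u'a : u' 0 a = 0.
  by rewrite !mxE w1a -mulrA -mpolyCM mulVf // mulr1 subrr.
exists (col' a u'); rewrite -u'D !mulmx_sum_row (bigD1_ord a) //= u'a scale0r add0r.
have cE (b : 'I_m.+1.-1) : (col' a u') 0 b = u' 0 (lift a b) by rewrite mxE.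
apply: eq_bigr => b _; rewrite cE; congr (_ *: _).
by apply/rowP => e; rewrite !mxE.
Qed.

Section MinimalResolution.
Variable B : nat -> nat -> Prop.

(** What the recursion that builds the minimal resolution carries along: a syzygy
    module whose comparison with a given resolution yields the next stage. *)
Record stage (i : nat) := Stage {
  st_n : nat;
  st_sh : 'I_st_n -> nat;
  st_Z : 'rV[S]_st_n -> Prop;
  st_submod : submod st_Z;
  st_graded : graded st_sh st_Z;
  st_max : in_max st_Z;
  st_cmp : compared idfun B i st_sh st_Z
}.

Record next_stage i (X : stage i) := NextStage {
  ns_stage :> stage i.+1;
  ns_diff : 'M[S]_(st_n ns_stage, st_n X);
  ns_homog : homog_mx (@st_sh _ ns_stage) (@st_sh _ X) ns_diff;
  ns_im : forall v, st_Z v <-> exists w, v = w *m ns_diff;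
  ns_ker : forall w, @st_Z _ ns_stage w <-> w *m ns_diff = 0
}.

Lemma next_stage_exists i (X : stage i) : inhabited (next_stage X).
Proof.
case: X => n sh Z ZM Zgr Zmax Zc.
have [m [sh' [D [hD ZE kerD]]]] := minimal_generators ZM Zgr (compared_fin_gen ZM Zc).
have Dc := compared_step ZM Zmax Zc hD ZE (map_mx_id (fun=> erefl) D).
constructor.
by exists (@Stage i.+1 m sh' _ (submod_ker D) (graded_ker hD) kerD Dc) D.
Qed.

Definition next i (X : stage i) : next_stage X :=
  epsilon (next_stage_exists X) (fun=> True).

Fixpoint stages (X0 : stage 0) i : stage i :=
  if i is j.+1 then next (stages X0 j) else X0.

End MinimalResolution.

(** The zeroth Betti number in degree 0 witnesses that some Betti number is nonzero,
    as the maximum in the regularity requires. *)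
Theorem minimal_resolution_exists (B : nat -> nat -> Prop) (I : S -> Prop) :
  quotient_resolved B I -> graded_ideal I -> (forall f, I f -> f@_0%MM = 0) ->
  exists F : free_complex K s,
    minimal_graded_free_resolution I F /\ betti F 0 0 <> 0%N.
Proof.
move=> RI gI Imax; have [iI _] := gI.
pose aug : 'cV[S]_1 := 1%:M.
have augE (v : 'rV[S]_1) : (v *m aug) 0 0 = v 0 0 by rewrite mulmx1.
have haug : homog_mx (fun=> 0%N) (fun=> 0%N) aug.
  move=> a b k; rewrite !ord1 mxE eqxx msupp1 inE => /eqP ->.
  by rewrite mdeg0.
have sur f : exists v : 'rV[S]_1, I (f - (v *m aug) 0 0).
  exists f%:M; rewrite augE mxE eqxx subrr; by case: iI.
have cmp0 := compared0 (phi := idfun) RI gI iI (fun f h => h) (fun f h => h) haug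
  (map_mx_id (fun=> erefl) aug) sur.
have max0 : in_max (fun v : 'rV[S]_1 => I ((v *m aug) 0 0)).
  by move=> v; rewrite augE => /Imax + b; rewrite ord1.
pose X0 := Stage (aug_submod aug iI) (aug_graded gI haug) max0 cmp0.
pose st := stages X0.
pose F := @FreeComplex K s (fun i => st_n (st i)) (fun i => @st_sh _ _ (st i)) aug
  (fun i => ns_diff (next (st i))).
exists F; split; last first.
  move/eqP; rewrite cards_eq0 => /eqP /setP /(_ 0).
  by rewrite !inE eqxx.
split.
- split=> [a|i]; last by move=> a b k; apply: (ns_homog (n := next (st i))).
  apply/dhomogP => k kf; have := haug a 0 k kf.
  by rewrite addn0.
- split; [exact: sur | exact: (@ns_im _ _ _ (next (st 0%N))) |].
  move=> i v; rewrite -(@ns_ker _ _ _ (next (st i))).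
  exact: (@ns_im _ _ _ (next (st i.+1))).
move=> i a b.
have Za : st_Z (row a (ns_diff (next (st i)))).
  by rewrite rowE; apply: submod_im (@ns_im _ _ _ (next (st i))) _.
by have := st_max Za b; rewrite mxE.
Qed.

(** A minimal resolution X that phi fixes is a retract, through phi, of any resolution
    of a larger ideal that phi maps back; so every degree in which X has a generator
    occurs in the other resolution. *)
Theorem minimal_shift (phi : {rmorphism S -> S}) (B : nat -> nat -> Prop) (IX IY : S -> Prop)
    (X : free_complex K s) :
  (forall p, p@_0%MM = 0 -> (phi p)@_0%MM = 0) ->
  quotient_resolved B IY -> graded_ideal IY -> is_ideal IX ->
  (forall f, IX f -> IY f) -> (forall f, IY f -> IX (phi f)) ->
  minimal_graded_free_resolution IX X ->
  map_mx phi (res_aug X) = res_aug X ->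
  (forall i, map_mx phi (res_diff X i) = res_diff X i) ->
  forall i a, B i (@res_shift K s X i a).
Proof.
move=> phi0 RY gIY iX XY YX [[g0 gX] [sur ex0 exX] minX] phiaug phiX i a.
pose Z j : 'rV[S]_(res_rank X j) -> Prop :=
  match j return 'rV[S]_(res_rank X j) -> Prop with
  | 0%N => fun v => IX (aug_map v)
  | l.+1 => fun v => v *m res_diff X l = 0
  end.
have ZE j v : Z j v <-> exists w, v = w *m res_diff X j by case: j v.
have ZM j : submod (Z j).
  by case: j => [|j]; [exact: aug_submod | exact: submod_ker].
have Zmax j : in_max (Z j).
  move=> v /ZE [w ->] b; rewrite mxE raddf_sum big1 //= => c _.
  by rewrite mcoeff0M minX mulr0.
suff cmp : compared phi B i (@res_shift K s X i) (Z i).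
  exact: compared_bound phi0 _ _ _ _ (Zmax i) cmp a.
elim: i {a} => [|i IH].
  apply: compared0 RY gIY iX XY YX _ phiaug sur.
  by move=> b c k; rewrite ord1 addn0 => kb; move/dhomogP: (g0 b); apply.
exact: compared_step (ZM i) (Zmax i) IH (gX i) (ZE i) (phiX i).
Qed.

End GradedModules.

(** * Mapping cones and the Koszul complex *)

Section Cone.
Variables (K : fieldType) (s : nat).
Local Notation S := {mpoly K[s]}.
Variables (F : free_complex K s) (f : S) (d : nat).

(** The sign makes consecutive differentials compose to 0. *)
Definition cone_entry i : S := (-1) ^+ i * f.

Definition cone_rank i : nat :=
  if i is j.+1 then (res_rank F j.+1 + res_rank F j)%N else res_rank F 0.

Definition cone_shift i : 'I_(cone_rank i) -> nat :=
  match i return 'I_(cone_rank i) -> nat with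
  | 0%N => @res_shift K s F 0
  | j.+1 => split_shift (@res_shift K s F j.+1) (fun a => @res_shift K s F j a + d)%N
  end.

Definition cone_diff i : 'M[S]_(cone_rank i.+1, cone_rank i) :=
  match i return 'M[S]_(cone_rank i.+1, cone_rank i) with
  | 0%N => col_mx (res_diff F 0) (cone_entry 0)%:M
  | j.+1 => block_mx (res_diff F j.+1) 0 (cone_entry j.+1)%:M (res_diff F j)
  end.

Definition cone : free_complex K s :=
  FreeComplex cone_shift (res_aug F) cone_diff.

Lemma cone_entryS i : cone_entry i.+1 = - cone_entry i.
Proof. by rewrite /cone_entry exprS -mulrA mulN1r. Qed.

(** As f is a nonzerodivisor modulo I, the cone of the multiplication by f on F has no
    homology above degree 0; it is minimal because f has no constant term. *)
Lemma cone_resolution (I I' : S -> Prop) :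
  minimal_graded_free_resolution I F -> is_ideal I ->
  f \is d.-homog -> (0 < d)%N -> (forall g, I (g * f) -> I g) ->
  (forall g, I' g <-> exists a, I (g - a * f)) ->
  minimal_graded_free_resolution I' cone.
Proof.
move=> [[g0 gF] [sur ex0 exF] minF] iI fd d0 reg I'E.
have [I0 ID IM] := iI.
have fc0 : f@_0%MM = 0.
  apply: (dhomog_nemf_coeff fd) => /=; by rewrite mdeg0 eq_sym -lt0n.
have ec0 i : (cone_entry i)@_0%MM = 0.
  elim: i => [|i IH]; first by rewrite /cone_entry mul1r.
  by rewrite cone_entryS mcoeffN IH oppr0.
have ehom i : cone_entry i \is d.-homog.
  elim: i => [|i IH]; first by rewrite /cone_entry mul1r.
  by rewrite cone_entryS rpredN.
have scal_hom i n (sh : 'I_n -> nat) :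
    homog_mx (fun a => sh a + d)%N sh (cone_entry i)%:M.
  move=> a b k; rewrite mxE; case: eqP => [->|_]; last by rewrite msupp0.
  by rewrite mulr1n => /(dhomogP _ _ _ (ehom i)) /= ->; rewrite addnC.
have dd i : res_diff F i.+1 *m res_diff F i = 0.
  apply/row_matrixP => a; rewrite row0 row_mul; apply/exF.
  by exists (delta_mx 0 a); rewrite rowE.
have augD (u v : 'rV[S]_(res_rank F 0)) : aug_map (u + v) = aug_map u + aug_map v.
  by rewrite /aug_map mulmxDl mxE.
have augZ c (v : 'rV[S]_(res_rank F 0)) : aug_map (c *: v) = c * aug_map v.
  by rewrite /aug_map -scalemxAl mxE.
split.
- split=> [a|[|j]]; first exact: g0.
    move=> a b k; rewrite /= -(splitK a); case: (split a) => x /=.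
      by rewrite col_mxEu split_shiftL; apply: gF.
    by rewrite col_mxEd split_shiftR; apply: scal_hom.
  apply: homog_block; [exact: gF | exact: homog_mx0 | exact: scal_hom |].
  by move=> a b k /gF; rewrite addnA => ->.
- split.
  + move=> g; have [v hv] := sur g; exists v; apply/I'E; exists 0.
    by rewrite mul0r subr0.
  + move=> v; rewrite -[aug_map (F := cone) v]/(aug_map (F := F) v); split.
      case/I'E => a Ia; have [w2 Iw2] := sur a.
      have : I (aug_map (F := F) (v - f *: w2)).
        rewrite augD -scaleNr augZ; have := ID _ _ Ia (IM _ f Iw2); congr I.
        by rewrite mulrBr [f * a]mulrC addrA subrK mulNr.
      case/ex0 => w1 E; exists (row_mx w1 w2).
      rewrite mul_row_col mul_mx_scalar /cone_entry expr0 mul1r -E.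
      by rewrite subrK.
    case=> w ->; rewrite -(hsubmxK w) mul_row_col mul_mx_scalar /cone_entry expr0 mul1r.
    apply/I'E; exists (aug_map (F := F) (rsubmx w)); rewrite augD augZ mulrC addrK.
    by apply/ex0; exists (lsubmx w).
  case=> [|j] v.
  + rewrite -(hsubmxK v); move: (lsubmx v) (rsubmx v) => v1 v2 {v}.
    rewrite mul_row_col mul_mx_scalar; split.
      rewrite /cone_entry expr0 mul1r => E.
      have E' : v1 *m res_diff F 0 = - (f *: v2) by rewrite -[LHS](addrK (f *: v2)) E sub0r.
      have [w2 v2E] : exists w, v2 = w *m res_diff F 0.
        apply/ex0/reg.
        have : I (aug_map (v1 *m res_diff F 0)) by apply/ex0; exists v1.
        by rewrite E' -scaleNr augZ mulNr => /(IM _ (-1)); rewrite mulN1r opprK mulrC.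
      have [w1 v1E] : exists w, v1 + f *: w2 = w *m res_diff F 1.
        by apply/exF; rewrite mulmxDl -scalemxAl -v2E.
      exists (row_mx w1 w2); rewrite /= mul_row_block mulmx0 add0r -v1E -v2E.
      rewrite mul_mx_scalar cone_entryS /cone_entry expr0 mul1r scaleNr.
      by rewrite addrK.
    case=> w; rewrite -(hsubmxK w); move: (lsubmx w) (rsubmx w) => w1 w2 {w}.
    rewrite /= mul_row_block mulmx0 add0r => /eq_row_mx [-> ->].
    rewrite mulmxDl -!mulmxA dd mulmx0 add0r mul_scalar_mx cone_entryS.
    by rewrite scaleNr mulmxN -scalemxAr addNr.
  rewrite -(hsubmxK v); move: (lsubmx v) (rsubmx v) => v1 v2 {v}.
  rewrite mul_row_block mulmx0 add0r mul_mx_scalar; split.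
    rewrite -[X in _ = X](row_mx0 S) => /eq_row_mx [E1 /exF [w2 v2E]].
    have [w1 v1E] : exists w, v1 + cone_entry j.+1 *: w2 = w *m res_diff F j.+2.
      by apply/exF; rewrite mulmxDl -scalemxAl -v2E.
    exists (row_mx w1 w2); rewrite /= mul_row_block mulmx0 add0r -v1E -v2E.
    by rewrite mul_mx_scalar (cone_entryS j.+1) scaleNr addrK.
  case=> w; rewrite -(hsubmxK w); move: (lsubmx w) (rsubmx w) => w1 w2 {w}.
  rewrite /= mul_row_block mulmx0 add0r => /eq_row_mx [-> ->].
  rewrite -[RHS](row_mx0 S); congr row_mx; last by rewrite -mulmxA dd mulmx0.
  rewrite mulmxDl -!mulmxA dd mulmx0 add0r mul_scalar_mx (cone_entryS j.+1).
  by rewrite scaleNr mulmxN -scalemxAr addNr.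
have scal0 i n (a b : 'I_n) : ((cone_entry i)%:M a b)@_0%MM = 0.
  by rewrite mxE; case: eqP => _; rewrite ?mcoeff0 // mulr1n.
case=> [|j] a b; rewrite /= -(splitK a); case: (split a) => x /=.
- by rewrite col_mxEu.
- by rewrite col_mxEd.
- rewrite -(splitK b); case: (split b) => y /=; first by rewrite block_mxEul.
  by rewrite block_mxEur mxE mcoeff0.
rewrite -(splitK b); case: (split b) => y /=; first by rewrite block_mxEdl.
by rewrite block_mxEdr.
Qed.

End Cone.

Section Koszul.
Variables (K : fieldType) (s : nat).
Local Notation S := {mpoly K[s]}.
Implicit Types (u m k : 'X_{1..s}) (us : seq 'X_{1..s}).

Definition base_complex : free_complex K s :=
  @FreeComplex K s (fun i => if i is 0%N then 1%N else 0%N) (fun _ _ => 0%N)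
    (1%:M : 'M[S]_1) (fun _ => 0).

Lemma base_complex_resolution (I : S -> Prop) : (forall f, I f <-> f = 0) ->
  minimal_graded_free_resolution I base_complex.
Proof.
move=> I0; split; last by move=> [|i] [].
  split; last by move=> [|i] [].
  by move=> a; rewrite /= mxE !ord1 eqxx dhomog1.
split.
- by move=> f; exists (f%:M : 'M_1); rewrite /aug_map mulmx1 mxE eqxx mulr1n subrr; apply/I0.
- move=> v; rewrite /aug_map mulmx1; split=> [/I0 v0|[w ->]].
    by exists 0; rewrite mul0mx; apply/rowP => b; rewrite ord1 v0 mxE.
  by apply/I0; rewrite mulmx0 mxE.
move=> i v; split=> [_|_]; last by rewrite mulmx0.
by exists 0; apply/rowP => -[].
Qed.

Definition divisible us : pred 'X_{1..s} := fun m => has (fun u => (u <= m)%MM) us.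

Lemma divisible_up us : up_closed (divisible us).
Proof.
move=> m k /hasP [u uus um]; apply/hasP; exists u => //.
exact: lepm_trans um (lem_addr _ _).
Qed.

Definition mdisjoint u m : bool := [forall i, (u i == 0%N) || (m i == 0%N)].

Lemma mdisjoint_le u u' m : mdisjoint u u' -> (u' <= u + m)%MM -> (u' <= m)%MM.
Proof.
move=> /forallP uu /mnm_lepP h; apply/mnm_lepP => i; have := h i; rewrite mnmDE.
by case/orP: (uu i) => /eqP ->.
Qed.

(** The Koszul complex of monomials with disjoint supports, as an iterated cone. Its
    entries are, up to signs, these monomials, so that every ring endomorphism that
    fixes them fixes the complex. *)
Lemma koszul d us : (0 < d)%N -> all (fun u => mdeg u == d) us -> pairwise mdisjoint us ->
  exists F : free_complex K s,
  [/\ minimal_graded_free_resolution (mideal (divisible us)) F,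
      forall i a, @res_shift K s F i a = (d * i)%N, res_rank F (size us) != 0%N
    & forall phi : {rmorphism S -> S}, (forall u, u \in us -> phi 'X_[u] = 'X_[u]) ->
      map_mx phi (res_aug F) = res_aug F /\
      forall i, map_mx phi (res_diff F i) = res_diff F i].
Proof.
move=> d0; elim: us => [|u us IH] /=.
  move=> _ _; exists base_complex; split=> //.
  - apply: base_complex_resolution => f; split=> [h|->]; last exact: mideal0.
    by apply: msuppnil0; case E: (msupp f) => [//|k l]; have := h k; rewrite E mem_head => /(_ isT).
  - by move=> [|i] [] //=; rewrite muln0.
  move=> phi _; split=> [|i]; first by rewrite /= map_mx1.
  by rewrite map_mx0.
case/andP => /eqP du dus /andP [/allP uus pus].
have [F [minF shF rkF phiF]] := IH dus pus.
exists (cone F 'X_[u] d); split.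
- apply: (cone_resolution minF) => //.
  + exact/mideal_ideal/divisible_up.
  + by rewrite dhomogX /= du.
  + move=> g /mideal_colonX; apply: mideal_sub => m /hasP [u' u'us um].
    by apply/hasP; exists u' => //; apply: mdisjoint_le um; apply: uus.
  move=> g; rewrite -mideal_addX; last exact: divisible_up.
  by split; apply: mideal_sub => m /=; rewrite orbC.
- move=> [|i] a /=; first by rewrite shF.
  by rewrite /split_shift; case: (split a) => b; rewrite shF // mulnS addnC.
- by rewrite /= addn_eq0 negb_and rkF orbT.
move=> phi phius.
have [phia phid] := phiF phi (fun u' h => phius u' (@mem_behead _ (u :: us) u' h)).
split=> // i; have phie j : phi (cone_entry 'X_[u] j) = cone_entry 'X_[u] j.
  by rewrite rmorphM rmorphXn rmorphN1 phius ?mem_head.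
case: i => [|i] /=; first by rewrite map_col_mx phid map_scalar_mx phie.
by rewrite map_block_mx !phid map_mx0 map_scalar_mx phie.
Qed.

End Koszul.

(** * The regularity of an edge ideal *)

Section Regularity.
Variables (K : fieldType) (s : nat).
Local Notation S := {mpoly K[s]}.
Implicit Types (m k u : 'X_{1..s}) (W : {set 'I_s}) (D : pred 'X_{1..s}).

Lemma mideal_graded D : up_closed D -> graded_ideal (@mideal K s D).
Proof.
move=> upD; split; first exact: mideal_ideal.
move=> d f /midealP hf; apply/midealP => m nD.
by rewrite mcoeff_mrestr hf ?if_same.
Qed.

(** Resolutions of S/(J : X^u), shifted by the degree of u, and of S/(J + (X^u))
    combine to one of S/J. *)
Lemma quotient_horseshoe (B B1 : nat -> nat -> Prop) D u : up_closed D ->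
  (forall i j, B1 i j -> B i (mdeg u + j)%N) ->
  quotient_resolved B1 (@mideal K s (fun m => D (u + m)%MM)) ->
  quotient_resolved B (@mideal K s (fun m => D m || (u <= m)%MM)) ->
  quotient_resolved B (@mideal K s D).
Proof.
move=> upD BB [n1 [sh1 [aug1 [h1 B1s sur1 R1]]]] [n2 [sh2 [aug2 [h2 B2s sur2 R2]]]].
have [gI gJ] := mideal_graded upD; have [I0 ID IM] := gI.
pose aug : 'cV[S]_(n1 + n2) := col_mx ('X_[u] *: aug1) aug2.
have augE v1 v2 : (row_mx v1 v2 *m aug) 0 0 = (v1 *m aug1) 0 0 * 'X_[u] + (v2 *m aug2) 0 0.
  by rewrite mul_row_col mxE -scalemxAr mxE mulrC.
have haug : homog_mx (split_shift (fun a => mdeg u + sh1 a)%N sh2) (fun=> 0%N) aug.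
  move=> a b k; rewrite -(splitK a); case: (split a) => x /=.
    rewrite col_mxEu split_shiftL mxE mulrC (perm_mem (msuppMX _ _)) => /mapP [l /h1 <- ->].
    by rewrite mdegD addnA.
  by rewrite col_mxEd split_shiftR => /h2.
exists (n1 + n2)%N, (split_shift (fun a => mdeg u + sh1 a)%N sh2), aug; split=> //.
- by apply: split_shift_all => // a; apply: BB.
- move=> f; have [v2 /(mideal_addX _ _ upD) [a Ia]] := sur2 f.
  have [v1 /mideal_colonX Iv1] := sur1 a; exists (row_mx v1 v2).
  have := ID _ _ Ia Iv1; congr (mideal D); rewrite augE mulrBl addrA subrK.
  by rewrite opprD addrA addrAC.
apply: horseshoe; apply: (Extension (resolved_shift BB R1) R2).
- exact: aug_submod.
- by apply: aug_graded.
- by move=> v; rewrite augE mul0mx [(0 : 'M_1) _ _]mxE addr0 mideal_colonX.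
move=> v; split=> [/(mideal_addX _ _ upD) [a Ia]|[v1]].
  have [v1 /mideal_colonX Iv1] := sur1 (- a); exists v1; rewrite augE.
  have := ID _ _ Ia (IM _ (-1) Iv1); congr (mideal D).
  by rewrite mulN1r mulrBl opprB mulNr opprK addrA addrAC subrK addrC.
rewrite augE => h; apply/(mideal_addX _ _ upD); exists (- (v1 *m aug1) 0 0).
by rewrite mulNr opprK addrC.
Qed.

Variable G : sgraph s.

Definition vars_edges W m : bool := hits W m || has_edge G m.

Lemma vars_edges_up W : up_closed (vars_edges W).
Proof.
move=> m k /orP [h|h]; apply/orP; [left | right].
  exact: hits_up h.
exact: has_edge_up h.
Qed.

Lemma mideal_iff D D' : (forall m, D m = D' m) ->
  forall f : S, mideal D f <-> mideal D' f.
Proof. by move=> E f; split; apply: mideal_sub => m; rewrite E. Qed.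

Lemma variables_resolved W (B : nat -> nat -> Prop) : (forall i, B i i) ->
  quotient_resolved B (@mideal K s (hits W)).
Proof.
move=> Bii; pose us := [seq U_(i)%MM | i <- enum W].
have dus : all (fun u => mdeg u == 1%N) us.
  by apply/allP => _ /mapP [i _ ->]; rewrite mdeg1.
have pus : pairwise (@mdisjoint s) us.
  rewrite pairwise_map; have := enum_uniq W; rewrite uniq_pairwise.
  apply: sub_pairwise => i j /= ij; apply/forallP => l; rewrite !mnm1E !eqb0.
  by case: (eqVneq i l) => //= <-; rewrite eq_sym.
have [F [[gF rF _] shF _ _]] := koszul K (ltn0Sn 0) dus pus.
have E m : divisible us m = hits W m.
  apply/hasP/hitsP => [[_ /mapP [i iW ->]]|[i iW mi]].
    by rewrite lep1mP -lt0n => mi; exists i; rewrite // -mem_enum.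
  by exists U_(i)%MM; [apply: map_f; rewrite mem_enum | rewrite lep1mP -lt0n].
apply: quotient_resolved_ext (mideal_iff E) _.
by apply: complex_resolved gF rF _ => i a; rewrite shF mul1n.
Qed.

(** Splitting off a vertex x on an edge: the colon ideal by x is the ideal for
    W + N(x), and adding x gives the ideal for W + x. A stable set that is counted
    for W + N(x) can be enlarged by x, which compensates for the shift by 1. Isolated
    vertices are not counted, since x becomes isolated in the colon ideal. *)
Lemma vars_edges_resolved W r :
  (forall A, stable G A -> {in A, forall a, a \notin W /\ exists2 y, y \notin W & G a y} ->
     (#|A| <= r)%N) ->
  quotient_resolved (fun i j => j <= i + r)%N (@mideal K s (vars_edges W)).
Proof.
move: {2}#|~: W| (leqnn #|~: W|) => n; elim: n W r => [|n IH] W r Wn hr.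
  have WT : W = setT.
    apply/setP => x; rewrite inE; move: Wn; rewrite leqn0 cards_eq0 => /eqP/setP/(_ x).
    by rewrite !inE => /negbFE.
  apply: (@quotient_resolved_ext _ _ _ (@mideal K s (hits W))); last first.
    by apply: variables_resolved => i; apply: leq_addr.
  apply: mideal_iff => m; rewrite /vars_edges; case: hitsP => //= no.
  apply/esym/negbTE/negP => /has_edgeP [i [j [_ mi _]]]; apply: no; exists i => //.
  by rewrite WT inE.
have [/existsP [x /existsP [y /and3P [xy xW yW]]]|noedge] :=
    boolP [exists x, exists y, [&& G x y, x \notin W & y \notin W]]; last first.
  apply: (@quotient_resolved_ext _ _ _ (@mideal K s (hits W))); last first.
    by apply: variables_resolved => i; apply: leq_addr.
  apply: mideal_iff => m; rewrite /vars_edges; case: hitsP => //= no.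
  apply/esym/negbTE/negP => /has_edgeP [i [j [ij mi mj]]]; move: noedge.
  rewrite negb_exists => /forallP /(_ i); rewrite negb_exists => /forallP /(_ j).
  rewrite ij /= negb_and !negbK => /orP [h|h]; apply: no; by [exists i | exists j].
pose N := [set z | G x z].
have r0 : (0 < r)%N.
  rewrite -(cards1 x); apply: hr.
    by apply/stableP => a b /set1P -> /set1P ->; rewrite adj_irr.
  by move=> a /set1P ->; split=> //; exists y.
case: r r0 hr => // r _ hr.
have smaller z W' : z \notin W -> z \in W' -> W \subset W' -> (#|~: W'| <= n)%N.
  move=> zW zW' WW'; rewrite -ltnS; apply: leq_trans Wn; apply: proper_card.
  rewrite properC properE WW' /=; apply/subsetPn; by exists z.
have R1 : quotient_resolved (fun i j => j <= i + r)%N (@mideal K s (vars_edges (W :|: N))).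
  apply: IH; first by apply: (smaller y); rewrite ?subsetUl // !inE xy orbT.
  move=> A stA hA; have xA : x \notin A.
    by apply/negP => /hA [_ [z]]; rewrite !inE negb_or => /andP [_ /negbTE ->].
  have := hr (x |: A); rewrite cardsU1 xA add1n ltnS; apply.
    apply/stableP => a b; move/stableP: stA => stA.
    have nx c : c \in A -> ~~ G x c by case/hA; rewrite !inE negb_or => /andP [].
    move=> /setU1P [->|aA] /setU1P [->|bA]; rewrite ?adj_irr //; [exact: nx| |exact: stA].
    by rewrite adjC nx.
  move=> a /setU1P [->|/hA]; first by split=> //; exists y.
  case; rewrite inE negb_or => /andP [aW _] [z zW az]; split=> //.
  by exists z => //; apply: contra zW; rewrite inE => ->.
have R2 : quotient_resolved (fun i j => j <= i + r.+1)%N (@mideal K s (vars_edges (x |: W))).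
  apply: IH; first by apply: (smaller x); rewrite ?subsetUr // setU11.
  move=> A stA hA; apply: hr => // a /hA []; rewrite in_setU1 negb_or => /andP [_ aW] [z].
  by rewrite in_setU1 negb_or => /andP [_ zW] az; split=> //; exists z.
apply: (quotient_horseshoe (u := U_(x)%MM) (B1 := fun i j => j <= i + r)%N).
- exact: vars_edges_up.
- by move=> i j; rewrite mdeg1 add1n addnS ltnS.
- apply: quotient_resolved_ext R1; apply: mideal_iff => m.
  apply/orP/orP => [[/hitsP [i]|/has_edgeP [i [j [ij mi mj]]]]|
    [/hitsP [i iW]|/has_edgeP [i [j [ij]]]]].
  + rewrite !inE => /orP [iW|xi] mi;
      [left; apply/hitsP; exists i | right; apply/has_edgeP; exists x, i] => //.
      by rewrite mnmDE addn_gt0 mi orbT.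
    by rewrite !mnmDE !addn_gt0 mi mnm1E eqxx orbT.
  + by right; apply/has_edgeP; exists i, j; rewrite !mnmDE !addn_gt0 mi mj !orbT.
  + rewrite mnmDE mnm1E; case: eqP => [xi|_]; first by rewrite -xi (negbTE xW) in iW.
    by move=> mi; left; apply/hitsP; exists i; rewrite // inE iW.
  rewrite !mnmDE !mnm1E; case: eqP => [xi|_]; case: eqP => [xj|_] mi mj.
  + by move: ij; rewrite -xi -xj adj_irr.
  + by left; apply/hitsP; exists j; rewrite // !inE xi ij orbT.
  + by left; apply/hitsP; exists i; rewrite // !inE xj adjC ij orbT.
  by right; apply/has_edgeP; exists i, j.
apply: quotient_resolved_ext R2; apply: mideal_iff => m.
rewrite /vars_edges lep1mP -lt0n orbAC; congr (_ || _).
apply/hitsP/orP => [[i /setU1P [->|iW] mi]|[/hitsP [i iW mi]|mx]].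
- by right.
- by left; apply/hitsP; exists i.
- by exists i; rewrite // setU1r.
by exists x; rewrite // setU11.
Qed.

Local Notation EI := (@edge_ideal s G K).

Lemma edge_ideal_resolved : quotient_resolved (fun i j => j <= i + beta0 G)%N EI.
Proof.
apply: quotient_resolved_ext (@vars_edges_resolved set0 (beta0 G) _); last first.
  by move=> A stA _; apply: (leq_bigmax_cond (F := fun A : {set 'I_s} => #|A|)).
move=> f; rewrite edge_idealP; apply: mideal_iff => m; rewrite /vars_edges.
by case: hitsP => // -[i]; rewrite inE.
Qed.

Lemma edge_ideal_graded : graded_ideal EI.
Proof.
have [[I0 ID IM] gI] := mideal_graded (@has_edge_up s G).
split; [split|].
- exact/edge_idealP.
- by move=> f g /edge_idealP hf /edge_idealP hg; apply/edge_idealP/ID.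
- by move=> f g /edge_idealP hf; apply/edge_idealP/IM.
by move=> d f /edge_idealP hf; apply/edge_idealP/gI.
Qed.

Lemma edge_ideal_shift F : minimal_graded_free_resolution EI F ->
  forall i a, (@res_shift K s F i a <= i + beta0 G)%N.
Proof.
move=> minF; apply: (minimal_shift (phi := idfun) (B := fun i j => j <= i + beta0 G)%N)
  (edge_ideal_resolved) edge_ideal_graded _ _ _ minF _ _ => //.
- by case: edge_ideal_graded.
- exact: map_mx_id.
by move=> i; exact: map_mx_id.
Qed.

Lemma betti_neq0 F i j : betti F i j != 0%N <-> exists a, @res_shift K s F i a = j.
Proof.
rewrite cards_eq0; split=> [/set0Pn [a]|[a aj]]; first by rewrite inE => /eqP; exists a.
by apply/set0Pn; exists a; rewrite inE aj.
Qed.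

(** The maximum exists because all degrees are bounded by edge_ideal_shift. *)
Lemma regularity_spec : is_regularity EI (regularity_quotient EI).
Proof.
apply: epsilon_spec; have EI0 f : EI f -> f@_0%MM = 0.
  move/edge_idealP/midealP; apply; apply/negP => /has_edgeP [i [j [_]]].
  by rewrite mnm0E.
have [F [minF b00]] := minimal_resolution_exists edge_ideal_resolved edge_ideal_graded EI0.
pose P (r : nat) := exists i, betti F i (i + r)%N != 0%N.
have Pb r : P r -> (r <= beta0 G)%N.
  by case=> i /betti_neq0 [a aE]; have := edge_ideal_shift minF a; rewrite aE leq_add2l.
have P0 : exists n, (n <= beta0 G)%N /\ P (beta0 G - n)%N.
  by exists (beta0 G); rewrite subnn; split=> //; exists 0%N; apply/eqP.
have [n [[nb [i bi]] minn]] := least_nat P0.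
exists (beta0 G - n)%N, F; split=> //; first by exists i.
move=> k j bkj; rewrite leqNgt; apply/negP => lt.
have kj : (k <= j)%N by lia.
have Pjk : P (j - k)%N by exists k; rewrite subnKC.
have jkb := Pb _ Pjk.
have := minn (beta0 G - (j - k))%N; rewrite leq_subr subKn // => /(_ (conj isT Pjk)).
lia.
Qed.

Theorem regularity_leq_beta0 : (regularity_quotient EI <= beta0 G)%N.
Proof.
have [F [minF [i /betti_neq0 [a aE]] _]] := regularity_spec.
by have := edge_ideal_shift minF a; rewrite aE leq_add2l.
Qed.

(** For an induced matching M, the Koszul complex on the products of its edges
    resolves the quotient by a smaller ideal, and sending the other variables to 0
    maps I(G) back to it. *)
Theorem matching_leq_regularity : (induced_matching_number G <= regularity_quotient EI)%N.
Proof.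
have [F [[gF rF minF] _ regF]] := regularity_spec.
apply/bigmax_leqP => M /andP [/andP [/subsetP Medges triv] /forall_inP ind].
have edgeP e : e \in M -> exists i j, G i j /\ e = [set i; j].
  by case/Medges/imsetP => -[i j] /= ij ->; exists i, j.
pose us := [seq mnm_set e | e <- enum M].
have dus : all (fun u => mdeg u == 2%N) us.
  apply/allP => u /mapP [e]; rewrite mem_enum => /edgeP [i [j [ij eE]]] ->.
  by rewrite mdeg_mnm_set eE cards2 (adj_neq ij).
have pus : pairwise (@mdisjoint s) us.
  rewrite pairwise_map; have := enum_uniq M; rewrite uniq_pairwise.
  have disj : {in mem M &, subrel [rel x y | x != y] (relpre (@mnm_set s) (@mdisjoint s))}.
    move=> e e' eM e'M /= ee'; apply/forallP => l; rewrite !mnmE !eqb0 -negb_and.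
    apply/negP => /andP [le le'].
    by move/trivIsetP: triv => /(_ e e' eM e'M ee') /disjoint_setI0/setP/(_ l); rewrite !inE le le'.
  by apply: (sub_in_pairwise disj); apply/allP => e; rewrite mem_enum.
have [X [minX shX rkX phiX]] := koszul K (isT : 0 < 2)%N dus pus.
pose phi : {rmorphism S -> S} := @kill K s (~: cover M).
have phius u : u \in us -> phi 'X_[u] = 'X_[u].
  case/mapP => e; rewrite mem_enum => eM ->; rewrite /= kill_monomial.
  case: hitsP => // -[i]; rewrite inE mnm_set_gt0 => /negP icov ie; case: icov.
  by apply/bigcupP; exists e.
have [phia phid] := phiX phi phius.
have bF i a : betti F i (@res_shift K s F i a) != 0%N by apply/betti_neq0; exists a.
have RY := complex_resolved (B := fun i j => betti F i j != 0%N) gF rF bF.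
have szus : size us = #|M| by rewrite size_map -cardE.
have [a _] : exists a : 'I_(res_rank X (size us)), true.
  by case: (res_rank X (size us)) rkX => // n _; exists ord0.
have := minimal_shift (phi := phi) _ RY edge_ideal_graded _ _ _ minX phia phid a.
rewrite shX => h; have /regF : betti F (size us) (2 * size us) != 0%N.
  apply: h.
  - by move=> p p0; rewrite mcoeff_kill p0 if_same.
  - exact/mideal_ideal/divisible_up.
  - move=> f hf; apply/edge_idealP; apply: mideal_sub hf => m /hasP [_ /mapP [e eM ->]].
    rewrite mem_enum in eM; have [i [j [ij eE]]] := edgeP e eM.
    move=> /mnm_lepP em; apply/has_edgeP; exists i, j; split=> //.
      by apply: leq_trans (em i); rewrite mnm_set_gt0 eE set21.
    by apply: leq_trans (em j); rewrite mnm_set_gt0 eE set22.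
  move=> f /edge_idealP hf; apply/midealP => m nd; rewrite mcoeff_kill.
  case: hitsP => // nh; apply/eqP; rewrite mcoeff_eq0.
  apply: contra nd => /hf /has_edgeP [i [j [ij mi mj]]].
  have cov l : (0 < m l)%N -> l \in cover M.
    by move=> ml; apply: contraT => nl; case: nh; exists l; rewrite // inE.
  have eM : [set i; j] \in M.
    have eG : [set i; j] \in edges G by apply/imsetP; exists (i, j).
    have /implyP := ind _ eG; apply.
    by apply/subsetP => l /set2P [] ->; apply: cov.
  apply/hasP; exists (mnm_set [set i; j]); first by apply: map_f; rewrite mem_enum.
  apply/mnm_lepP => l; rewrite mnmE; case: set2P => // -[] ->.
    exact: mi.
  exact: mj.
by rewrite szus; lia.
Qed.

End Regularity.

Local Open Scope nat_scope.

Theorem corollary4p10 (K : fieldType) (s : nat) (G : sgraph s)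
    (hwc : well_covered G)
    (hG : simplicial_graph G \/
          [/\ connected_graph G, ~ contains_cycle G 4 & ~ contains_cycle G 5]) :
  [/\ vnumber (@edge_ideal s G K) <= induced_matching_number G,
      induced_matching_number G <= regularity_quotient (@edge_ideal s G K)
    & regularity_quotient (@edge_ideal s G K) <= beta0 G].
Proof.
split; [|exact: matching_leq_regularity|exact: regularity_leq_beta0].
have [A [stA covA leA]] := exists_nbhd_covers hwc hG.
exact: leq_trans (vnumber_leq (nbhd_covers_v_degree K stA covA)) leA.
Qed.
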